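(* The function $V:\mathbb{R}^n\times[0,T]\to\mathbb{R}$, $$V(x,t)=\inf_{\gamma\in\Gamma_{[t,T]}}\ \sup_{v(\cdot)\in\mathcal V_{[t,T]}}\ \max\Big\{\, l\big(\phi(T,t,x,\gamma[v](\cdot),v(\cdot))\big),\ \max_{\tau\in[t,T]} h\big(\phi(\tau,t,x,\gamma[v](\cdot),v(\cdot))\big)\Big\},$$ is the unique (continuous) viscosity solution over $(x,t)\in\mathbb{R}^n\times[0,T]$ of the variational inequality $$\max\Big\{ h(x)-V(x,t),\ \frac{\partial V}{\partial t}(x,t)+\sup_{v\in \mathbf V}\inf_{u\in U}\frac{\partial V}{\partial x}(x,t)\, f(x,u,v)\Big\}=0,$$ with terminal condition $V(x,T)=\max\{l(x),h(x)\}$ for all $x\in\mathbb{R}^n$.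
   Context: Setting. $T\ge 0$ is a time horizon; $U\subseteq\mathbb{R}^m$ and $\mathbf V\subseteq\mathbb{R}^p$ are nonempty compact sets. $f:\mathbb{R}^n\times U\times \mathbf V\to\mathbb{R}^n$, $l:\mathbb{R}^n\to\mathbb{R}$ and $h:\mathbb{R}^n\to\mathbb{R}$ are bounded and Lipschitz continuous in $x$, and $f$ is continuous in $u$ and $v$; explicitly there are constants $C_f,C_l,C_h>0$ such that for all $x,\hat x\in\mathbb{R}^n$, $u\in U$, $v\in \mathbf V$: $|f(x,u,v)|\le C_f$, $|f(x,u,v)-f(\hat x,u,v)|\le C_f|x-\hat x|$, $|l(x)|\le C_l$, $|l(x)-l(\hat x)|\le C_l|x-\hat x|$, $|h(x)|\le C_h$, $|h(x)-h(\hat x)|\le C_h|x-\hat x|$. For $t\le t'$, $\mathcal U_{[t,t']}$ and $\mathcal V_{[t,t']}$ denote the sets of Lebesgue measurable functions from $[t,t']$ to $U$ and $\mathbf V$ respectively. For $t\in[0,T]$, $x\in\mathbb{R}^n$, $u(\cdot)\in\mathcal U_{[t,T]}$, $v(\cdot)\in\mathcal V_{[t,T]}$, $\phi(\tau,t,x,u(\cdot),v(\cdot))$ for $\tau\in[t,T]$ denotes the value at time $\tau$ of the unique (absolutely continuous) solution of $\dot x(s)=f(x(s),u(s),v(s))$ a.e. with $x(t)=x$. $\Gamma_{[t,t']}$ is the set of non-anticipative strategies: maps $\gamma:\mathcal V_{[t,t']}\to\mathcal U_{[t,t']}$ such that for all $s\in[t,t']$ and $v,\hat v\in\mathcal V_{[t,t']}$,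 if $v(\tau)=\hat v(\tau)$ for a.e. $\tau\in[t,s]$ then $\gamma[v](\tau)=\gamma[\hat v](\tau)$ for a.e. $\tau\in[t,s]$. Viscosity solution. A continuous function $V:\mathbb{R}^n\times[0,T]\to\mathbb{R}$ is a viscosity solution of the variational inequality with the given terminal condition if it satisfies the terminal condition and, for every $(x_0,t_0)\in\mathbb{R}^n\times(0,T)$ and every smooth $W:\mathbb{R}^n\times(0,T)\to\mathbb{R}$: (1) if $V-W$ attains a local maximum at $(x_0,t_0)$, then $\max\{h(x_0)-V(x_0,t_0),\ \frac{\partial W}{\partial t}(x_0,t_0)+\sup_{v\in \mathbf V}\inf_{u\in U}\frac{\partial W}{\partial x}(x_0,t_0)f(x_0,u,v)\}\ge 0$; (2) if $V-W$ attains a local minimum at $(x_0,t_0)$, then the same expression is $\le 0$. *)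

(* Defs.v *)
From HB Require Import structures.
From mathcomp Require Import all_boot all_order all_algebra.
From mathcomp Require Import all_classical all_reals all_analysis.

Set Implicit Arguments.
Unset Strict Implicit.
Unset Printing Implicit Defensive.

Import Order.TTheory GRing.Theory Num.Theory.
Import numFieldNormedType.Exports.

Local Open Scope classical_set_scope.
Local Open Scope ring_scope.

(** Conventions.
    - R^k is ['rV[R]_k] with the library (sup) norm; norms enter only through
      bounds with arbitrary constants and through the topology.
    - A function whose mathematical domain is a subset (a time interval, U x V,
      R^n x [0,T], ...) is a total function constrained on that subset only.
    - [sup] and [inf] are the real-valued ones, junk on empty or unbounded sets;
      under the standing assumptions they are applied to nonempty bounded sets. *)

(** Lebesgue measurability: the source carries the (complete) sigma-algebra of
    Lebesgue measurable sets, not the Borel one, and the target the Borel sets. *)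
Definition lebesgue_measurable_fun (R : realType) (k : nat) (D : set R)
    (g : R -> 'rV[R]_k) : Prop :=
  @measurable_fun _ _ (caratheodory_type (@wlength R idfun)^*%mu)
    (g_sigma_algebraType (@open 'rV[R]_k)) D g.

Definition controls (R : realType) (k : nat) (K : set 'rV[R]_k) (t t' : R) :
    set (R -> 'rV[R]_k) :=
  [set u | lebesgue_measurable_fun `[t, t'] u /\
           forall s, s \in `[t, t'] -> K (u s)].

(** Taking s = t' shows that, up to null sets, gamma v on [t, t'] depends only
    on v on [t, t']: values of v or gamma v outside [t, t'] have no effect on
    trajectories, so total functions faithfully represent controls. *)
Definition strategies (R : realType) (m p : nat) (U : set 'rV[R]_m)
    (VV : set 'rV[R]_p) (t t' : R) :
    set ((R -> 'rV[R]_p) -> (R -> 'rV[R]_m)) :=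
  [set gamma |
    (forall v, controls VV t t' v -> controls U t t' (gamma v)) /\
    (forall s v v', s \in `[t, t'] ->
       controls VV t t' v -> controls VV t t' v' ->
       {ae lebesgue_measure, forall tau, tau \in `[t, s] -> v tau = v' tau} ->
       {ae lebesgue_measure, forall tau, tau \in `[t, s] ->
         gamma v tau = gamma v' tau})].

Definition absolutely_continuous_on (R : realType) (n : nat) (a b : R)
    (y : R -> 'rV[R]_n) : Prop :=
  forall e : R, 0 < e -> exists2 d : R, 0 < d &
    forall (k : nat) (I : 'I_k -> R * R),
      (forall i, a <= (I i).1 /\ (I i).1 <= (I i).2 /\ (I i).2 <= b) ->
      trivIset setT (fun i => `](I i).1, (I i).2[%classic) ->
      \sum_(i < k) ((I i).2 - (I i).1) < d ->
      \sum_(i < k) `|y (I i).2 - y (I i).1| < e.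

Section differential_game.
Context {R : realType} {n m p : nat}.
Variables (T : R) (U : set 'rV[R]_m) (VV : set 'rV[R]_p).
Variable f : 'rV[R]_n -> 'rV[R]_m -> 'rV[R]_p -> 'rV[R]_n.
Variables l h : 'rV[R]_n -> R.

Definition solves_ode (t : R) (x : 'rV[R]_n) (u : R -> 'rV[R]_m)
    (v : R -> 'rV[R]_p) (y : R -> 'rV[R]_n) : Prop :=
  [/\ absolutely_continuous_on t T y,
      y t = x &
      {ae lebesgue_measure, forall s, s \in `[t, T] ->
        is_derive s (1 : R) y (f (y s) (u s) (v s))}].

(** "The" solution: its restriction to [t, T] is unique under the standing
    assumptions, whatever function is selected. *)
Definition phi (tau t : R) (x : 'rV[R]_n) (u : R -> 'rV[R]_m)
    (v : R -> 'rV[R]_p) : 'rV[R]_n :=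
  xget (cst x) [set y | solves_ode t x u v y] tau.

(** The maximum over [t, T] of the continuous function h o phi, written as a
    supremum. *)
Definition payoff (t : R) (x : 'rV[R]_n) (u : R -> 'rV[R]_m)
    (v : R -> 'rV[R]_p) : R :=
  Num.max (l (phi T t x u v))
          (sup [set h (phi tau t x u v) | tau in `[t, T]]).

Definition value (z : 'rV[R]_n * R) : R :=
  inf [set sup [set payoff z.2 z.1 (gamma v) v | v in controls VV z.2 T]
      | gamma in strategies U VV z.2 T].

Definition hamiltonian (x q : 'rV[R]_n) : R :=
  sup [set inf [set \sum_(i < n) q 0 i * f x u v 0 i | u in U] | v in VV].

(** W is C^k on the open set D: it is differentiable there and, in finite
    dimension, its differential is C^(k-1) iff all its values on fixed
    directions are. *)
Fixpoint class_C (k : nat) (D : set ('rV[R]_n * R)) (W : 'rV[R]_n * R -> R) :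
    Prop :=
  match k with
  | 0%N => forall z, D z -> {for z, continuous W}
  | k'.+1 => (forall z, D z -> differentiable W z) /\
             (forall w : 'rV[R]_n * R, class_C k' D (fun z => 'D_w W z))
  end.

Definition smooth_on (D : set ('rV[R]_n * R)) (W : 'rV[R]_n * R -> R) : Prop :=
  forall k, class_C k D W.

Definition partial_t (W : 'rV[R]_n * R -> R) (z : 'rV[R]_n * R) : R :=
  derive1 (fun t : R => W (z.1, t)) z.2.

Definition partial_x (W : 'rV[R]_n * R -> R) (z : 'rV[R]_n * R) : 'rV[R]_n :=
  \row_(i < n) 'D_(delta_mx 0 i) (fun x : 'rV[R]_n => W (x, z.2)) z.1.

(** Left-hand side of the variational inequality at z, with the derivatives
    taken on the test function W. *)
Definition vi_lhs (V W : 'rV[R]_n * R -> R) (z : 'rV[R]_n * R) : R :=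
  Num.max (h z.1 - V z) (partial_t W z + hamiltonian z.1 (partial_x W z)).

Definition viscosity_solution (V : 'rV[R]_n * R -> R) : Prop :=
  [/\ {within [set z : 'rV[R]_n * R | z.2 \in `[0, T]], continuous V},
      forall x, V (x, T) = Num.max (l x) (h x) &
      forall (z0 : 'rV[R]_n * R) (W : 'rV[R]_n * R -> R),
        z0.2 \in `]0, T[ ->
        smooth_on [set z | z.2 \in `]0, T[] W ->
        ((\forall z \near z0, V z - W z <= V z0 - W z0) ->
           0 <= vi_lhs V W z0) /\
        ((\forall z \near z0, V z0 - W z0 <= V z - W z) ->
           vi_lhs V W z0 <= 0)].

End differential_game.

(* Main.v *)
(** The value function satisfies both halves of the dynamic programming principle,
    by concatenating controls and gluing near-optimal non-anticipative strategies;
    differentiating a test function along trajectories turns them into the two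
    viscosity inequalities.  For the subsolution property the opponent's
    open-loop control is answered pointwise by a countably valued selection
    [v |-> u], which exists because [VV] is separable and [f] is continuous in
    [v].  Uniqueness is a comparison principle on forward cones of speed
    [c > n Cf]: if [V1 - V2] were positive at a point, a penalty growing towards
    the lateral boundary would turn [V1] into a strict subsolution, and doubling
    the variables contradicts the viscosity inequalities.  All the test functions
    needed are quadratic polynomials. *)

Require Import Defs.
From HB Require Import structures.
From mathcomp Require Import all_boot all_order all_algebra.
From mathcomp Require Import all_classical all_reals all_analysis.
From mathcomp Require Import measurable_realfun ring lra.
Import Order.TTheory GRing.Theory Num.Theory.
Import numFieldNormedType.Exports.
Local Open Scope classical_set_scope.
Local Open Scope ring_scope.

Set Implicit Arguments.
Unset Strict Implicit.
Unset Printing Implicit Defensive.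

(** * Absolutely continuous functions with a.e. nonpositive derivative *)

(** Trajectories are only absolutely continuous, so differential estimates go through one principle:
    an absolutely continuous real function with a.e. nonpositive derivative does not increase.
    Lipschitz bounds, Gronwall, the Picard contraction and the drift of a test function all derive
    from it, coordinate by coordinate because the norm is a sup norm. In the uniqueness part the
    competing solution is merely continuous: no bound or modulus of continuity at infinity is
    available. Since speeds are bounded and data are prescribed at the final time, the solution at a
    point depends only on later points in a cone; truncated at [T] this cone is compact, and
    compactness supplies both maxima and uniform continuity. The factor [n] in its speed comes from
    pairing gradients with [f] coordinatewise, each coordinate of [f] being at most [Cf]. Strictness
    is due to a small penalty linear in time, which has to dominate the errors of doubling; the
    precision of doubling is therefore fixed after that penalty. *)

(** Induction along the interval: the condition to the left of the supremum [c] of the points with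
    [g x <= g a] puts [c] among them, and the condition to its right moves past [c] unless
    [c = b]. *)
Lemma locally_nonincreasing_le (R : realType) (g : R -> R) (a b : R) : a <= b ->
  (forall x, a <= x <= b -> exists2 d, 0 < d & forall y, a <= y <= b ->
     `|y - x| < d -> (x <= y -> g y <= g x) /\ (y <= x -> g x <= g y)) ->
  g b <= g a.
Proof.
move=> ab loc; pose S := [set x | a <= x <= b /\ g x <= g a].
have Sa : S a by split; rewrite ?lexx ?ab.
have Sb : ubound S b by move=> x [/andP[]].
have hS : has_sup S by split; [exists a | exists b].
set c := sup S.
have ac : a <= c by apply: sup_upper_bound.
have cb : c <= b by apply: ge_sup => //; exists a.
have [d d0 hd] := loc c (introT andP (conj ac cb)).
have [x Sx xc] := sup_adherent d0 hS.
have xlec : x <= c by apply: sup_upper_bound.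
have [xab gx] := Sx.
have Sc : g c <= g a.
  apply: le_trans gx; apply: (proj2 (hd x xab _)) => //.
  rewrite ler0_norm ?subr_le0//; rewrite -/c in xc; lra.
have [->//|ncb] := eqVneq b c.
have ltcb : c < b by rewrite lt_neqAle eq_sym ncb.
pose y := Num.min b (c + d / 2).
have cy : c < y by rewrite /y lt_min ltcb/=; lra.
have yb : y <= b by rewrite /y ge_min lexx.
have yc : y <= c + d / 2 by rewrite /y ge_min lexx orbT.
have yab : a <= y <= b by rewrite yb andbT; lra.
have Sy : S y.
  split => //; apply: le_trans Sc; apply: (proj1 (hd y yab _)); last exact: ltW.
  by rewrite gtr0_norm ?subr_gt0//; lra.
have : y <= c by apply: sup_upper_bound.
lra.
Qed.

(** Convertible to [absolutely_continuous_on] for row vectors; the general codomain also covers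
    coordinates and a test function along a trajectory. *)
Definition ac_on (R : realType) (V : normedModType R) (a b : R) (g : R -> V) :
    Prop :=
  forall e : R, 0 < e -> exists2 d : R, 0 < d &
    forall (k : nat) (I : 'I_k -> R * R),
      (forall i, a <= (I i).1 /\ (I i).1 <= (I i).2 /\ (I i).2 <= b) ->
      trivIset setT (fun i => `](I i).1, (I i).2[%classic) ->
      \sum_(i < k) ((I i).2 - (I i).1) < d ->
      \sum_(i < k) `|g (I i).2 - g (I i).1| < e.

Lemma negligible_open_cover (R : realType) (N : set R) (d : R) : 0 < d ->
  lebesgue_measure.-negligible N ->
  exists G : set R, [/\ open G, N `<=` G & (lebesgue_measure G < d%:E)%E].
Proof.
move=> d0 [A [mA A0 NA]].
have Aoo : (lebesgue_measure A < +oo)%E by rewrite A0.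
have [G [oG AG mG]] := lebesgue_regularity_outer mA Aoo d0.
exists G; split => //; first exact: subset_trans AG.
rewrite (le_lt_trans _ mG)// measureD//=; last 2 first.
- exact: open_measurable.
- rewrite (_ : G = (G `\` A) `|` A); last by rewrite setUC setDUK.
  rewrite (le_lt_trans (measureU2 _ _ _))//=.
  - by apply: measurableD => //; exact: open_measurable.
  - by rewrite [X in (_ + X)%E]A0 adde0 (lt_trans mG)// ltry.
rewrite (_ : G `&` A = A); last by rewrite setIC; apply/setIidPl.
by rewrite [X in (_ - X)%E]A0 sube0.
Qed.

Lemma sum_itv_le_measure (R : realType) (O : set R) (k : nat) (I : 'I_k -> R * R) :
  open O -> (forall i, (I i).1 <= (I i).2) ->
  (forall i, `](I i).1, (I i).2[%classic `<=` O) ->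
  trivIset setT (fun i => `](I i).1, (I i).2[%classic) ->
  ((\sum_(i < k) ((I i).2 - (I i).1))%:E <= lebesgue_measure O)%E.
Proof.
move=> oO hI IO tI.
have -> : (\sum_(i < k) ((I i).2 - (I i).1))%:E =
   lebesgue_measure (\big[setU/set0]_(i < k) `](I i).1, (I i).2[%classic).
  rewrite measure_semi_additive_ord//; last by apply: bigsetU_measurable.
  rewrite -sumEFin; apply: eq_bigr => i _.
  apply: etrans (esym (lebesgue_measure_itv _)); rewrite /= lte_fin.
  case: ltP => // h; have -> : (I i).2 = (I i).1 by apply/eqP; rewrite eq_le h hI.
  by rewrite subrr.
apply: le_measure; rewrite ?inE.
- by apply: bigsetU_measurable.
- exact: open_measurable.
- by apply: (big_ind (fun X => X `<=` O)) => // A B AO BO x [/AO|/BO].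
Qed.

(** Clearing the denominator gives a two-sided linear estimate that includes [t = s]; monotonicity
    arguments and coordinatewise passages use this form. *)
Lemma is_derive1P (R : realType) (V : normedModType R) (y : R -> V) (s : R) (d : V) :
  is_derive s (1 : R) y d <->
  (forall e : R, 0 < e -> exists2 r : R, 0 < r & forall t : R, `|t - s| < r ->
     `|y t - y s - (t - s) *: d| <= e * `|t - s|).
Proof.
split=> [[dy <-] e e0|hd].
  have /cvgrPdist_le/(_ e e0) := dy.
  rewrite -/(derive y s 1).
  move/nbhs_ballP => [r /= r0 hr]; exists r => // t tr.
  have [->|ts] := eqVneq t s; first by rewrite !subrr scale0r subrr !normr0 mulr0.
  have ts0 : t - s != 0 by rewrite subr_eq0.
  have := hr (t - s); rewrite /ball/= sub0r normrN => /(_ tr ts0).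
  rewrite /= -[_%:A]/((t - s) * 1) mulr1 /= subrK => h.
  have -> : y t - y s - (t - s) *: derive y s 1 =
    - ((t - s) *: (derive y s 1 - (t - s)^-1 *: (y t - y s))).
    by rewrite scalerBr scalerA divff// scale1r opprB.
  by rewrite normrN normrZ mulrC ler_wpM2r.
have : h^-1 *: ((y \o shift s) (h *: 1) - y s) @[h --> 0^'] --> d.
  apply/cvgrPdist_le => e e0; have [r r0 hr] := hd e e0.
  apply/nbhs_ballP; exists r => //= h; rewrite /ball/= sub0r normrN => hr0 h0.
  have := hr (h + s); rewrite addrK => /(_ hr0).
  rewrite -[_%:A]/(h * 1) mulr1 /= => hle.
  have -> : d - h^-1 *: (y (h + s) - y s) = - (h^-1 *: (y (h + s) - y s - h *: d)).
    by rewrite [in RHS]scalerBr scalerA mulVf// scale1r opprB.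
  rewrite normrN normrZ normfV mulrC ler_pdivrMr ?normr_gt0//.
move=> hl; apply: DeriveDef; first by apply/cvg_ex; exists d.
exact/cvg_lim.
Qed.

(* The exceptional null set is covered by an open [G] of small measure; subtracting
   the variation [m] of [g] inside [G] and the drift [e * x] makes [g] nonincreasing
   near every point. *)
Lemma ac_nonincreasing (R : realType) (g : R -> R) (a b : R) : a <= b ->
  ac_on a b g ->
  {ae lebesgue_measure, forall s, s \in `[a, b] ->
     exists2 d, d <= 0 & is_derive s (1 : R) g d} ->
  g b <= g a.
Proof.
move=> ab acg aeg.
suff H e : 0 < e -> g b - g a <= e * (b - a) + e.
  rewrite -subr_le0; apply/ler_addgt0Pl => e e0; rewrite addr0.
  have c0 : 0 < b - a + 1 by lra.
  have := H (e / (b - a + 1)) (divr_gt0 e0 c0).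
  by rewrite -[X in _ <= _ + X](mulr1 (e / _)) -mulrDr divfK// gt_eqF.
move=> e0; have [d d0 hd] := acg e e0.
have [G [oG NG mG]] := negligible_open_cover d0 aeg.
(* Variation sums over finite disjoint families inside [G], up to [x]. Absolute continuity bounds
   them by [e] because [G] has measure less than [d]. *)
pose S x := [set r | exists (k : nat) (I : 'I_k -> R * R),
   [/\ forall i, a <= (I i).1 /\ (I i).1 <= (I i).2 /\ (I i).2 <= x,
      trivIset setT (fun i => `](I i).1, (I i).2[%classic),
      (forall i, `](I i).1, (I i).2[%classic `<=` G) &
      r = \sum_(i < k) `|g (I i).2 - g (I i).1|]].
have S0 x : S x 0.
  exists 0%N, (fun i => (0, 0)); split => //; try by case.
  by rewrite big_ord0.
have Sub x : x <= b -> ubound (S x) e.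
  move=> xb r [k [I [h1 h2 h3 ->]]]; apply/ltW/hd => //.
    by move=> i; have [h4 [h5 h6]] := h1 i; do 2!split => //; exact: le_trans xb.
  rewrite -lte_fin (le_lt_trans _ mG)//; apply: sum_itv_le_measure => //.
  by move=> i; have [? []] := h1 i.
have hS x : x <= b -> has_sup (S x).
  by move=> xb; split; [exists 0|exists e; exact: Sub].
pose m x := sup (S x).
have m0 x : x <= b -> 0 <= m x by move=> xb; apply: sup_upper_bound => //; exact: hS.
have me x : x <= b -> m x <= e by move=> xb; apply: ge_sup; [exists 0|exact: Sub].
have mmono x y : x <= y -> y <= b -> m x <= m y.
  move=> xy yb; apply: sup_le; [|by exists 0|exact: hS].
  move=> r [k [I [h1 h2 h3 h4]]]; exists r; split => //=; exists k, I; split => //.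
  by move=> i; have [? [? ?]] := h1 i; do 2!split => //; exact: le_trans xy.
(* The interval []x, y[] can be added to any family ending before [x], so [m] grows at least by the
   increment of [g] over it. *)
have mjump x y : a <= x -> x <= y -> y <= b -> `]x, y[ `<=` G ->
    `|g y - g x| <= m y - m x.
  move=> ax xy yb xyG; rewrite lerBrDr addrC -lerBrDr.
  apply: ge_sup; first by exists 0.
  move=> r [k [I [h1 h2 h3 ->]]]; rewrite lerBrDr addrC.
  apply: sup_upper_bound; first exact: hS.
  exists k.+1, (fun i => if unlift ord0 i is Some j then I j else (x, y)); split.
  - move=> i; case: unliftP => [j _|_] //=.
    by have [? [? ?]] := h1 j; do 2!split => //; exact: le_trans xy.
  - move=> i j _ _; case: unliftP => [i' ->|->]; case: unliftP => [j' ->|->] //=.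
    + by move=> h; congr lift; apply: (h2 i' j').
    + move=> [z [/= zi zxy]]; exfalso; have [_ [_ hx]] := h1 i'.
      by move: zi zxy; rewrite !in_itv/= => /andP[_ z1] /andP[z2 _]; lra.
    + move=> [z [/= zxy zi]]; exfalso; have [_ [_ hx]] := h1 j'.
      by move: zi zxy; rewrite !in_itv/= => /andP[_ z1] /andP[z2 _]; lra.
  - by move=> i; case: unliftP => [j _|_] //=.
  - rewrite big_ord_recl unlift_none/=; congr (_ + _).
    by apply: eq_bigr => i _; rewrite liftK.
pose q x := g x - e * x - m x.
suff : q b <= q a by rewrite /q; have := m0 a ab; have := me b (lexx b); lra.
apply: locally_nonincreasing_le => // x /andP[ax xb].
have [xG|xG] := pselect (G x).
  have /nbhs_ballP [r r0 hr] := open_nbhs_nbhs (conj oG xG).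
  exists r => // y /andP[ay yb] yx; split => [xy|yx'].
    have : `|g y - g x| <= m y - m x.
      apply: mjump => // z; rewrite /= in_itv/= => /andP[xz zy]; apply: hr.
      rewrite /ball/= ltr0_norm; last lra.
      by move: yx; rewrite ger0_norm; lra.
    by rewrite /q ler_norml => /andP[_]; nra.
  have : `|g x - g y| <= m x - m y.
    apply: mjump => // z; rewrite /= in_itv/= => /andP[yz zx]; apply: hr.
    rewrite /ball/= gtr0_norm; last lra.
    by move: yx; rewrite ler0_norm; lra.
  by rewrite /q ler_norml => /andP[_]; nra.
have : exists2 d, d <= 0 & is_derive x (1 : R) g d.
  apply: contrapT => hx; apply: xG; apply: NG => /= h; apply: hx; apply: h.
  by rewrite in_itv/= ax xb.
move=> [c c0 /is_derive1P/(_ e e0)[r r0 hr]]; exists r => // y /andP[ay yb] yx.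
have := hr y yx; rewrite ler_norml => /andP[h1 h2]; split => xy.
  have := mmono x y xy yb; move: h1 h2; rewrite /q ger0_norm ?subr_ge0//.
  rewrite -[_ *: c]/((y - x) * c); nra.
have := mmono y x xy xb; move: h1 h2; rewrite /q ler0_norm ?subr_le0//.
rewrite -[_ *: c]/((y - x) * c); nra.
Qed.

Lemma ae_mono (R : realType) (P Q : R -> Prop) : (forall s, P s -> Q s) ->
  {ae lebesgue_measure, forall s, P s} -> {ae lebesgue_measure, forall s, Q s}.
Proof. by move=> PQ [A [mA A0 PA]]; exists A; split => // s nQ; apply: PA => /PQ. Qed.

Lemma ae_and (R : realType) (P Q : R -> Prop) :
  {ae lebesgue_measure, forall s, P s} -> {ae lebesgue_measure, forall s, Q s} ->
  {ae lebesgue_measure, forall s, P s /\ Q s}.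
Proof. by move=> aP aQ; apply: (@filterI _ _ (ae_filter_ringOfSetsType _)). Qed.

Lemma rV_norm_leP (R : realType) (n : nat) (x : 'rV[R]_n) (e : R) : 0 <= e ->
  (forall i, `|x 0 i| <= e) <-> `|x| <= e.
Proof.
move=> e0; split => [h|h i].
  rewrite [leLHS]/Num.Def.normr /= mx_normrE; apply/bigmax_leP; split => //= -[i j] _.
  by rewrite ord1; exact: h.
apply: le_trans h; rewrite [leRHS]/Num.Def.normr /= mx_normrE.
by apply/bigmax_geP; right; exists (0, i).
Qed.

(** * Increments of absolutely continuous curves *)

Lemma ac_on_subset (R : realType) (V : normedModType R) (a b a' b' : R) (g : R -> V) :
  a <= a' -> b' <= b -> ac_on a b g -> ac_on a' b' g.
Proof.
move=> aa bb ag e e0; have [d d0 hd] := ag e e0; exists d => // k I hI.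
apply: hd => i; have [? [? ?]] := hI i; split; first exact: le_trans aa _.
by split => //; exact: le_trans bb.
Qed.

Lemma ac_onB (R : realType) (V : normedModType R) (a b : R) (g1 g2 : R -> V) :
  ac_on a b g1 -> ac_on a b g2 -> ac_on a b (fun s => g1 s - g2 s).
Proof.
move=> a1 a2 e e0.
have e20 : 0 < e / 2 by rewrite divr_gt0.
have [d1 d10 hd1] := a1 _ e20; have [d2 d20 hd2] := a2 _ e20.
exists (Num.min d1 d2); first by rewrite lt_min d10.
move=> k I hI tI; rewrite lt_min => /andP[l1 l2].
have := hd1 k I hI tI l1; have := hd2 k I hI tI l2 => h2 h1.
rewrite [e]splitr (le_lt_trans _ (ltrD h1 h2))//.
rewrite -big_split/=; apply: ler_sum => i _.
rewrite (_ : _ - _ = (g1 (I i).2 - g1 (I i).1) - (g2 (I i).2 - g2 (I i).1)).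
  exact: ler_normB.
by rewrite !opprB addrACA [RHS]addrACA; congr (_ + _); rewrite addrC.
Qed.

Lemma lipschitz_ac_on (R : realType) (V : normedModType R) (a b C : R) (g : R -> V) :
  (forall s t, a <= s -> s <= t -> t <= b -> `|g t - g s| <= C * (t - s)) ->
  ac_on a b g.
Proof.
move=> lg e e0; have C0 : 0 < `|C| + 1 by rewrite ltr_wpDl.
exists (e / (`|C| + 1)); first by rewrite divr_gt0.
move=> k I hI tI; rewrite ltr_pdivlMr// mulrC => /(le_lt_trans _); apply.
rewrite mulr_sumr; apply: ler_sum => i _; have [h1 [h2 h3]] := hI i.
apply: (le_trans (lg _ _ h1 h2 h3)); rewrite ler_wpM2r ?subr_ge0//.
by rewrite (le_trans (ler_norm _))// lerDl.
Qed.

Lemma ac_on_coord (R : realType) (n : nat) (a b : R) (z : R -> 'rV[R]_n) (i : 'I_n) :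
  ac_on a b z -> ac_on a b (fun s => z s 0 i).
Proof.
move=> az e e0; have [d d0 hd] := az e e0; exists d => // k I hI tI lI.
apply: le_lt_trans (hd k I hI tI lI); apply: ler_sum => j _.
have := (rV_norm_leP (z (I j).2 - z (I j).1) (normr_ge0 _)).2 (lexx _) i.
by rewrite !mxE.
Qed.

Lemma is_derive_coord (R : realType) (n : nat) (z : R -> 'rV[R]_n) (s : R)
    (c : 'rV[R]_n) (i : 'I_n) :
  is_derive s (1 : R) z c -> is_derive s (1 : R) (fun t => z t 0 i) (c 0 i).
Proof.
move=> /is_derive1P h; apply/is_derive1P => e e0; have [r r0 hr] := h e e0.
exists r => // t tr; apply: le_trans (hr t tr).
have := (rV_norm_leP (z t - z s - (t - s) *: c) (normr_ge0 _)).2 (lexx _) i.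
by rewrite !mxE.
Qed.

Lemma coord_is_derive (R : realType) (n : nat) (z : R -> 'rV[R]_n) (s : R)
    (c : 'rV[R]_n) :
  (forall i, is_derive s (1 : R) (fun t => z t 0 i) (c 0 i)) ->
  is_derive s (1 : R) z c.
Proof.
move=> h; apply/is_derive1P => e e0.
have {}h i : exists r, 0 < r /\ forall t, `|t - s| < r ->
    `|z t 0 i - z s 0 i - (t - s) * c 0 i| <= e * `|t - s|.
  by have /is_derive1P/(_ e e0)[r r0 hr] := h i; exists r.
have [r hr] := choice h.
exists (\big[Num.min/1]_(i < n) r i).
  by elim/big_ind : _ => // [x y x0 y0|i _]; [rewrite lt_min x0|exact: (hr i).1].
move=> t tr; apply/rV_norm_leP; first by rewrite mulr_ge0// ltW.
move=> i; rewrite !mxE; apply: (hr i).2; apply: lt_le_trans tr _.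
exact: bigmin_le.
Qed.

(** A mean value inequality: each [z_i - G] and [- z_i - G] has a.e. nonpositive derivative, and the
    sup norm reassembles the coordinates. *)
Lemma ac_increment (R : realType) (n : nat) (a b : R) (z : R -> 'rV[R]_n)
    (G : R -> R) : a <= b -> ac_on a b z -> ac_on a b G ->
  {ae lebesgue_measure, forall s, s \in `[a, b] ->
     exists c g, [/\ is_derive s (1 : R) z c, is_derive s (1 : R) G g & `|c| <= g]} ->
  `|z b - z a| <= G b - G a.
Proof.
move=> ab az aG h.
have ac0 : ac_on a b (fun _ : R => (0 : R)).
  by apply: (@lipschitz_ac_on _ _ _ _ 0) => *; rewrite subrr normr0 mul0r.
(* The sup-norm criterion needs a nonnegative bound. It is derived from [G] alone, as there is no
   coordinate to use when [n = 0]. *)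
have G0 : 0 <= G b - G a.
  have := @ac_nonincreasing R (fun s => 0 - G s) a b ab (ac_onB ac0 aG).
  rewrite subr_ge0 !sub0r lerN2; apply; apply: ae_mono h => s hs /hs[c [g [_ dG cg]]].
  exists (0 - g); last by apply: is_deriveB.
  by rewrite sub0r oppr_le0 (le_trans _ cg).
apply/rV_norm_leP => // i; rewrite !mxE ler_norml.
have azi := ac_on_coord i az.
have cle (c : 'rV[R]_n) g : `|c| <= g -> `|c 0 i| <= g.
  by move=> cg; apply: le_trans cg; exact: ((rV_norm_leP c (normr_ge0 _)).2 (lexx _) i).
apply/andP; split.
  have := @ac_nonincreasing R (fun s => (0 - z s 0 i) - G s) a b ab
    (ac_onB (ac_onB ac0 azi) aG).
  suff H : {ae lebesgue_measure, forall s, s \in `[a, b] -> exists2 d, d <= 0 &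
       is_derive s (1 : R) (fun s => 0 - z s 0 i - G s) d} by move=> /(_ H); lra.
  apply: ae_mono h => s hs /hs[c [g [dz dG cg]]].
  exists ((0 - c 0 i) - g).
    by have := cle c g cg; rewrite ler_norml => /andP[]; lra.
  by have := is_derive_coord i dz => dzi; apply: is_deriveB.
have := @ac_nonincreasing R (fun s => z s 0 i - G s) a b ab (ac_onB azi aG).
suff H : {ae lebesgue_measure, forall s, s \in `[a, b] -> exists2 d, d <= 0 &
     is_derive s (1 : R) (fun s => z s 0 i - G s) d} by move=> /(_ H); lra.
apply: ae_mono h => s hs /hs[c [g [dz dG cg]]].
exists (c 0 i - g).
  by have := cle c g cg; rewrite ler_norml => /andP[]; lra.
by have := is_derive_coord i dz => dzi; apply: is_deriveB.
Qed.

Lemma expR_increment_le (R : realType) (x y : R) :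
  expR y - expR x <= expR y * (y - x).
Proof.
have := expR_ge1Dx (x - y).
have -> : expR x = expR y * expR (x - y) by rewrite -expRD addrC subrK.
have := expR_gt0 y; nra.
Qed.

Lemma is_derive_expR_affine (R : realType) (C lam a s : R) :
  is_derive s (1 : R) (fun s => C * expR (lam * (s - a)))
    (C * lam * expR (lam * (s - a))).
Proof.
have h1 : is_derive s (1 : R) (fun s => lam * (s - a)) lam.
  apply/is_derive1P => e e0; exists 1 => // t _.
  rewrite (_ : _ - _ = 0); first by rewrite normr0 mulr_ge0// ltW.
  rewrite -[_ *: lam]/((t - s) * lam); ring.
have h2 := @is_derive1_comp R expR (fun s => lam * (s - a)) s _ _ (is_derive_expR _) h1.
have h3 := is_deriveZ C h2.
apply: (is_derive_eq h3); rewrite -[_ *: _]/(C * _).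
ring.
Qed.

Lemma ac_on_expR_affine (R : realType) (C lam a b : R) : 0 <= C -> 0 <= lam ->
  ac_on a b (fun s => C * expR (lam * (s - a))).
Proof.
move=> C0 l0; apply: (@lipschitz_ac_on _ _ _ _ (C * (expR (lam * (b - a)) * lam))).
move=> s t as_ st tb; rewrite -mulrBr ger0_norm; last first.
  by rewrite mulr_ge0// subr_ge0 ler_expR ler_wpM2l// lerB.
rewrite -mulrA ler_wpM2l//; apply: (le_trans (expR_increment_le _ _)).
rewrite -mulrBr opprB addrA subrK -mulrA ler_wpM2r ?mulr_ge0 ?subr_ge0//.
by rewrite ler_expR ler_wpM2l// lerB.
Qed.

(** Integrating the exponential weight gains a factor [1 / lam]. This gain is what makes both the
    Gronwall estimate and Picard iteration contract. *)
Lemma ac_exp_increment (R : realType) (n : nat) (a b C lam : R) (z : R -> 'rV[R]_n) :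
  0 <= C -> 0 <= lam -> ac_on a b z ->
  {ae lebesgue_measure, forall s, s \in `[a, b] ->
     exists2 c, is_derive s (1 : R) z c & `|c| <= C * lam * expR (lam * (s - a))} ->
  forall s, a <= s <= b -> `|z s - z a| <= C * (expR (lam * (s - a)) - 1).
Proof.
move=> C0 l0 az h s /andP[as_ sb].
have := @ac_increment R n a s z (fun s => C * expR (lam * (s - a))) as_.
rewrite subrr mulr0 expR0 -mulrBr; apply.
- exact: ac_on_subset az.
- exact: ac_on_expR_affine.
- apply: ae_mono h => r hr /[!in_itv]/= /andP[ar rs].
  have [|c dc hc] := hr _; first by rewrite in_itv/= ar (le_trans rs).
  exists c, (C * lam * expR (lam * (r - a))); split => //.
  exact: is_derive_expR_affine.
Qed.

Lemma ac_lipschitz (R : realType) (n : nat) (a b C : R) (z : R -> 'rV[R]_n) :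
  ac_on a b z ->
  {ae lebesgue_measure, forall s, s \in `[a, b] ->
     exists2 c, is_derive s (1 : R) z c & `|c| <= C} ->
  forall s t, a <= s -> s <= t -> t <= b -> `|z t - z s| <= C * (t - s).
Proof.
move=> az h s t as_ st tb; rewrite mulrBr.
apply: (@ac_increment R n s t z (fun s => C * s)) => //.
- exact: ac_on_subset az.
- apply: (@lipschitz_ac_on _ _ _ _ `|C|) => r r' _ rr _.
  by rewrite -mulrBr normrM [X in _ * X]ger0_norm// subr_ge0.
- apply: ae_mono h => r hr /[!in_itv]/= /andP[ar rs].
  have [|c dc hc] := hr _; first by rewrite in_itv/= (le_trans as_) ?(le_trans rs).
  exists c, C; split => //; apply/is_derive1P => e e0; exists 1 => // u _.
  rewrite (_ : _ - _ = 0); first by rewrite normr0 mulr_ge0// ltW.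
  by rewrite -[_ *: C]/((u - r) * C); ring.
Qed.

(** The a priori bound [B] makes the weighted supremum [M] finite, without which it could not be
    absorbed. The two factors 2 reflect the weight [E] of rate [2 * L], twice the Lipschitz rate. *)
Lemma gronwall (R : realType) (n : nat) (a b L B : R) (z : R -> 'rV[R]_n) :
  0 < L -> ac_on a b z -> (forall s, a <= s <= b -> `|z s| <= B) ->
  {ae lebesgue_measure, forall s, s \in `[a, b] ->
     exists2 c, is_derive s (1 : R) z c & `|c| <= L * `|z s|} ->
  forall s, a <= s <= b -> `|z s| <= 2 * `|z a| * expR (2 * L * (s - a)).
Proof.
move=> L0 az zB h s0 s0ab.
have L20 : 0 < 2 * L by rewrite mulr_gt0.
pose E s := expR (2 * L * (s - a)).
have E0 s : 0 < E s by exact: expR_gt0.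
have E1 s : a <= s -> 1 <= E s.
  by move=> as_; rewrite -expR0 ler_expR mulr_ge0 ?subr_ge0// ltW.
pose S := [set `|z s| / E s | s in [set s | a <= s <= b]].
have aab : a <= a <= b by rewrite lexx/=; case/andP: s0ab; exact: le_trans.
have S0 : S (`|z a| / E a) by exists a.
have hS : has_sup S.
  split; first by exists (`|z a| / E a).
  exists B => _ [s /= sab <-]; rewrite ler_pdivrMr//.
  have Bz := zB s sab; have /andP[as_ _] := sab; have := E1 s as_.
  have := normr_ge0 (z s); nra.
pose M := sup S.
have zM s : a <= s <= b -> `|z s| <= M * E s.
  by move=> sab; rewrite -ler_pdivrMr//; apply: sup_upper_bound => //; exists s.
have M0 : 0 <= M.
  by rewrite (le_trans _ (sup_upper_bound hS S0))// divr_ge0// ltW.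
have key s : a <= s <= b -> `|z s| <= `|z a| + M / 2 * (E s - 1).
  move=> sab; rewrite -lerBlDl (le_trans (lerB_dist _ _))//.
  apply: (@ac_exp_increment R n a b (M / 2) (2 * L) z) => //.
  - by rewrite divr_ge0.
  - exact: ltW.
  - apply: ae_mono h => r hr rab; have [c dc hc] := hr rab.
    exists c => //; apply: (le_trans hc).
    have rab' : a <= r <= b by move: rab; rewrite in_itv.
    have := zM r rab'; rewrite /E.
    set e := expR _; nra.
(* Absorption: the weight [E] makes the Gronwall operator a contraction of ratio 1/2. *)
have : M <= `|z a| + M / 2.
  apply: ge_sup; first by exists (`|z a| / E a).
  move=> _ [s /= sab <-]; rewrite ler_pdivrMr//.
  have := key s sab; have /andP[as_ _] := sab; have := E1 s as_.
  have := normr_ge0 (z a); nra.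
move=> Mle; apply: (le_trans (zM _ s0ab)); rewrite ler_wpM2r//; first exact: ltW.
lra.
Qed.

(** * Lebesgue measurability and primitives *)

Definition lmeasurable (R : realType) (A : set R) : Prop :=
  @measurable _ (caratheodory_type (@wlength R idfun)^*%mu) A.

Lemma borel_lmeasurable (R : realType) (A : set R) : measurable A -> lmeasurable A.
Proof. exact: sub_caratheodory. Qed.

Lemma lmeasurable_bigcup (R : realType) (J : countType) (P : J -> Prop) (A : J -> set R) :
  (forall j, P j -> lmeasurable (A j)) -> lmeasurable (\bigcup_(j in P) A j).
Proof.
move=> h.
have -> : \bigcup_(j in P) A j = \bigcup_j (if asbool (P j) then A j else set0).
  apply/seteqP; split => [s [j Pj js]|s [j _]].
    by exists j => //; rewrite (asboolT Pj).
  by case: ifPn => // /asboolP Pj js; exists j.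
apply: countable_bigcupT_measurable => // j; case: ifPn => // /asboolP; exact: h.
Qed.

Lemma lmeasurable_borel_mod_null (R : realType) (A : set R) : lmeasurable A ->
  exists B N : set R, [/\ measurable B, lebesgue_measure.-negligible N & A = B `|` N].
Proof.
rewrite /lmeasurable -completed_caratheodory_measurable.
rewrite g_sigma_completed_algebra_genE => -[B mB [N mN <-]].
by exists B, N.
Qed.

(* The library integrates Borel functions, so [g] is first replaced by a Borel
   function [g'] that agrees with it off a null set. *)
Lemma lebesgue_primitive (R : realType) (a b C : R) (g : R -> R) : a <= b ->
  (forall c, lmeasurable (`[a, b]%classic `&` [set s | c < g s])) ->
  (forall s, a <= s <= b -> `|g s| <= C) ->
  exists G : R -> R, [/\ G a = 0,
    forall s t, a <= s -> s <= t -> t <= b -> `|G t - G s| <= C * (t - s) &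
    {ae lebesgue_measure, forall s, s \in `[a, b] -> is_derive s (1 : R) G (g s)}].
Proof.
move=> ab mg gC.
have C0 : 0 <= C by apply: le_trans (gC a _) => //; rewrite lexx.
pose q (k : nat) : rat := odflt 0 (unpickle k).
have hq (r : rat) : exists k, q k = r by exists (pickle r); rewrite /q pickleK.
have /choice[B hB] k : exists BN : set R * set R, [/\ measurable BN.1,
   lebesgue_measure.-negligible BN.2 &
   `[a, b]%classic `&` [set s | ratr (q k) < g s] = BN.1 `|` BN.2].
  by have [B [N h]] := lmeasurable_borel_mod_null (mg (ratr (q k))); exists (B, N).
have : lebesgue_measure.-negligible (\bigcup_k (B k).2).
  by apply: negligible_bigcup => k; have [] := hB k.
move=> [N [mN N0 NN]].
(* [N] contains all the null parts of the rational superlevel sets. With the value 0 on [N] and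
   outside [[a, b]], [g'] is Borel on the whole line. *)
pose g' s := if asbool (s \in `[a, b] /\ ~ N s) then g s else 0.
have g'E s : s \in `[a, b] -> ~ N s -> g' s = g s by move=> h1 h2; rewrite /g' asboolT.
have g'0 s : s \notin `[a, b] -> g' s = 0.
  by move=> h1; rewrite /g' asboolF// => -[h2]; rewrite h2 in h1.
have mg' : measurable_fun setT g'.
  apply: (measurability (@RGenOInfty.G R)); first exact: RGenOInfty.measurableE.
  move=> _ [_ [c ->] <-]; rewrite setTI.
  (* Off [N] and inside [[a, b]], [c < g s] holds iff some rational [r] satisfies [c < r < g s], up
     to null parts removed with [N]. The default value 0 contributes exactly when [c < 0]. *)
  have -> : g' @^-1` `]c, +oo[%classic =
     (\bigcup_(k in [set k | c < ratr (q k)]) ((B k).1 `\` N)) `|`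
     (if c < 0 then ~` `[a, b]%classic `|` N else set0).
    apply/seteqP; split => [s /=|s /= [[k ck [Bs Ns]]|]].
    - rewrite in_itv/= andbT /g'; case: asboolP => [[sab Ns] cg|nab c0].
        have [r] := rat_in_itvoo cg; rewrite in_itv/= => /andP[cr rg].
        have [k qk] := hq r; left; exists k; first by rewrite /= qk.
        have [_ _ h] := hB k.
        have : ((B k).1 `|` (B k).2) s by rewrite -h; split => //=; rewrite qk.
        by move=> [?|hs]; [split|exfalso; apply: Ns; apply: NN; exists k].
      rewrite c0; right; apply: contrapT => /not_orP[/contrapT h1 h2]; exact: nab.
    - have [_ _ h] := hB k; have : (`[a, b]%classic `&` [set s | ratr (q k) < g s]) s.
        by rewrite h; left.
      by move=> [/= sab gs]; rewrite in_itv/= andbT g'E// (lt_trans ck).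
    - case: ifPn => // c0 h; rewrite in_itv/= andbT /g' asboolF// => -[h1 h2].
      by case: h.
  apply: measurableU.
    by apply: bigcup_measurable => k _; apply: measurableD => //; have [] := hB k.
  case: ifP => // _; apply: measurableU => //; apply: measurableC; exact: measurable_itv.
have g'C s : `|g' s| <= C.
  rewrite /g'; case: asboolP => [[sab _]|_]; last by rewrite normr0.
  by apply: gC; move: sab; rewrite in_itv.
have intg x y b1 b2 : lebesgue_measure.-integrable
    [set` Interval (BSide b1 x) (BSide b2 y)] (EFin \o g').
  apply: measurable_bounded_integrable => //.
  - rewrite /= lebesgue_measure_itv/=; case: ifP => // _; exact: ltry.
  - exact: measurable_funTS.
  - exists C; split; first exact: num_real.
    by move=> M CM s _ /=; apply: le_trans (ltW CM); exact: g'C.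
have locg : locally_integrable setT g'.
  have := integrable_locally (measurable_itv `[a, b]) (intg a b true false).
  congr (locally_integrable _ _); apply/funext => s; rewrite patchE.
  by case: ifPn => //; rewrite notin_setE/= => /negP/g'0.
pose G s := \int[lebesgue_measure]_(t in [set` Interval (BLeft a) (BRight s)]) g' t.
exists G; split.
- by rewrite /G set_itv1 Rintegral_set1.
- move=> s t as_ st tb; rewrite /G Rintegral_itvB//.
  apply: (le_trans (le_normr_Rintegral _ (intg s t false false))) => //.
  have -> : C * (t - s) = \int[lebesgue_measure]_(x in `]s, t]) (cst C) x.
    transitivity (fine (\int[lebesgue_measure]_(x in `]s, t]) (cst C%:E) x)%E) => //.
    rewrite integral_cst//= lebesgue_measure_itv/= lte_fin.
    case: ltP => [//|ts]; have -> : s = t by apply/eqP; rewrite eq_le st ts.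
    by rewrite mule0 subrr mulr0.
  apply: le_Rintegral => //; first by apply: integrable_norm; exact: intg.
  + apply: measurable_bounded_integrable => //.
    * rewrite /= lebesgue_measure_itv/=; case: ifP => // _; exact: ltry.
    * exists C; split; first exact: num_real.
      by move=> M CM x _ /=; rewrite ger0_norm// ltW.
- have ae1 := @FTC1 R g' (BLeft a) (fun y => intg a y true false) locg.
  have ae2 : {ae lebesgue_measure, forall s, ~ N s}.
    by exists N; split => // s /= /contrapT.
  (* The differentiation theorem is applied at points to the right of the base point [a], so [a]
     itself is discarded. *)
  have ae3 : {ae lebesgue_measure, forall s, s != a}.
    exists [set a]; split => //; first exact: lebesgue_measure_set1.
    by move=> s /= /negP; rewrite negbK => /eqP.
  apply: ae_mono (ae_and (ae_and ae1 ae2) ae3) => s [[/= h Ns] sa] sab.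
  have [|dG gE] := h.
    by rewrite lte_fin lt_neqAle eq_sym sa/=; move: sab; rewrite in_itv/= => /andP[].
  by rewrite -(g'E s)// -gE derive1E; exact: derivableP.
Qed.

(** * Rational balls and measurability of vector-valued functions *)

Definition rat_ball (R : realType) (k : nat) (j : 'rV[rat]_k * rat) : set 'rV[R]_k :=
  ball (map_mx ratr j.1 : 'rV[R]_k) (ratr j.2).

Lemma rat_ballP (R : realType) (k : nat) (A : set 'rV[R]_k) (x : 'rV[R]_k) :
  nbhs x A -> exists j, rat_ball j x /\ rat_ball j `<=` A.
Proof.
move=> /nbhs_ballP[e /= e0 eA].
have e20 : 0 < e / 2 by rewrite divr_gt0.
have [r] := rat_in_itvoo e20; rewrite in_itv/= => /andP[r0 re].
have r20 : 0 < (ratr r : R) / 2 by rewrite divr_gt0.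
have /choice[q hq] i : exists q : rat, `|x 0 i - ratr q| <= (ratr r : R) / 2.
  have : x 0 i - ratr r / 2 < x 0 i + (ratr r : R) / 2 by lra.
  move=> /rat_in_itvoo[q]; rewrite in_itv/= => /andP[h1 h2]; exists q.
  by rewrite ler_norml; lra.
have xq : `|map_mx ratr (\row_i q i) - x| <= (ratr r : R) / 2.
  by apply/rV_norm_leP; [exact: ltW|move=> i; rewrite !mxE distrC].
exists (\row_i q i, r); rewrite /rat_ball mx_norm_ball /ball_ /=; split.
  by rewrite (le_lt_trans xq)//; lra.
move=> y /= yr; apply: eA; rewrite mx_norm_ball /ball_ /=.
rewrite (le_lt_trans (ler_distD (map_mx ratr (\row_i q i)) _ _))//.
by rewrite distrC in xq; lra.
Qed.

(** Each open set is a countable union of rational balls, so these suffice as test sets.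
    Measurability of controls then reduces to countable set operations. *)
Lemma lebesgue_measurable_funP (R : realType) (k : nat) (D : set R) (g : R -> 'rV[R]_k) :
  lmeasurable D ->
  (forall j, lmeasurable (D `&` g @^-1` (rat_ball j))) <-> lebesgue_measurable_fun D g.
Proof.
move=> mD; split => [h|h j].
  rewrite /lebesgue_measurable_fun.
  apply: (@measurability _ _ (caratheodory_type (@wlength R idfun)^*%mu)
    (g_sigma_algebraType (@open 'rV[R]_k)) D g (@open 'rV[R]_k)) => // _ [A oA <-].
  have -> : D `&` g @^-1` A =
     \bigcup_(j in (fun j : 'rV[rat]_k * rat => rat_ball j `<=` A)) (D `&` g @^-1` (rat_ball j)).
    apply/seteqP; split => [s [Ds As]|s [j jA [Ds js]]]; last by split => //; exact: jA.
    by have [j [jg jA]] := rat_ballP (open_nbhs_nbhs (conj oA As)); exists j.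
  by apply: lmeasurable_bigcup => j _; exact: h.
by apply: h => //; apply: sub_sigma_algebra; exact: ball_open.
Qed.

(** * Existence and uniqueness of trajectories *)

(** The intervals of radius [w k] around [a k] are nested, and the supremum of their left ends lies
    in all of them. The explicit rate is what the limit of Picard iterates requires. *)
Lemma geometric_limit (R : realType) (a : nat -> R) (c : R) :
  (forall k, `|a k.+1 - a k| <= c * 2^-1 ^+ k) ->
  exists l, forall k, `|a k - l| <= 2 * c * 2^-1 ^+ k.
Proof.
move=> h; pose w k : R := 2 * c * 2^-1 ^+ k.
have wS k : w k.+1 = w k / 2 by rewrite /w exprSr mulrA.
have w0 k : 0 <= w k.
  by have := h k; have := normr_ge0 (a k.+1 - a k); rewrite /w -mulrA; nra.
have h' k : `|a k.+1 - a k| <= w k / 2.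
  by apply: (le_trans (h k)); rewrite /w; lra.
have lo j k : a j - w j <= a (j + k)%N - w (j + k)%N.
  elim: k => [|k IH]; first by rewrite addn0.
  rewrite (le_trans IH)// addnS wS; have := h' (j + k)%N.
  by rewrite ler_norml => /andP[]; lra.
have hi j k : a (j + k)%N + w (j + k)%N <= a j + w j.
  elim: k => [|k IH]; first by rewrite addn0.
  rewrite (le_trans _ IH)// addnS wS; have := h' (j + k)%N.
  by rewrite ler_norml => /andP[]; lra.
have lohi j k : a j - w j <= a k + w k.
  have := lo j k; have := hi k j; rewrite addnC => h1 h2.
  by have := w0 (j + k)%N; lra.
pose S := [set a k - w k | k in setT].
have hS : has_sup S.
  by split; [exists (a 0%N - w 0%N); exists 0%N|exists (a 0%N + w 0%N) => _ [k _ <-]].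
exists (sup S) => k; rewrite -/(w k) ler_norml; apply/andP; split.
  rewrite lerBrDr addrC lerBlDr; apply: ge_sup; first by case: hS.
  by move=> _ [j _ <-].
have : a k - w k <= sup S by apply: sup_upper_bound => //; exists k.
lra.
Qed.

Lemma le_geometric_le0 (R : realType) (x c : R) :
  (forall k, x <= c * 2^-1 ^+ k) -> x <= 0.
Proof.
move=> h; apply/ler_addgt0Pl => e e0; rewrite addr0.
have c0 : 0 < `|c| + 1 by rewrite ltr_wpDl.
have /cvgrPdist_lt/(_ (e / (`|c| + 1)) (divr_gt0 e0 c0)) :
    (fun k => (2^-1 : R) ^+ k) @ \oo --> (0 : R).
  by apply: cvg_expr; rewrite ger0_norm; lra.
move=> [k _ /(_ k (leqnn k))]; rewrite sub0r normrN ger0_norm ?exprn_ge0//.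
rewrite ltr_pdivlMr// => hk; apply: (le_trans (h k)).
have : 0 <= (2^-1 : R) ^+ k by rewrite exprn_ge0.
have := ler_norm c; move: hk; set q := _ ^+ k; nra.
Qed.

Section ode.
Context {R : realType} {n m p : nat}.
Context {U : set 'rV[R]_m} {VV : set 'rV[R]_p}.
Context {f : 'rV[R]_n -> 'rV[R]_m -> 'rV[R]_p -> 'rV[R]_n} {Cf : R}.
Context (Cf_gt0 : 0 < Cf)
  (f_continuous : forall x : 'rV[R]_n,
      {within U `*` VV, continuous (fun w : 'rV[R]_m * 'rV[R]_p => f x w.1 w.2)})
  (f_bounded : forall x u v, U u -> VV v -> `|f x u v| <= Cf)
  (f_lipschitz : forall x x' u v, U u -> VV v ->
      `|f x u v - f x' u v| <= Cf * `|x - x'|).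

Lemma rhs_continuous_controls x u v e : U u -> VV v -> 0 < e ->
  exists2 d, 0 < d & forall u' v', U u' -> VV v' -> ball u d u' -> ball v d v' ->
    `|f x u' v' - f x u v| < e.
Proof.
move=> Uu Vv e0; have /subspace_continuousP cf := @f_continuous x.
have /cvgrPdist_lt/(_ e e0)/nbhs_ballP[d /= d0 hd] := cf (u, v) (conj Uu Vv).
by exists d => // u' v' Uu' Vv' uu vv; rewrite distrC; apply: (hd (u', v')).
Qed.

(** The Lipschitz bound is uniform in the controls, so it upgrades continuity in the controls at
    fixed [x] to joint continuity. *)
Lemma rhs_joint_continuous x u v e : U u -> VV v -> 0 < e ->
  exists A B C, [/\ nbhs x A, nbhs u B, nbhs v C &
    forall x' u' v', A x' -> B u' -> C v' -> U u' -> VV v' ->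
      `|f x' u' v' - f x u v| < e].
Proof.
move=> Uu Vv e0; have e20 : 0 < e / 2 by lra.
have [d d0 hd] := rhs_continuous_controls x Uu Vv e20.
have eC : 0 < e / 2 / Cf by rewrite divr_gt0.
exists (ball x (e / 2 / Cf)), (ball u d), (ball v d).
split; try exact: nbhsx_ballx.
move=> x' u' v' xx uu vv Uu' Vv'.
rewrite (le_lt_trans (ler_distD (f x u' v') _ _))// [e]splitr ler_ltD//; last exact: hd.
apply: (le_trans (f_lipschitz _ _ Uu' Vv')); rewrite mulrC -ler_pdivlMr// ltW//.
by move: xx; rewrite mx_norm_ball /ball_/= distrC.
Qed.

Lemma continuous_lebesgue_measurable (k : nat) (a b : R) (y : R -> 'rV[R]_k) :
  (forall s e, a <= s <= b -> 0 < e -> exists2 d, 0 < d &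
     forall t, a <= t <= b -> `|t - s| < d -> `|y t - y s| < e) ->
  lebesgue_measurable_fun `[a, b]%classic y.
Proof.
move=> cy; apply/lebesgue_measurable_funP; first exact: borel_lmeasurable.
move=> j; apply: borel_lmeasurable.
(* The implication inside the interior is vacuous off [[a, b]], which turns relative openness into
   genuine openness, endpoints included. *)
have -> : `[a, b]%classic `&` y @^-1` rat_ball j =
    `[a, b]%classic `&` interior [set s | a <= s <= b -> rat_ball j (y s)].
  apply/seteqP; split => [s [/= sab ys]|s [/= sab /nbhs_singleton ys]]; split => //=.
    have sab' : a <= s <= b by move: sab; rewrite in_itv.
    have : nbhs (y s) (rat_ball j) by apply: open_nbhs_nbhs; split => //; exact: ball_open.
    move=> /nbhs_ballP[e /= e0 he]; have [d d0 hd] := cy s e sab' e0.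
    apply/nbhs_ballP; exists d => // t /= ts tab; apply: he.
    by rewrite mx_norm_ball /ball_/= distrC; apply: hd => //; rewrite distrC.
  by apply: ys; move: sab; rewrite in_itv.
by apply: measurableI => //; apply: open_measurable; exact: open_interior.
Qed.

(** The class of curves on which Picard iteration acts; it is invariant because [f] is bounded by
    the same constant [Cf]. *)
Definition lip_on (a b : R) (y : R -> 'rV[R]_n) : Prop :=
  forall s t, a <= s -> s <= t -> t <= b -> `|y t - y s| <= Cf * (t - s).

Lemma lip_on_measurable a b y : lip_on a b y ->
  lebesgue_measurable_fun `[a, b]%classic y.
Proof.
move=> ly; apply: continuous_lebesgue_measurable => s e /andP[as_ sb] e0.
exists (e / Cf); first by rewrite divr_gt0.
move=> t /andP[at_ tb]; rewrite ltr_pdivlMr// mulrC.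
have [st|ts] := leP s t.
  by apply: le_lt_trans; rewrite [`|t - s|]ger0_norm ?subr_ge0//; exact: ly.
rewrite distrC [`|y _ - _|]distrC; apply: le_lt_trans.
by rewrite [`|s - t|]gtr0_norm ?subr_gt0//; apply: ly => //; exact: ltW.
Qed.

(** By joint continuity a strict inequality [c < f] persists on a product of three rational balls.
    The superlevel set is thus a countable union of intersections of preimages under [y], [u] and
    [v]. *)
Lemma rhs_lmeasurable a b y u v i c : a <= b ->
  controls U a b u -> controls VV a b v -> lip_on a b y ->
  lmeasurable (`[a, b]%classic `&` [set s | c < f (y s) (u s) (v s) 0 i]).
Proof.
move=> ab [mu uU] [mv vV] ly.
have mI : lmeasurable `[a, b]%classic by apply: borel_lmeasurable.
have my := (lebesgue_measurable_funP y mI).2 (lip_on_measurable ly).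
have {}mu := (lebesgue_measurable_funP u mI).2 mu.
have {}mv := (lebesgue_measurable_funP v mI).2 mv.
pose J := (('rV[rat]_n * rat) * (('rV[rat]_m * rat) * ('rV[rat]_p * rat)))%type.
pose good (j : J) := forall x u v, rat_ball j.1 x -> rat_ball j.2.1 u ->
  rat_ball j.2.2 v -> U u -> VV v -> c < f x u v 0 i.
have -> : `[a, b]%classic `&` [set s | c < f (y s) (u s) (v s) 0 i] =
   \bigcup_(j in good) ((`[a, b]%classic `&` y @^-1` rat_ball j.1) `&`
      ((`[a, b]%classic `&` u @^-1` rat_ball j.2.1) `&`
       (`[a, b]%classic `&` v @^-1` rat_ball j.2.2))).
  apply/seteqP; split => [s [/= sab cs]|s [j gj [[/= sab ys] [[_ us] [_ vs]]]]]; last first.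
    by split => //=; apply: gj => //; [exact: uU|exact: vV].
  have e0 : 0 < f (y s) (u s) (v s) 0 i - c by rewrite subr_gt0.
  have [A [B [C [nA nB nC h]]]] := rhs_joint_continuous (y s) (uU _ sab) (vV _ sab) e0.
  have [j1 [y1 h1]] := rat_ballP nA.
  have [j2 [y2 h2]] := rat_ballP nB.
  have [j3 [y3 h3]] := rat_ballP nC.
  exists (j1, (j2, j3)) => //= x' u' v' /= /h1 Ax /h2 Bu /h3 Cv Uu Vv.
  have := h _ _ _ Ax Bu Cv Uu Vv; set d := f x' u' v' - _ => hd.
  have := (rV_norm_leP d (normr_ge0 _)).2 (lexx _) i.
  rewrite /d !mxE ler_norml => /andP[+ _]; rewrite /d in hd; lra.
apply: lmeasurable_bigcup => j _.
apply: measurableI; first exact: my.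
by apply: measurableI; [exact: mu|exact: mv].
Qed.

Lemma rhs_primitive a b x y u v : a <= b ->
  controls U a b u -> controls VV a b v -> lip_on a b y ->
  exists G : R -> 'rV[R]_n, [/\ G a = x, lip_on a b G &
    {ae lebesgue_measure, forall s, s \in `[a, b] ->
       is_derive s (1 : R) G (f (y s) (u s) (v s))}].
Proof.
move=> ab cu cv ly.
have uU s : a <= s <= b -> U (u s) by case: cu => _ h sab; apply: h; rewrite in_itv.
have vV s : a <= s <= b -> VV (v s) by case: cv => _ h sab; apply: h; rewrite in_itv.
have /choice[G hG] i : exists G : R -> R, [/\ G a = 0,
    forall s t, a <= s -> s <= t -> t <= b -> `|G t - G s| <= Cf * (t - s) &
    {ae lebesgue_measure, forall s, s \in `[a, b] ->
      is_derive s (1 : R) G (f (y s) (u s) (v s) 0 i)}].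
  apply: lebesgue_primitive => // [c|s sab]; first exact: rhs_lmeasurable.
  apply: le_trans (f_bounded (y s) (uU s sab) (vV s sab)).
  exact: ((rV_norm_leP _ (normr_ge0 _)).2 (lexx _) i).
exists (fun s => x + \row_i G i s); split.
- apply/rowP => i; rewrite !mxE; have [-> _ _] := hG i; exact: addr0.
- move=> s t as_ st tb; apply/rV_norm_leP; first by rewrite mulr_ge0 ?subr_ge0// ltW.
  move=> i; rewrite !mxE opprD addrACA subrr add0r.
  by have [_ h _] := hG i; exact: h.
- have : {ae lebesgue_measure, forall s, forall i, s \in `[a, b] ->
      is_derive s (1 : R) (G i) (f (y s) (u s) (v s) 0 i)}.
    apply: (@filter_forall _ _ _ _ (ae_filter_ringOfSetsType _)) => i.
    by have [] := hG i.
  apply: ae_mono => s h sab; apply: coord_is_derive => i.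
  apply/is_derive1P => e e0; have /is_derive1P/(_ e e0)[r r0 hr] := h i sab.
  exists r => // t tr; rewrite !mxE opprD addrACA subrr add0r; exact: hr.
Qed.

Lemma lip_on_dist a b y : lip_on a b y -> forall s, a <= s <= b ->
  `|y s - y a| <= Cf * (b - a).
Proof.
move=> ly s /andP[as_ sb]; apply: (le_trans (ly a s (lexx _) as_ sb)).
by rewrite ler_wpM2l ?lerB// ltW.
Qed.

Lemma lip_on_ac a b y : lip_on a b y -> ac_on a b y.
Proof. exact: lipschitz_ac_on. Qed.

Lemma solves_ode_exists a b x u v : a <= b ->
  controls U a b u -> controls VV a b v ->
  exists y, solves_ode b f a x u v y.
Proof.
move=> ab cu cv.
have uU s : s \in `[a, b] -> U (u s) by case: cu => _ /(_ s).
have vV s : s \in `[a, b] -> VV (v s) by case: cv => _ /(_ s).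
(* [P] is the Picard operator on Lipschitz curves and is arbitrary elsewhere; the iterates never
   leave the Lipschitz class. *)
have /choice[P hP] (y : R -> 'rV[R]_n) : exists G, lip_on a b y ->
    [/\ G a = x, lip_on a b G & {ae lebesgue_measure, forall s, s \in `[a, b] ->
       is_derive s (1 : R) G (f (y s) (u s) (v s))}].
  have [ly|nly] := pselect (lip_on a b y); last by exists y.
  by have [G hG] := rhs_primitive x ab cu cv ly; exists G.
pose Y k := iter k P (cst x).
have lY k : lip_on a b (Y k).
  elim: k => [|k IH]; last by have [] := hP _ IH.
  by move=> s t _ st _; rewrite subrr normr0 mulr_ge0 ?subr_ge0// ltW.
have Ya k : Y k a = x by case: k => [//|k]; have [] := hP _ (lY k).
have dY k : {ae lebesgue_measure, forall s, s \in `[a, b] ->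
    is_derive s (1 : R) (Y k.+1) (f (Y k s) (u s) (v s))} by have [] := hP _ (lY k).
pose M := Cf * (b - a).
have M0 : 0 <= M by rewrite mulr_ge0 ?subr_ge0// ltW.
(* In the norm weighted by [E], Picard iteration contracts by 1/2. *)
pose E s := expR (2 * Cf * (s - a)).
have Cf20 : 0 <= 2 * Cf by rewrite mulr_ge0// ltW.
have E1 s : a <= s -> 1 <= E s.
  by move=> as_; rewrite -expR0 ler_expR mulr_ge0 ?subr_ge0.
have step k s : a <= s <= b -> `|Y k.+1 s - Y k s| <= M * 2^-1 ^+ k * E s.
  elim: k s => [|k IH] s sab.
    rewrite expr0 mulr1; have := lip_on_dist (lY 1%N) sab; rewrite Ya => h.
    by apply: (le_trans h); rewrite ler_peMr// E1//; case/andP: sab.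
  pose z s := Y k.+2 s - Y k.+1 s.
  have za : z a = 0 by rewrite /z !Ya subrr.
  have Mk0 : 0 <= M * 2^-1 ^+ k.+1 by rewrite mulr_ge0// exprn_ge0.
  have := @ac_exp_increment R n a b (M * 2^-1 ^+ k.+1) (2 * Cf) z Mk0 Cf20.
  move=> /(_ (ac_onB (lip_on_ac (lY _)) (lip_on_ac (lY _)))).
  rewrite za => H; rewrite -[_ - _]/(z s) -[z s]subr0.
  apply: le_trans (H _ _ sab) _ => {H}; last first.
    by rewrite ler_wpM2l// gerBl.
  apply: ae_mono (ae_and (dY k.+1) (dY k)) => r [h1 h2] rab.
  exists (f (Y k.+1 r) (u r) (v r) - f (Y k r) (u r) (v r)).
    by have := h1 rab; have := h2 rab => ? ?; apply: is_deriveB.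
  apply: (le_trans (f_lipschitz _ _ (uU _ rab) (vV _ rab))).
  have rab' : a <= r <= b by move: rab; rewrite in_itv.
  have := IH r rab'; rewrite exprS /E; set e := expR _ => h.
  apply: (@le_trans _ _ (Cf * (M * 2^-1 ^+ k * e))); first by rewrite ler_wpM2l// ltW.
  by rewrite le_eqVlt; apply/orP; left; apply/eqP; field.
pose K := M * E b.
have K0 : 0 <= K by rewrite mulr_ge0// expR_ge0.
have stepK k s : a <= s <= b -> `|Y k.+1 s - Y k s| <= K * 2^-1 ^+ k.
  move=> sab; apply: (le_trans (step k s sab)); rewrite /K mulrAC.
  rewrite ler_wpM2r ?exprn_ge0// ler_wpM2l// ler_expR ler_wpM2l// lerB//.
  by case/andP: sab.
have /choice[y hy] s : exists l, a <= s <= b -> forall k,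
    `|Y k s - l| <= 2 * K * 2^-1 ^+ k.
  have [sab|nsab] := boolP (a <= s <= b); last by exists 0.
  have /choice[l hl] i : exists l, forall k, `|Y k s 0 i - l| <= 2 * K * 2^-1 ^+ k.
    apply: geometric_limit => k; apply: le_trans (stepK k s sab).
    have := (rV_norm_leP (Y k.+1 s - Y k s) (normr_ge0 _)).2 (lexx _) i.
    by rewrite !mxE.
  exists (\row_i l i) => _ k; apply/rV_norm_leP => [|i]; last by rewrite !mxE.
  by apply: mulr_ge0; [apply: mulr_ge0|apply: exprn_ge0; rewrite invr_ge0].
have ly : lip_on a b y.
  move=> s t as_ st tb; rewrite -subr_le0.
  apply: (@le_geometric_le0 _ _ (4 * K)) => k.
  have := hy s _ k; rewrite as_ (le_trans st tb) => /(_ isT) hs.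
  have := hy t _ k; rewrite tb (le_trans as_ st) => /(_ isT) ht.
  have := lY k s t as_ st tb.
  have : `|y t - y s| <= `|Y k t - y t| + `|Y k t - Y k s| + `|Y k s - y s|.
    have -> : y t - y s = (Y k t - Y k s) - (Y k t - y t) + (Y k s - y s).
      by rewrite opprB addrAC -!addrA addrC; apply/rowP => i; rewrite !mxE; ring.
    apply: (le_trans (ler_normD _ _)); rewrite lerD2r.
    by apply: (le_trans (ler_normB _ _)); rewrite addrC.
  by move: hs ht; set q := _ ^+ k; lra.
have [Ga lG dG] := hP _ ly.
(* The limit [y] is a fixed point on [[a, b]]: the derivatives of [P y] and [Y k.+1] differ by at
   most [Cf] times the distance from [y] to [Y k], which is geometrically small. The solution
   exhibited is [P y], whose derivative is known by construction. *)
have Gy s : a <= s <= b -> P y s = y s.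
  move=> sab; apply/eqP; rewrite -subr_eq0 -normr_le0.
  apply: (@le_geometric_le0 _ _ (M * (2 * K) + 2 * K)) => k.
  pose z s := P y s - Y k.+1 s.
  have za : z a = 0 by rewrite /z Ga Ya subrr.
  have CK0 : 0 <= Cf * (2 * K * 2^-1 ^+ k).
    apply: mulr_ge0; first exact: ltW.
    by apply: mulr_ge0; [apply: mulr_ge0|apply: exprn_ge0; rewrite invr_ge0].
  have /andP[as_ sb] := sab.
  have := @ac_lipschitz R n a b (Cf * (2 * K * 2^-1 ^+ k)) z.
  move=> /(_ (ac_onB (lip_on_ac lG) (lip_on_ac (lY _)))) H.
  have {}H : `|z s| <= Cf * (2 * K * 2^-1 ^+ k) * (b - a).
    rewrite -[z s]subr0 -za; apply: le_trans (H _ a s (lexx _) as_ sb) _; last first.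
      by rewrite ler_wpM2l// lerB.
    apply: ae_mono (ae_and dG (dY k)) => r [h1 h2] rab.
    exists (f (y r) (u r) (v r) - f (Y k r) (u r) (v r)).
      by have := h1 rab; have := h2 rab => ? ?; apply: is_deriveB.
    apply: (le_trans (f_lipschitz _ _ (uU _ rab) (vV _ rab))).
    rewrite ler_wpM2l ?(ltW Cf_gt0)// distrC; apply: hy.
    by move: rab; rewrite in_itv.
  have := hy s sab k.+1; rewrite exprS => h2.
  have -> : P y s - y s = z s + (Y k.+1 s - y s) by rewrite /z addrA subrK.
  apply: (le_trans (ler_normD _ _)).
  have : 0 <= 2 * K * 2^-1 ^+ k.
    by apply: mulr_ge0; [apply: mulr_ge0|apply: exprn_ge0; rewrite invr_ge0].
  by move: H h2; rewrite /M; set q := _ ^+ k; nra.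
exists (P y); split => //; first exact: lip_on_ac.
by apply: ae_mono dG => s h sab; rewrite Gy; [exact: h|move: sab; rewrite in_itv].
Qed.

Lemma solves_ode_lip a b x u v y : controls U a b u -> controls VV a b v ->
  solves_ode b f a x u v y -> lip_on a b y.
Proof.
move=> [_ uU] [_ vV] [ay _ dy]; apply: ac_lipschitz => //.
apply: ae_mono dy => s h sab; exists (f (y s) (u s) (v s)); first exact: h.
by apply: f_bounded; [exact: uU|exact: vV].
Qed.

Lemma solves_ode_restrict a b a' b' x u v y : a <= a' -> b' <= b ->
  solves_ode b f a x u v y -> solves_ode b' f a' (y a') u v y.
Proof.
move=> aa bb [ay _ dy]; split => //; first exact: ac_on_subset ay.
apply: ae_mono dy => s h; rewrite in_itv/= => /andP[as_ sb]; apply: h.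
by rewrite in_itv/= (le_trans aa as_) (le_trans sb bb).
Qed.

Lemma solves_ode_ae a b x u v u' v' y :
  {ae lebesgue_measure, forall s, s \in `[a, b] -> u s = u' s} ->
  {ae lebesgue_measure, forall s, s \in `[a, b] -> v s = v' s} ->
  solves_ode b f a x u v y -> solves_ode b f a x u' v' y.
Proof.
move=> eu ev [ay ya dy]; split => //.
apply: ae_mono (ae_and (ae_and eu ev) dy) => s [[h1 h2] h] sab.
by rewrite -h1// -h2//; exact: h.
Qed.

(** Gronwall for the difference of two trajectories. With [x = x'] this is uniqueness; otherwise it
    gives the dependence of the value on the initial state. *)
Lemma solves_ode_dist a b x x' u v y y' : controls U a b u -> controls VV a b v ->
  solves_ode b f a x u v y -> solves_ode b f a x' u v y' ->
  forall s, a <= s <= b -> `|y s - y' s| <= 2 * `|x - x'| * expR (2 * Cf * (s - a)).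
Proof.
move=> cu cv sy sy' s sab.
have ly := solves_ode_lip cu cv sy; have ly' := solves_ode_lip cu cv sy'.
have [ay ya dy] := sy; have [ay' ya' dy'] := sy'.
have [_ uU] := cu; have [_ vV] := cv.
have := @gronwall R n a b Cf (`|x - x'| + Cf * (b - a) + Cf * (b - a))
  (fun s => y s - y' s) Cf_gt0 (ac_onB ay ay').
rewrite ya ya'; apply => //.
  move=> r rab; have := lip_on_dist ly rab; have := lip_on_dist ly' rab.
  rewrite ya ya' => h1 h2.
  have -> : y r - y' r = (x - x') + (y r - x) - (y' r - x').
    by apply/rowP => i; rewrite !mxE; ring.
  apply: (le_trans (ler_normB _ _)); rewrite lerD//.
  by apply: (le_trans (ler_normD _ _)); rewrite lerD2l.
apply: ae_mono (ae_and dy dy') => r [h1 h2] rab.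
exists (f (y r) (u r) (v r) - f (y' r) (u r) (v r)).
  by have := h1 rab; have := h2 rab => ? ?; apply: is_deriveB.
by apply: f_lipschitz; [exact: uU|exact: vV].
Qed.
End ode.

(** * Test functions *)

Section test_functions.
Context {R : realType} {n : nat}.
Implicit Types (D : set ('rV[R]_n * R)) (W : 'rV[R]_n * R -> R).

Lemma smooth_differentiable D W z : smooth_on D W -> D z -> differentiable W z.
Proof. by move=> sW Dz; have [+ _] := sW 1%N; apply. Qed.

Lemma smooth_derive_continuous D W z w : smooth_on D W -> D z ->
  {for z, continuous (fun z => 'D_w W z)}.
Proof. by move=> sW Dz; have [_ /(_ w)] := sW 1%N; apply. Qed.

Lemma partial_tE W z : partial_t W z = 'D_(0, 1) W z.
Proof.
rewrite /partial_t derive1E /derive; case: z => x t /=.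
apply: (congr1 (fun g : R -> R => lim (g @ 0^'))); apply/funext => k /=.
congr (_ *: (W _ - _)).
by rewrite [RHS]surjective_pairing/= scaler0 add0r.
Qed.

Lemma partial_xE W z i : partial_x W z 0 i = 'D_(delta_mx 0 i, 0) W z.
Proof.
rewrite /partial_x mxE /derive; case: z => x t /=.
apply: (congr1 (fun g : R -> R => lim (g @ 0^'))); apply/funext => k /=.
congr (_ *: (W _ - _)).
by rewrite [RHS]surjective_pairing/= scaler0 add0r.
Qed.

Lemma diff_partials W z a s : differentiable W z ->
  'd W z (a, s) = s * partial_t W z + \sum_(i < n) a 0 i * partial_x W z 0 i.
Proof.
move=> dW; have -> : (a, s) = s *: (0, 1) +
    \sum_(i < n) a 0 i *: ((delta_mx 0 i : 'rV[R]_n), (0 : R)).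
  rewrite [LHS]surjective_pairing [RHS]surjective_pairing /=; congr pair.
    rewrite scaler0 add0r raddf_sum/= {1}(row_sum_delta a).
    by apply: eq_bigr => i _.
  rewrite raddf_sum/= big1 ?addr0 => [|i _]; first by rewrite -[_ *: _]/(s * 1) mulr1.
  exact: scaler0.
rewrite linearD linearZ/= linear_sum/= partial_tE deriveE//; congr (_ + _).
by apply: eq_bigr => i _; rewrite linearZ/= partial_xE deriveE.
Qed.

Lemma is_derive_test W (y : R -> 'rV[R]_n) s c : is_derive s (1 : R) y c ->
  differentiable W (y s, s) ->
  is_derive s (1 : R) (fun r => W (y r, r))
    (partial_t W (y s, s) + \sum_(i < n) c 0 i * partial_x W (y s, s) 0 i).
Proof.
move=> dy dW.
have dy' : differentiable y s by apply/derivable1_diffP; case: dy.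
have dP : differentiable (fun r => (y r, r)) s by apply: differentiable_pair.
have dWP : differentiable (W \o (fun r => (y r, r))) s by apply: differentiable_comp.
apply: DeriveDef; first exact: diff_derivable.
have dyc : 'd y s 1 = c by rewrite -deriveE//; case: dy.
have did : 'd (fun r : R => r) s 1 = 1 by rewrite -deriveE// derive_id.
rewrite deriveE// diff_comp// /= diff_pair//= dyc did diff_partials// mul1r.
by [].
Qed.

Lemma smooth_near D W z0 e : open D -> smooth_on D W -> D z0 -> 0 < e ->
  exists2 r, 0 < r & forall z, ball z0 r z -> [/\ D z,
    forall i, `|partial_x W z 0 i - partial_x W z0 0 i| <= e &
    `|partial_t W z - partial_t W z0| <= e].
Proof.
move=> oD sW Dz0 e0.
have hD w : \forall z \near z0, `|'D_w W z - 'D_w W z0| <= e.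
  have /cvgrPdist_le/(_ e e0) := @smooth_derive_continuous D W z0 w sW Dz0.
  by apply: filterS => z; rewrite distrC.
have : \forall z \near z0, [/\ D z,
    forall i, `|partial_x W z 0 i - partial_x W z0 0 i| <= e &
    `|partial_t W z - partial_t W z0| <= e].
  have h1 : \forall z \near z0, D z by apply: open_nbhs_nbhs.
  have h2 : \forall z \near z0, forall i, `|partial_x W z 0 i - partial_x W z0 0 i| <= e.
    apply: (@filter_forall _ _ (fun i z => `|partial_x W z 0 i - partial_x W z0 0 i| <= e) (nbhs z0)) => i.
    by apply: filterS (hD (delta_mx 0 i, 0)) => z; rewrite !partial_xE.
  have h3 := hD (0, 1).
  apply: filterS3 h1 h2 h3 => z Dz hx ht; split => //.
  by rewrite !partial_tE.
by move=> /nbhs_ballP[r /= r0 hr]; exists r.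
Qed.

(** The mean value theorem on a segment, which stays in the ball by convexity; [n + 1] counts the
    partial derivatives. It makes a test function absolutely continuous along a Lipschitz
    trajectory. *)
Lemma smooth_lipschitz D W z0 r G : smooth_on D W -> 0 <= G ->
  (forall z, ball z0 r z -> [/\ D z, forall i, `|partial_x W z 0 i| <= G &
     `|partial_t W z| <= G]) ->
  forall z z', ball z0 r z -> ball z0 r z' ->
    `|W z' - W z| <= (n%:R + 1) * G * `|z' - z|.
Proof.
move=> sW G0 hG z z' bz bz'.
pose w := z' - z; pose g (s : R) := W (z + s *: w).
have bseg s : 0 <= s <= 1 -> ball z0 r (z + s *: w).
  move=> /andP[s0 s1]; move: bz bz'; rewrite ball_prod_normE /ball_/= => bz bz'.
  have -> : z0 - (z + s *: w) = (1 - s) *: (z0 - z) + s *: (z0 - z').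
    rewrite /w !scalerBr !scalerBl !scale1r opprD opprB !addrA.
    by rewrite [_ - (z - _) + _]addrAC subrK opprB addrA [_ + _ - z]addrAC.
  apply: (le_lt_trans (ler_normD _ _)); rewrite !normrZ (ger0_norm s0).
  rewrite ger0_norm ?subr_ge0//.
  pose M := Num.max `|z0 - z| `|z0 - z'|.
  have M1 : `|z0 - z| <= M by rewrite le_max lexx.
  have M2 : `|z0 - z'| <= M by rewrite le_max lexx orbT.
  have Mr : M < r by rewrite gt_max bz.
  nra.
have dg (s : R) : 0 <= s <= 1 -> is_derive s (1 : R) g ('d W (z + s *: w) w).
  move=> /bseg bs; have [Dz _ _] := hG _ bs.
  have dW := smooth_differentiable sW Dz.
  have E : (fun k : R => k^-1 *: ((g \o shift s) (k *: (1 : R)) - g s)) =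
     (fun k : R => k^-1 *: ((W \o shift (z + s *: w)) (k *: w) - W (z + s *: w))).
    apply/funext => k /=; congr (_ *: (W _ - _)).
    by rewrite -[_%:A]/(k * 1) mulr1 scalerDl addrCA.
  apply: DeriveDef; first by rewrite /derivable E; apply: diff_derivable.
  by rewrite /derive E -/(derive W (z + s *: w) w) deriveE.
have cg : {within `[0, 1], continuous g}.
  by apply: derivable_within_continuous => s; rewrite in_itv/= => /dg; case.
have [c] := @MVT_segment R g (fun s => 'd W (z + s *: w) w) 0 1 ler01
  (fun s hs => dg s (subset_itv_oo_cc hs)) cg.
rewrite in_itv/= => c01; rewrite /g scale1r scale0r addr0 subr0 mulr1.
have -> : z + w = z' by rewrite /w addrC subrK.
move=> ->; rewrite -/w.
have [Dz hx ht] := hG _ (bseg _ c01).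
rewrite [w]surjective_pairing diff_partials; last exact: smooth_differentiable sW Dz.
have w1 : `|w.1| <= `|w| by rewrite prod_normE le_max lexx.
have w2 : `|w.2| <= `|w| by rewrite prod_normE le_max lexx orbT.
apply: (le_trans (ler_normD _ _)); rewrite -surjective_pairing.
have -> : (n%:R + 1) * G * `|w| = G * `|w| + n%:R * G * `|w| by ring.
apply: lerD; first by rewrite normrM mulrC ler_pM.
apply: (le_trans (ler_norm_sum _ _ _)).
apply: (@le_trans _ _ (\sum_(i < n) G * `|w|)).
  apply: ler_sum => i _; rewrite normrM mulrC ler_pM//; apply: le_trans w1.
  exact: ((rV_norm_leP _ (normr_ge0 _)).2 (lexx _) i).
by rewrite sumr_const card_ord -(mulr_natl (G * _)) mulrA.
Qed.

End test_functions.

(** A class closed under directional derivatives turns smoothness of every order into one induction.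
    It is stated for any normed module because doubling also needs polynomials on pairs of
    points. *)
Inductive polynomial_fun (R : realType) (X : normedModType R) : (X -> R) -> Prop :=
| poly_cst c : polynomial_fun (cst c)
| poly_linear (L : {linear X -> R}) : continuous L -> polynomial_fun L
| poly_add f g : polynomial_fun f -> polynomial_fun g -> polynomial_fun (f \+ g)
| poly_mul f g : polynomial_fun f -> polynomial_fun g -> polynomial_fun (f \* g).

Section polynomials.
Context {R : realType}.

Lemma poly_scalar_linear (X : normedModType R) (L : X -> R) :
  (forall a u v, L (a *: u + v) = a * L u + L v) -> continuous L ->
  polynomial_fun L.
Proof.
move=> hL cL.
pose LL : {linear X -> R} := HB.pack L (GRing.isLinear.Build R X R *%R L hL).
exact: (@poly_linear R X LL).
Qed.

Lemma poly_sum (X : normedModType R) (k : nat) (g : 'I_k -> X -> R) :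
  (forall i, polynomial_fun (g i)) -> polynomial_fun (fun z => \sum_(i < k) g i z).
Proof.
elim: k g => [|k IH] g hg.
  have -> : (fun z => \sum_(i < 0) g i z) = cst 0 by apply/funext => z; rewrite big_ord0.
  exact: poly_cst.
have -> : (fun z => \sum_(i < k.+1) g i z) =
   (fun z => \sum_(i < k) g (widen_ord (leqnSn k) i) z) \+ g ord_max.
  by apply/funext => z; rewrite big_ord_recr.
by apply: poly_add => //; exact: IH.
Qed.

Lemma poly_differentiable (X : normedModType R) (W : X -> R) :
  polynomial_fun W -> forall z, differentiable W z.
Proof.
elim=> {W} [c|L cL|f g _ hf _ hg|f g _ hf _ hg] z.
- exact: differentiable_cst.
- exact: linear_differentiable.
- exact: differentiableD.
- exact: differentiableM.
Qed.

Lemma poly_continuous (X : normedModType R) (W : X -> R) :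
  polynomial_fun W -> continuous W.
Proof. by move=> pW z; apply: differentiable_continuous; exact: poly_differentiable. Qed.

Lemma poly_derive (X : normedModType R) (W : X -> R) (w : X) :
  polynomial_fun W -> polynomial_fun (fun z => 'D_w W z).
Proof.
elim=> {W} [c|L cL|f g pf hf pg hg|f g pf hf pg hg].
- have -> : (fun z => 'D_w (cst c) z) = cst 0 by apply/funext => z; exact: derive_cst.
  exact: poly_cst.
- have -> : (fun z => 'D_w L z) = cst (L w).
    apply/funext => z; rewrite deriveE; last exact: linear_differentiable.
    by rewrite diff_lin.
  exact: poly_cst.
- have -> : (fun z => 'D_w (f \+ g) z) = (fun z => 'D_w f z) \+ (fun z => 'D_w g z).
    apply/funext => z /=; rewrite -deriveD//; apply: diff_derivable; exact: poly_differentiable.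
  exact: poly_add.
- have -> : (fun z => 'D_w (f \* g) z) =
      (f \* (fun z => 'D_w g z)) \+ (g \* (fun z => 'D_w f z)).
    apply/funext => z /=; rewrite -[_ * _]/(_ *: _) -[X in _ + X]/(_ *: _).
    rewrite -deriveM//; apply: diff_derivable; exact: poly_differentiable.
  by apply: poly_add; exact: poly_mul.
Qed.

Lemma poly_smooth (n : nat) (D : set ('rV[R]_n * R)) (W : 'rV[R]_n * R -> R) :
  polynomial_fun W -> smooth_on D W.
Proof.
move=> pW k; elim: k W pW => [|k IH] W pW /=; first by move=> z _; exact: poly_continuous.
by split=> [z _|w]; [exact: poly_differentiable|apply: IH; exact: poly_derive].
Qed.

Lemma coord1_continuous (n : nat) (i : 'I_n) :
  continuous (fun z : 'rV[R]_n * R => z.1 0 i).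
Proof.
move=> z; apply: (@continuous_comp _ _ _ fst (fun x : 'rV[R]_n => x 0 i)).
  exact: cvg_fst.
exact: coord_continuous.
Qed.

Lemma poly_coord (n : nat) (i : 'I_n) : polynomial_fun (fun z : 'rV[R]_n * R => z.1 0 i).
Proof.
apply: poly_scalar_linear; last exact: coord1_continuous.
by move=> a u v /=; rewrite !mxE.
Qed.

Lemma poly_time (n : nat) : polynomial_fun (fun z : 'rV[R]_n * R => z.2).
Proof. by apply: poly_scalar_linear => // z; exact: cvg_snd. Qed.

(* Squared Euclidean distance: unlike the sup norm of the library, it is smooth. *)
Definition dist2 (n : nat) (z z' : 'rV[R]_n * R) : R :=
  (z.2 - z'.2) ^+ 2 + \sum_(i < n) (z.1 0 i - z'.1 0 i) ^+ 2.

(** A test function with prescribed partials [a] and [b] at [z0]; the coefficient [K] absorbs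
    second-order remainders without changing them. *)
Definition quadratic (n : nat) (z0 : 'rV[R]_n * R) (b : 'rV[R]_n) (a K : R)
    (z : 'rV[R]_n * R) : R :=
  a * (z.2 - z0.2) + \sum_(i < n) b 0 i * (z.1 0 i - z0.1 0 i) + K * dist2 z z0.

Lemma poly_sub_cst (X : normedModType R) (g : X -> R) c : polynomial_fun g ->
  polynomial_fun (fun z => g z - c).
Proof. by move=> pg; apply: (@poly_add _ _ g (cst (- c))) => //; exact: poly_cst. Qed.

Lemma poly_scale (X : normedModType R) (g : X -> R) c : polynomial_fun g ->
  polynomial_fun (fun z => c * g z).
Proof. by move=> pg; apply: (@poly_mul _ _ (cst c) g) => //; exact: poly_cst. Qed.

Lemma poly_sqr (X : normedModType R) (g : X -> R) : polynomial_fun g ->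
  polynomial_fun (fun z => g z ^+ 2).
Proof.
move=> pg; have -> : (fun z => g z ^+ 2) = g \* g by apply/funext => z; rewrite expr2.
exact: poly_mul.
Qed.

Lemma poly_dist2 (n : nat) (z0 : 'rV[R]_n * R) : polynomial_fun (fun z => dist2 z z0).
Proof.
have -> : (fun z => dist2 z z0) = (fun z : 'rV[R]_n * R => (z.2 - z0.2) ^+ 2) \+
  (fun z => \sum_(i < n) (z.1 0 i - z0.1 0 i) ^+ 2) by [].
apply: poly_add.
  by apply: poly_sqr; apply: poly_sub_cst; exact: poly_time.
by apply: poly_sum => i; apply: poly_sqr; apply: poly_sub_cst; exact: poly_coord.
Qed.

Lemma poly_quadratic (n : nat) (z0 : 'rV[R]_n * R) b a K :
  polynomial_fun (quadratic z0 b a K).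
Proof.
have -> : quadratic z0 b a K = (fun z : 'rV[R]_n * R => a * (z.2 - z0.2)) \+
   (fun z : 'rV[R]_n * R => \sum_(i < n) b 0 i * (z.1 0 i - z0.1 0 i)) \+
   (fun z : 'rV[R]_n * R => K * dist2 z z0) by [].
apply: poly_add; last by apply: poly_scale; exact: poly_dist2.
apply: poly_add.
  by apply: poly_scale; apply: poly_sub_cst; exact: poly_time.
by apply: poly_sum => i; apply: poly_scale; apply: poly_sub_cst; exact: poly_coord.
Qed.

Lemma dist2xx (n : nat) (z : 'rV[R]_n * R) : dist2 z z = 0.
Proof. by rewrite /dist2 subrr expr0n add0r big1// => i _; rewrite subrr expr0n. Qed.

Lemma dist2_ge0 (n : nat) (z z' : 'rV[R]_n * R) : 0 <= dist2 z z'.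
Proof. by rewrite addr_ge0 ?sqr_ge0// sumr_ge0// => i _; exact: sqr_ge0. Qed.

Lemma quadratic0 (n : nat) (z0 : 'rV[R]_n * R) b a K : quadratic z0 b a K z0 = 0.
Proof.
rewrite /quadratic dist2xx subrr !mulr0 addr0 add0r big1// => i _.
by rewrite subrr mulr0.
Qed.

Lemma norm_dist2 (n : nat) (z z' : 'rV[R]_n * R) : `|z - z'| ^+ 2 <= dist2 z z'.
Proof.
have S0 : 0 <= \sum_(i < n) (z.1 0 i - z'.1 0 i) ^+ 2.
  by apply: sumr_ge0 => i _; exact: sqr_ge0.
rewrite prod_normE/=; set s := Num.sqrt (dist2 z z').
suff h : Num.max `|z.1 - z'.1| `|z.2 - z'.2| <= s.
  by rewrite -(sqr_sqrtr (dist2_ge0 z z')) lerXn2r ?nnegrE ?sqrtr_ge0//.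
rewrite ge_max; apply/andP; split.
  apply/rV_norm_leP => [|i]; first exact: sqrtr_ge0.
  rewrite !mxE -sqrtr_sqr ler_wsqrtr// /dist2 (bigD1 i)//=.
  rewrite addrCA lerDl addr_ge0 ?sqr_ge0// sumr_ge0// => j _; exact: sqr_ge0.
by rewrite -sqrtr_sqr ler_wsqrtr// /dist2 lerDl.
Qed.

Lemma derive_quadratic_growth (n : nat) (W : 'rV[R]_n * R -> R) z w A B :
  (forall k : R, W (k *: w + z) - W z = k * A + k ^+ 2 * B) -> 'D_w W z = A.
Proof.
move=> hW; apply/cvg_lim => //; apply/cvgrPdist_le => e e0.
have B0 : 0 < `|B| + 1 by rewrite ltr_wpDl.
apply/nbhs_ballP; exists (e / (`|B| + 1)); first by rewrite /= divr_gt0.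
move=> k; rewrite /ball/= sub0r normrN ltr_pdivlMr// => hk k0.
rewrite hW -[_ *: _]/(_ * _) mulrDr mulKf// expr2 -mulrA mulKf// opprD addrA subrr.
rewrite sub0r normrN normrM; apply: le_trans (ltW hk); rewrite ler_wpM2l//.
by rewrite lerDl.
Qed.

Lemma partials_quadratic (n : nat) (z0 : 'rV[R]_n * R) b a K :
  partial_t (quadratic z0 b a K) z0 = a /\ partial_x (quadratic z0 b a K) z0 = b.
Proof.
have E (k : R) (w : 'rV[R]_n * R) : quadratic z0 b a K (k *: w + z0) - quadratic z0 b a K z0 =
    k * (a * w.2 + \sum_(i < n) b 0 i * w.1 0 i) +
    k ^+ 2 * (K * (w.2 ^+ 2 + \sum_(i < n) w.1 0 i ^+ 2)).
  rewrite quadratic0 subr0 /quadratic /dist2 /=.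
  have -> : k *: w.2 + z0.2 - z0.2 = k * w.2 by rewrite addrK.
  have e1 i : (k *: w.1 + z0.1) 0 i - z0.1 0 i = k * w.1 0 i by rewrite !mxE addrK.
  under eq_bigr => i _ do rewrite e1.
  under [X in K * (_ + X)]eq_bigr => i _ do rewrite e1 exprMn.
  rewrite -mulr_sumr; under eq_bigr => i _ do rewrite mulrCA.
  by rewrite -mulr_sumr; ring.
split.
  rewrite partial_tE (derive_quadratic_growth (E^~ _)) /= mulr1 big1 ?addr0// => i _.
  by rewrite mxE mulr0.
apply/rowP => i; rewrite partial_xE (derive_quadratic_growth (E^~ _)) /= mulr0 add0r.
rewrite (bigD1 i)//= mxE !eqxx mulr1 big1 ?addr0// => j ji.
by rewrite mxE (negbTE ji) andbF mulr0.
Qed.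

(** * Uniform continuity and doubling of variables *)

Lemma heine (X : normedModType R) (Q : set X) (A : X -> R) e : compact Q ->
  {within Q, continuous A} -> 0 < e ->
  exists2 d, 0 < d & forall x y, Q x -> Q y -> `|x - y| < d -> `|A x - A y| < e.
Proof.
move=> cQ /subspace_continuousP cA e0; have e20 : 0 < e / 2 by rewrite divr_gt0.
have /compact_near_coveringP cov := cQ.
have := cov R (0^'+) (fun d x => Q x -> forall y, Q y -> `|x - y| < d -> `|A x - A y| < e).
move=> /(_ _)[].
  move=> x Qx; have /cvgrPdist_lt/(_ _ e20)/nbhs_ballP[r /= r0 hr] := cA x Qx.
  have r20 : 0 < r / 2 by rewrite divr_gt0.
  exists (ball x (r / 2), [set d | d < r / 2]) => /=.
    split; first exact: nbhsx_ballx.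
    exact: nbhs_right_lt.
  move=> [x' d] [/= xx dr] Qx' y Qy xy.
  have h1 : `|A x - A x'| < e / 2.
    by apply: hr => //; apply: le_ball xx; lra.
  have h2 : `|A x - A y| < e / 2.
    apply: hr => //; move: xx; rewrite -!ball_normE /ball_/= => xx.
    rewrite (le_lt_trans (ler_distD x' _ _))//; lra.
  rewrite (le_lt_trans (ler_distD (A x) _ _))// [e]splitr ltrD//.
  by rewrite distrC.
move=> d /= d0 hd.
exists (d / 2); first by rewrite divr_gt0.
move=> x y Qx Qy xy; apply: (hd (d / 2)) => //=.
  rewrite /ball/= sub0r normrN gtr0_norm; lra.
by rewrite divr_gt0.
Qed.

(** A maximum of [A z - B z' - N * dist2 z z'] on [Q * Q] touches [A] from above in [z] and [B] from
    below in [z']. Uniform continuity on the compact [Q] lets a single [N] achieve precision [e], in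
    place of a limit. *)
Lemma doubling (n : nat) (Q : set ('rV[R]_n * R)) (A B : 'rV[R]_n * R -> R) zb e :
  compact Q -> {within Q, continuous A} -> {within Q, continuous B} -> Q zb -> 0 < e ->
  exists N z z', [/\ 0 < N, Q z /\ Q z',
    A zb - B zb <= A z - B z',
    (forall y, Q y -> A y - N * dist2 y z' <= A z - N * dist2 z z') /\
    (forall y, Q y -> B z' + N * dist2 z z' <= B y + N * dist2 z y) &
    [/\ `|A z - A z'| <= e, `|B z - B z'| <= e, N * dist2 z z' <= e & `|z - z'| <= e]].
Proof.
move=> cQ cA cB Qb e0.
have [dA dA0 hA] := heine cQ cA e0; have [dB dB0 hB] := heine cQ cB e0.
have Q0 : Q !=set0 by exists zb.
have [za Qa ha] := compact_EVT_max Q0 cQ cA.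
have [zc Qc hc] := compact_EVT_min Q0 cQ cB.
pose d := Num.min e (Num.min dA dB).
have d0 : 0 < d by rewrite !lt_min e0 dA0.
pose w0 := A zb - B zb.
have w0le : w0 <= A za - B zc by rewrite /w0 lerB ?ha ?hc ?inE.
(* At a maximum, comparison with [(zb, zb)] bounds [N * dist2 z z'] by [A za - B zc - w0], so this
   [N] brings the two points within [d / 2]. The added 1 keeps [N] positive. *)
pose N := (A za - B zc - w0 + 1) / (d / 2) ^+ 2.
have d20 : 0 < (d / 2) ^+ 2 by rewrite exprn_gt0// divr_gt0.
have N0 : 0 < N by rewrite divr_gt0//; lra.
pose Phi (zz : ('rV[R]_n * R) * ('rV[R]_n * R)) :=
  A zz.1 - B zz.2 - N * dist2 zz.1 zz.2.
have cQQ : compact (Q `*` Q) by exact: compact_setX.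
have cPhi : {within Q `*` Q, continuous Phi}.
  have pd : polynomial_fun (fun zz : ('rV[R]_n * R) * ('rV[R]_n * R) => dist2 zz.1 zz.2).
    have c2 (X Y Z : topologicalType) (g1 : X -> Y) (g2 : Y -> Z) :
        continuous g1 -> continuous g2 -> continuous (g2 \o g1).
      by move=> h1 h2 x; apply: continuous_comp; [exact: h1|exact: h2].
    have cf1 : continuous (@fst ('rV[R]_n * R) ('rV[R]_n * R)) by move=> x; exact: cvg_fst.
    have cf2 : continuous (@snd ('rV[R]_n * R) ('rV[R]_n * R)) by move=> x; exact: cvg_snd.
    have ct : continuous (@snd 'rV[R]_n R) by move=> x; exact: cvg_snd.
    have sub (g1 g2 : ('rV[R]_n * R) * ('rV[R]_n * R) -> R) : polynomial_fun g1 ->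
        polynomial_fun g2 -> polynomial_fun (fun zz => (g1 zz - g2 zz) ^+ 2).
      move=> p1 p2; apply: poly_sqr.
      have -> : (fun zz => g1 zz - g2 zz) = g1 \+ (fun zz => -1 * g2 zz).
        by apply/funext => zz /=; rewrite mulN1r.
      by apply: poly_add => //; exact: poly_scale.
    apply: (@poly_add _ _ (fun zz : ('rV[R]_n * R) * ('rV[R]_n * R) => (zz.1.2 - zz.2.2) ^+ 2)
      (fun zz => \sum_(i < n) (zz.1.1 0 i - zz.2.1 0 i) ^+ 2)).
      by apply: sub; apply: poly_scalar_linear => //; exact: (c2 _ _ _ _ _ _ ct).
    apply: poly_sum => i; apply: sub; apply: poly_scalar_linear.
    + by move=> a u v /=; rewrite !mxE.
    + exact: (c2 _ _ _ _ _ cf1 (@coord1_continuous n i)).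
    + by move=> a u v /=; rewrite !mxE.
    + exact: (c2 _ _ _ _ _ cf2 (@coord1_continuous n i)).
  have cA1 : {within Q `*` Q, continuous (fun zz => A zz.1)}.
    apply/subspace_continuousP => -[z z'] [/= Qz Qz'].
    apply/cvgrPdist_lt => k k0; move/subspace_continuousP/(_ z Qz): cA.
    move=> /cvgrPdist_lt/(_ k k0)/nbhs_ballP[r /= r0 hr]; apply/nbhs_ballP.
    by exists r => // -[y y'] [/= yz yz'] [/= Qy Qy']; exact: hr.
  have cB2 : {within Q `*` Q, continuous (fun zz => B zz.2)}.
    apply/subspace_continuousP => -[z z'] [/= Qz Qz'].
    apply/cvgrPdist_lt => k k0; move/subspace_continuousP/(_ z' Qz'): cB.
    move=> /cvgrPdist_lt/(_ k k0)/nbhs_ballP[r /= r0 hr]; apply/nbhs_ballP.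
    by exists r => // -[y y'] [/= yz yz'] [/= Qy Qy']; exact: hr.
  have cD : {within Q `*` Q, continuous (fun zz => N * dist2 zz.1 zz.2)}.
    by apply: continuous_subspaceT; apply: poly_continuous; exact: poly_scale.
  move=> zz; apply: cvgB; last exact: cD.
  by apply: cvgB; [exact: cA1|exact: cB2].
have [[z z'] zQ hmax] := compact_EVT_max (ex_intro _ (zb, zb) (conj Qb Qb)) cQQ cPhi.
have {zQ}[Qz Qz'] : Q z /\ Q z' by move: zQ; rewrite inE.
have {}hmax y y' : Q y -> Q y' ->
    A y - B y' - N * dist2 y y' <= A z - B z' - N * dist2 z z'.
  by move=> Qy Qy'; apply: (hmax (y, y')); rewrite inE.
have hb : w0 <= A z - B z' - N * dist2 z z'.
  by have := hmax zb zb Qb Qb; rewrite dist2xx mulr0 subr0.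
have hAz : A z <= A za by apply: ha; rewrite inE.
have hBz : B zc <= B z' by apply: hc; rewrite inE.
have hdist : dist2 z z' <= (d / 2) ^+ 2.
  have : N * dist2 z z' <= A za - B zc - w0 by lra.
  rewrite /N mulrAC ler_pdivrMr// => h1.
  have := dist2_ge0 z z'; have K0 : 0 <= A za - B zc - w0 by lra.
  move: h1 d20; set k := A za - B zc - w0 in K0 *; set q := (d / 2) ^+ 2.
  set s := dist2 z z'; nra.
have hzz : `|z - z'| <= d / 2.
  have d2 : 0 <= d / 2 by rewrite divr_ge0// ltW.
  rewrite -(@ler_pXn2r _ 2%N)// ?nnegrE//.
  exact: le_trans (norm_dist2 z z') hdist.
have hzzd : `|z - z'| < d by lra.
have hAA : `|A z - A z'| < e.
  by apply: hA => //; apply: lt_le_trans hzzd _; rewrite /d !ge_min lexx !orbT.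
have hBB : `|B z - B z'| < e.
  by apply: hB => //; apply: lt_le_trans hzzd _; rewrite /d !ge_min lexx !orbT.
have Nd0 : 0 <= N * dist2 z z' by rewrite mulr_ge0 ?dist2_ge0// ltW.
exists N, z, z'; split => //.
- by rewrite -/w0; lra.
- split => y Qy; first by have := hmax y z' Qy Qz'; lra.
  by have := hmax z y Qz Qy; lra.
- split; [exact: ltW|exact: ltW| |].
    (* Comparison with the diagonal point [(z, z)] bounds the penalty by [B z - B z'], which is
       already small. *)
    have := hmax z z Qz Qz; rewrite dist2xx mulr0 subr0.
    by move: hBB; rewrite ltr_norml => /andP[_]; lra.
  apply: (le_trans (ltW hzzd)); by rewrite /d ge_min lexx.
Qed.
End polynomials.

(** * Dynamic programming *)

Section game.
Context {R : realType} {n m p : nat} {T : R}.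
Context {U : set 'rV[R]_m} {VV : set 'rV[R]_p}.
Context {f : 'rV[R]_n -> 'rV[R]_m -> 'rV[R]_p -> 'rV[R]_n}.
Context {l h : 'rV[R]_n -> R} {Cf Cl Ch : R}.
Context (U_neq0 : U !=set0) (VV_neq0 : VV !=set0).
Context (Cf_gt0 : 0 < Cf) (Cl_gt0 : 0 < Cl) (Ch_gt0 : 0 < Ch).
Context (f_continuous : forall x : 'rV[R]_n,
      {within U `*` VV, continuous (fun w : 'rV[R]_m * 'rV[R]_p => f x w.1 w.2)})
  (f_bounded : forall x u v, U u -> VV v -> `|f x u v| <= Cf)
  (f_lipschitz : forall x x' u v, U u -> VV v ->
      `|f x u v - f x' u v| <= Cf * `|x - x'|)
  (l_bounded : forall x, `|l x| <= Cl)
  (l_lipschitz : forall x x', `|l x - l x'| <= Cl * `|x - x'|)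
  (h_bounded : forall x, `|h x| <= Ch)
  (h_lipschitz : forall x x', `|h x - h x'| <= Ch * `|x - x'|).

(** * Controls, concatenation and causality of trajectories *)

Lemma controls_cst k (K : set 'rV[R]_k) a b c : K c -> controls K a b (cst c).
Proof. by move=> Kc; split => //; exact: measurable_cst. Qed.

Lemma controls_restrict k (K : set 'rV[R]_k) a b a' b' u : a <= a' -> b' <= b ->
  controls K a b u -> controls K a' b' u.
Proof.
move=> aa bb [mu uK].
have sub s : s \in `[a', b'] -> s \in `[a, b].
  by rewrite !in_itv/= => /andP[as_ sb]; rewrite (le_trans aa as_) (le_trans sb bb).
split; last by move=> s /sub; exact: uK.
have mI c d : lmeasurable (`[c, d]%classic : set R) by apply: borel_lmeasurable.
apply/lebesgue_measurable_funP => // j.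
have -> : `[a', b']%classic `&` u @^-1` rat_ball j =
    `[a', b']%classic `&` (`[a, b]%classic `&` u @^-1` rat_ball j).
  by apply/seteqP; split => [s [/= /[dup] sab /sub sab' us]|s [/= sab [_ us]]].
apply: measurableI; first exact: mI.
exact: (lebesgue_measurable_funP u (mI _ _)).2 mu j.
Qed.

(** The switch is strict: the result equals [u2] everywhere from [t'] on, and [u1] before [t']; on
    an interval ending at [t'] only the single point [t'] is affected. *)
Definition concat k (t' : R) (u1 u2 : R -> 'rV[R]_k) (s : R) : 'rV[R]_k :=
  if s < t' then u1 s else u2 s.

Lemma controls_concat k (K : set 'rV[R]_k) a t' b u1 u2 : a <= t' -> t' <= b ->
  controls K a b u1 -> controls K t' b u2 -> controls K a b (concat t' u1 u2).
Proof.
move=> at' t'b [m1 u1K] [m2 u2K]; split; last first.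
  move=> s sab; rewrite /concat; case: ltP => st'; first exact: u1K.
  by apply: u2K; move: sab; rewrite !in_itv/= st' => /andP[].
have mI c d : lmeasurable (`[c, d]%classic : set R) by apply: borel_lmeasurable.
apply/lebesgue_measurable_funP => // j.
have -> : `[a, b]%classic `&` concat t' u1 u2 @^-1` rat_ball j =
   ((`[a, b]%classic `&` u1 @^-1` rat_ball j) `&` `]-oo, t'[%classic) `|`
   (`[t', b]%classic `&` u2 @^-1` rat_ball j).
  apply/seteqP; split => [s [/= sab]|s /= [[[sab us]]|[stb us]]].
  - rewrite /concat; case: ltP => st' us; [left|right]; split => //=.
    by move: sab; rewrite !in_itv/= st' => /andP[].
  - by rewrite in_itv/= => st'; split => //; rewrite /concat st'.
  - move: stb; rewrite in_itv/= => /andP[ts sb]; split.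
      by rewrite in_itv/= sb (le_trans at').
    by rewrite /concat ltNge ts.
apply: measurableU; last exact: (lebesgue_measurable_funP u2 (mI _ _)).2 m2 j.
apply: measurableI; first exact: (lebesgue_measurable_funP u1 (mI _ _)).2 m1 j.
exact: borel_lmeasurable.
Qed.

Lemma phi_solves t x u v : t <= T -> controls U t T u -> controls VV t T v ->
  solves_ode T f t x u v (fun tau => phi T f tau t x u v).
Proof.
move=> tT cu cv.
have [y hy] := solves_ode_exists Cf_gt0 f_continuous f_bounded f_lipschitz x tT cu cv.
exact: (@xgetPex _ (cst x) [set y | solves_ode T f t x u v y] (ex_intro _ y hy)).
Qed.

(** Causality: a trajectory up to [s] is determined by controls up to null sets on [[t, s]]. Gluing
    of trajectories and non-anticipation of the state rest on this form. *)
Lemma phi_unique t s x u v u' v' y : t <= s -> s <= T ->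
  controls U t T u -> controls VV t T v ->
  {ae lebesgue_measure, forall r, r \in `[t, s] -> u' r = u r} ->
  {ae lebesgue_measure, forall r, r \in `[t, s] -> v' r = v r} ->
  solves_ode s f t x u' v' y ->
  forall r, t <= r <= s -> phi T f r t x u v = y r.
Proof.
move=> ts sT cu cv eu ev sy r trs; apply/eqP; rewrite -subr_eq0 -normr_le0.
have sphi := phi_solves x (le_trans ts sT) cu cv.
have := solves_ode_restrict (lexx t) sT sphi.
have [_ -> _] := sphi => sphi'.
have := solves_ode_dist Cf_gt0 f_bounded f_lipschitz
  (controls_restrict (lexx t) sT cu) (controls_restrict (lexx t) sT cv) sphi'
  (solves_ode_ae eu ev sy) trs.
by rewrite subrr normr0 mulr0 mul0r.
Qed.

Lemma ae_refl_on k (a b : R) (u : R -> 'rV[R]_k) :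
  {ae lebesgue_measure, forall r, r \in `[a, b] -> u r = u r}.
Proof. by apply: aeW. Qed.

Lemma phi0 t x u v : t <= T -> controls U t T u -> controls VV t T v ->
  phi T f t t x u v = x.
Proof. by move=> tT cu cv; have [] := phi_solves x tT cu cv. Qed.

Lemma phi_lip t x u v r : t <= T -> controls U t T u -> controls VV t T v ->
  t <= r <= T -> `|phi T f r t x u v - x| <= Cf * (r - t).
Proof.
move=> tT cu cv /andP[tr rT].
have := solves_ode_lip f_bounded cu cv (phi_solves x tT cu cv).
by move=> /(_ t r (lexx _) tr rT); rewrite phi0.
Qed.

Lemma phi_dist t x x' u v r : t <= T -> controls U t T u -> controls VV t T v ->
  t <= r <= T -> `|phi T f r t x u v - phi T f r t x' u v| <=
    2 * `|x - x'| * expR (2 * Cf * (r - t)).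
Proof.
move=> tT cu cv trT.
exact: (solves_ode_dist Cf_gt0 f_bounded f_lipschitz cu cv
  (phi_solves x tT cu cv) (phi_solves x' tT cu cv) trT).
Qed.

(** The bound on [h] keeps the real-valued supremum meaningful; afterwards payoffs are handled
    through inequalities only. *)
Lemma payoff_leP t x u v M : t <= T ->
  payoff T f l h t x u v <= M <->
  l (phi T f T t x u v) <= M /\ forall r, t <= r <= T -> h (phi T f r t x u v) <= M.
Proof.
move=> tT; rewrite /payoff ge_max.
set S := [set _ | _ in _].
have hS : has_sup S.
  split; first by exists (h (phi T f t t x u v)); exists t => //=; rewrite in_itv/= lexx.
  by exists Ch => _ [r _ <-]; have := h_bounded (phi T f r t x u v); rewrite ler_norml => /andP[].
split => [/andP[-> Sle]|[-> hle]/=].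
  split => // r rT; apply: le_trans Sle; apply: sup_upper_bound => //.
  by exists r => //=; rewrite in_itv.
apply: ge_sup; first by case: hS.
by move=> _ [r /= rT <-]; apply: hle; move: rT; rewrite in_itv.
Qed.

Lemma payoff_ge_terminal t x u v : t <= T ->
  l (phi T f T t x u v) <= payoff T f l h t x u v.
Proof. by move=> tT; have [] := (payoff_leP x u v _ tT).1 (lexx _). Qed.

Lemma payoff_ge_running t x u v r : t <= r <= T ->
  h (phi T f r t x u v) <= payoff T f l h t x u v.
Proof.
move=> /[dup] trT /andP[tr rT].
by have [_] := (payoff_leP x u v _ (le_trans tr rT)).1 (lexx _); apply.
Qed.

Lemma payoff_lb t x u v : t <= T -> - Cl <= payoff T f l h t x u v.
Proof.
move=> tT; apply: le_trans (payoff_ge_terminal x u v tT).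
by have := l_bounded (phi T f T t x u v); rewrite ler_norml => /andP[].
Qed.

Lemma payoff_ub t x u v : t <= T -> payoff T f l h t x u v <= Cl + Ch.
Proof.
move=> tT; apply/payoff_leP => //; split => [|r _].
  have := l_bounded (phi T f T t x u v); rewrite ler_norml => /andP[_ /le_trans]; apply.
  by rewrite lerDl ltW.
have := h_bounded (phi T f r t x u v); rewrite ler_norml => /andP[_ /le_trans]; apply.
by rewrite lerDr ltW.
Qed.

Lemma controls_neq0 k (K : set 'rV[R]_k) t : K !=set0 -> exists v, controls K t T v.
Proof. by move=> [c Kc]; exists (cst c); exact: controls_cst. Qed.

Lemma has_sup_payoff t x (gamma : (R -> 'rV[R]_p) -> R -> 'rV[R]_m) : t <= T ->
  has_sup [set payoff T f l h t x (gamma v) v | v in controls VV t T].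
Proof.
move=> tT; have [v cv] := controls_neq0 t VV_neq0; split.
  by exists (payoff T f l h t x (gamma v) v); exists v.
by exists (Cl + Ch) => _ [w _ <-]; exact: payoff_ub.
Qed.

Lemma strategies_cst t c : U c -> strategies U VV t T (cst (cst c)).
Proof.
move=> Uc; split => [v _|s v v' _ _ _ _]; first exact: controls_cst.
exact: aeW.
Qed.

Lemma has_inf_value t x : t <= T ->
  has_inf [set sup [set payoff T f l h t x (gamma v) v | v in controls VV t T]
      | gamma in strategies U VV t T].
Proof.
move=> tT; split.
  have [c Uc] := U_neq0.
  by eexists; exists (cst (cst c)) => //; exact: strategies_cst.
exists (- Cl) => _ [gamma _ <-].
have [v cv] := controls_neq0 t VV_neq0.
apply: le_trans (payoff_lb x (gamma v) v tT) _.
by apply: sup_upper_bound; [exact: has_sup_payoff|exists v].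
Qed.

Lemma value_le t x M gamma : t <= T -> strategies U VV t T gamma ->
  (forall v, controls VV t T v -> payoff T f l h t x (gamma v) v <= M) ->
  value T U VV f l h (x, t) <= M.
Proof.
move=> tT sg hM; apply: (@le_trans _ _
    (sup [set payoff T f l h t x (gamma v) v | v in controls VV t T])).
  apply: ge_inf; first by case: (has_inf_value x tT).
  by exists gamma.
apply: ge_sup; first by case: (has_sup_payoff x gamma tT).
by move=> _ [v cv <-]; exact: hM.
Qed.

Lemma value_lt t x M : t <= T -> value T U VV f l h (x, t) < M ->
  exists2 gamma, strategies U VV t T gamma &
    forall v, controls VV t T v -> payoff T f l h t x (gamma v) v <= M.
Proof.
move=> tT vM; have e0 : 0 < M - value T U VV f l h (x, t) by rewrite subr_gt0.
have [_ [gamma sg <-] hlt] := inf_adherent e0 (has_inf_value x tT).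
exists gamma => // v cv; move: hlt; rewrite -/(value T U VV f l h (x, t)) addrC subrK.
move=> /ltW; apply: le_trans; apply: sup_upper_bound; first exact: has_sup_payoff.
by exists v.
Qed.

Lemma value_ge t x M : t <= T ->
  (forall gamma, strategies U VV t T gamma ->
     exists2 v, controls VV t T v & M <= payoff T f l h t x (gamma v) v) ->
  M <= value T U VV f l h (x, t).
Proof.
move=> tT hM; rewrite leNgt; apply/negP => vM.
pose M' := (M + value T U VV f l h (x, t)) / 2.
have vM' : value T U VV f l h (x, t) < M' by rewrite /M'; lra.
have [gamma sg hg] := value_lt tT vM'.
have [v cv hv] := hM gamma sg.
have := le_trans hv (hg v cv); rewrite /M'; lra.
Qed.

(** The family [g] of near-optimal strategies need not depend measurably on the state: for each [v]
    the single member [g (X v)] is used after [t']. *)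
Lemma dpp_upper t t' x M gamma1 : t <= t' -> t' <= T ->
  strategies U VV t T gamma1 ->
  (forall v, controls VV t T v ->
     value T U VV f l h (phi T f t' t x (gamma1 v) v, t') <= M /\
     forall r, t <= r <= t' -> h (phi T f r t x (gamma1 v) v) <= M) ->
  value T U VV f l h (x, t) <= M.
Proof.
move=> tt' t'T [cg1 ng1] hM; apply/ler_addgt0Pr => e e0.
have tT := le_trans tt' t'T.
(* States whose value exceeds [M] receive a constant strategy; by hypothesis [X v] is never one of
   them. *)
have /choice[g hg] x' : exists g, strategies U VV t' T g /\
   (value T U VV f l h (x', t') <= M ->
    forall v, controls VV t' T v -> payoff T f l h t' x' (g v) v <= M + e).
  have [vM|vM] := leP (value T U VV f l h (x', t')) M.
    have vMe : value T U VV f l h (x', t') < M + e by rewrite (le_lt_trans vM)// ltrDl.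
    by have [g sg hg] := value_lt t'T vMe; exists g.
  by have [c Uc] := U_neq0; exists (cst (cst c)); split; [exact: strategies_cst|].
pose X v := phi T f t' t x (gamma1 v) v.
pose gamma v := concat t' (gamma1 v) (g (X v) v).
have rV v : controls VV t T v -> controls VV t' T v by exact: controls_restrict.
have cg v : controls VV t T v -> controls U t' T (g (X v) v).
  by move=> cv; have [[+ _] _] := hg (X v); apply; exact: rV.
have sg : strategies U VV t T gamma.
  split=> [v cv|s v v' sT cv cv' evv'].
    by apply: controls_concat => //; [exact: cg1|exact: cg].
  have e1 := ng1 s v v' sT cv cv' evv'.
  have [st'|t's] := ltP s t'.
    apply: ae_mono e1 => r h1 rs; rewrite /gamma /concat.
    have -> : r < t' by move: rs; rewrite in_itv/= => /andP[_ rs]; exact: le_lt_trans st'.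
    exact: h1.
  (* The concatenation is non-anticipative because [X v] only sees [v] before [t']. *)
  have XX : X v = X v'.
    apply: (@phi_unique t t' x _ _ (gamma1 v') v'
      (fun r => phi T f r t x (gamma1 v') v')) => //.
    - exact: cg1.
    - apply: ae_mono e1 => r h1 rt'; rewrite h1//.
      by move: rt'; rewrite !in_itv/= => /andP[-> rt']; exact: le_trans t's.
    - apply: ae_mono evv' => r h1 rt'; rewrite h1//.
      by move: rt'; rewrite !in_itv/= => /andP[-> rt']; exact: le_trans t's.
    - have sp := phi_solves x tT (cg1 _ cv') cv'.
      by have := solves_ode_restrict (lexx t) t'T sp; rewrite phi0//; exact: cg1.
    - by rewrite tt' lexx.
  have sT' : s \in `[t', T] by move: sT; rewrite !in_itv/= t's => /andP[].
  have e2 : {ae lebesgue_measure, forall r, r \in `[t', s] -> g (X v) v r = g (X v') v' r}.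
    rewrite -XX; have [[_ +] _] := hg (X v); apply => //; [exact: rV|exact: rV|].
    apply: ae_mono evv' => r h1 rt'; apply: h1.
    by move: rt'; rewrite !in_itv/= => /andP[rt' ->]; rewrite (le_trans tt').
  apply: ae_mono (ae_and e1 e2) => r [h1 h2] rs; rewrite /gamma /concat.
  case: ltP => [rt'|t'r]; first exact: h1.
  by apply: h2; move: rs; rewrite !in_itv/= t'r => /andP[].
apply: (value_le tT sg) => v cv.
have cgv : controls U t T (gamma v) by have [+ _] := sg; apply.
have [vX hX] := hM v cv.
have sp := phi_solves x tT (cg1 _ cv) cv.
have sq := phi_solves x tT cgv cv.
have aelt k (u1 u2 : R -> 'rV[R]_k) :
    {ae lebesgue_measure, forall r, r \in `[t, t'] -> u1 r = concat t' u1 u2 r}.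
  exists [set t']; split => //; first exact: lebesgue_measure_set1.
  move=> r /= hr; apply: contrapT => rt'; apply: hr => rtt'.
  by rewrite /concat lt_neqAle; move/eqP: rt' => ->; move: rtt'; rewrite in_itv/= => /andP[_ ->].
have P1 r : t <= r <= t' -> phi T f r t x (gamma v) v = phi T f r t x (gamma1 v) v.
  move=> rt'; apply: (@phi_unique t t' x _ _ (gamma1 v) v) => //.
  - exact: aelt.
  - exact: ae_refl_on.
  - by have := solves_ode_restrict (lexx t) t'T sp; rewrite phi0//; exact: cg1.
have P2 r : t' <= r <= T -> phi T f r t x (gamma v) v = phi T f r t' (X v) (g (X v) v) v.
  move=> rT; apply/esym; apply: (@phi_unique t' T _ _ _ (gamma v) v) => //.
  - exact: cg.
  - exact: rV.
  - by apply: aeW => s; rewrite in_itv/= /gamma /concat ltNge => /andP[-> _].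
  - exact: ae_refl_on.
  - have := solves_ode_restrict tt' (lexx T) sq; rewrite P1//.
    by rewrite tt' lexx.
have [_ hgX] := hg (X v).
have pX := hgX vX v (rV _ cv).
apply/payoff_leP => //; split.
  by rewrite P2 ?lexx ?t'T//; apply: le_trans pX; exact: payoff_ge_terminal.
move=> r /andP[tr rT]; have [rt'|t'r] := leP r t'.
  by rewrite P1 ?tr// (le_trans (hX r _)) ?tr// lerDl ltW.
rewrite P2 ?(ltW t'r)//; apply: le_trans pX.
by apply: payoff_ge_running; rewrite (ltW t'r).
Qed.

(** Once the opponent's control [v1] is frozen before [t'], [gamma] induces a strategy [g] from [t']
    on. Non-anticipation keeps the state at [t'] equal to [X] whatever the continuation, and the
    payoff from [t] dominates the one from [t']. *)
Lemma dpp_lower t t' x M : t <= t' -> t' <= T ->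
  (forall gamma, strategies U VV t T gamma -> exists2 v, controls VV t T v &
     M <= value T U VV f l h (phi T f t' t x (gamma v) v, t')) ->
  M <= value T U VV f l h (x, t).
Proof.
move=> tt' t'T hM; have tT := le_trans tt' t'T.
apply/ler_addgt0Pl => e e0; rewrite addrC -lerBlDr.
apply: (value_ge tT) => gamma [cg ng].
have [v1 cv1 Mv] := hM gamma (conj cg ng).
pose X := phi T f t' t x (gamma v1) v1.
pose g v := gamma (concat t' v1 v).
have cc v : controls VV t' T v -> controls VV t T (concat t' v1 v).
  by move=> cv; exact: controls_concat.
have sg : strategies U VV t' T g.
  split=> [v cv|s v v' sT cv cv' evv'].
    by apply: (controls_restrict tt' (lexx T)); apply: cg; exact: cc.
  have sT' : s \in `[t, T] by move: sT; rewrite !in_itv/= => /andP[t's ->]; rewrite (le_trans tt').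
  have := ng s _ _ sT' (cc v cv) (cc v' cv') => h1.
  have {}h1 := h1 _.
  have : {ae lebesgue_measure, forall r, r \in `[t, s] ->
      concat t' v1 v r = concat t' v1 v' r}.
    apply: ae_mono evv' => r hr rs; rewrite /concat; case: ltP => // t'r.
    by apply: hr; move: rs; rewrite !in_itv/= t'r => /andP[].
  move=> /h1; apply: ae_mono => r hr rs; apply: hr.
  by move: rs; rewrite !in_itv/= => /andP[t'r ->]; rewrite (le_trans tt').
have [v cv hv] : exists2 v, controls VV t' T v & M - e <= payoff T f l h t' X (g v) v.
  apply: contrapT => hn; suff : value T U VV f l h (X, t') <= M - e by rewrite -/X in Mv; lra.
  apply: (value_le t'T sg) => v cv; rewrite leNgt; apply/negP => /ltW hlt.
  by apply: hn; exists v.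
pose w := concat t' v1 v.
have cw : controls VV t T w by exact: cc.
exists w => //; apply: (le_trans hv).
have aelt : {ae lebesgue_measure, forall r, r \in `[t, t'] -> v1 r = w r}.
  exists [set t']; split => //; first exact: lebesgue_measure_set1.
  move=> r /= hr; apply: contrapT => rt'; apply: hr => rtt'.
  by rewrite /w /concat lt_neqAle; move/eqP: rt' => ->; move: rtt'; rewrite in_itv/= => /andP[_ ->].
have t'I : t' \in `[t, T] by rewrite in_itv/= tt'.
have sp := phi_solves x tT (cg _ cv1) cv1.
have sq := phi_solves x tT (cg _ cw) cw.
have PX : phi T f t' t x (gamma w) w = X.
  apply: (@phi_unique t t' x _ _ (gamma v1) v1
    (fun r => phi T f r t x (gamma v1) v1)) => //.
  - exact: cg.
  - exact: ng.
  - by have := solves_ode_restrict (lexx t) t'T sp; rewrite phi0//; exact: cg.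
  - by rewrite tt' lexx.
have P2 r : t' <= r <= T -> phi T f r t' X (g v) v = phi T f r t x (gamma w) w.
  move=> rT; apply: (@phi_unique t' T _ _ _ (gamma w) w) => //.
  - by have [+ _] := sg; apply.
  - exact: ae_refl_on.
  - by apply: aeW => s; rewrite in_itv/= /w /concat ltNge => /andP[-> _].
  - by have := solves_ode_restrict tt' (lexx T) sq; rewrite PX.
apply/payoff_leP => //; split.
  by rewrite P2 ?lexx ?t'T//; exact: payoff_ge_terminal.
move=> r /andP[t'r rT]; rewrite P2 ?t'r//; apply: payoff_ge_running.
by rewrite rT (le_trans tt').
Qed.

(** * Regularity of the value *)

Local Notation V := (value T U VV f l h).
Local Notation Lx := (2 * (Cl + Ch) * expR (2 * Cf * T)).

Lemma value_ge_obstacle t x : t <= T -> h x <= V (x, t).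
Proof.
move=> tT; apply: (value_ge tT) => gamma [cg _].
have [v cv] := controls_neq0 t VV_neq0; exists v => //.
rewrite -[X in h X <= _](phi0 x tT (cg _ cv) cv).
by apply: payoff_ge_running; rewrite lexx.
Qed.

Lemma value_terminal x : V (x, T) = Num.max (l x) (h x).
Proof.
have le0 : T <= T by [].
have eT r : T <= r <= T -> r = T by move=> /andP[h1 h2]; apply/eqP; rewrite eq_le h1 h2.
apply/eqP; rewrite eq_le; apply/andP; split.
  have [c Uc] := U_neq0; apply: (value_le le0 (strategies_cst T Uc)) => v cv.
  have cc : controls U T T (cst c) by exact: controls_cst.
  apply/payoff_leP => //; split => [|r /eT ->]; rewrite phi0//.
    by rewrite le_max lexx.
  by rewrite le_max lexx orbT.
rewrite ge_max value_ge_obstacle// andbT.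
apply: (value_ge le0) => gamma [cg _].
have [v cv] := controls_neq0 T VV_neq0; exists v => //.
rewrite -[X in l X <= _](phi0 x le0 (cg _ cv) cv); exact: payoff_ge_terminal.
Qed.

(** The same strategy is played from both points. In [Lx] the exponential and the factor 2 come from
    Gronwall, and [Cl + Ch] dominates both Lipschitz constants in the payoff. *)
Lemma value_lip_x x x' t : 0 <= t -> t <= T -> V (x, t) <= V (x', t) + Lx * `|x - x'|.
Proof.
move=> t0 tT; apply/ler_addgt0Pr => e e0; rewrite -addrA [_ + e]addrC addrA.
have hlt : V (x', t) < V (x', t) + e by rewrite ltrDl.
have [gamma sg hg] := value_lt tT hlt; apply: (value_le tT sg) => v cv.
have cg : controls U t T (gamma v) by case: sg => + _; apply.
have close (k : 'rV[R]_n -> R) Ck r : 0 < Ck -> Ck <= Cl + Ch ->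
    (forall x x', `|k x - k x'| <= Ck * `|x - x'|) -> t <= r <= T ->
    k (phi T f r t x (gamma v) v) <= k (phi T f r t x' (gamma v) v) + Lx * `|x - x'|.
  move=> Ck0 CkC lk rT; rewrite -lerBlDl (le_trans (ler_norm _))//.
  apply: (le_trans (lk _ _)).
  apply: (@le_trans _ _ ((Cl + Ch) * (2 * `|x - x'| * expR (2 * Cf * T)))).
    apply: ler_pM => //; first exact: ltW.
    apply: (le_trans (phi_dist x x' tT cg cv rT)).
    rewrite ler_wpM2l ?mulr_ge0// ler_expR ler_wpM2l ?mulr_ge0 ?(ltW Cf_gt0)//.
    by case/andP: rT => _; lra.
  by rewrite le_eqVlt; apply/orP; left; apply/eqP; ring.
have [hl hh] := (payoff_leP x' (gamma v) v _ tT).1 (hg v cv).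
apply/payoff_leP => //; split => [|r rT].
  apply: (le_trans (close l Cl T Cl_gt0 _ l_lipschitz _)); first by rewrite lerDl ltW.
    by rewrite tT lexx.
  by rewrite lerD2r.
apply: (le_trans (close h Ch r Ch_gt0 _ h_lipschitz rT)); first by rewrite lerDr ltW.
by rewrite lerD2r; exact: hh.
Qed.

(** Dynamic programming over [[t, t']], where the state moves by at most [Cf * (t' - t)]. The term
    [Ch] accounts for the obstacle along the way, compared with [h x <= V (x, t')]. *)
Lemma value_lip_t x t t' : 0 <= t -> t <= t' -> t' <= T ->
  `|V (x, t) - V (x, t')| <= (Lx + Ch) * Cf * (t' - t).
Proof.
move=> t0 tt' t'T; have tT := le_trans tt' t'T; have t'0 := le_trans t0 tt'.
have Lx0 : 0 <= Lx by rewrite !mulr_ge0 ?expR_ge0 ?addr_ge0 ?(ltW Cl_gt0) ?(ltW Ch_gt0).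
have Cft : 0 <= Cf * (t' - t) by rewrite mulr_ge0 ?subr_ge0// ltW.
have step u v : controls U t T u -> controls VV t T v ->
    `|phi T f t' t x u v - x| <= Cf * (t' - t).
  by move=> cu cv; apply: phi_lip => //; rewrite tt'.
rewrite ler_norml; apply/andP; split.
  rewrite lerBrDr addrC; apply: (dpp_lower tt' t'T) => gamma [cg _].
  have [v cv] := controls_neq0 t VV_neq0; exists v => //.
  have hs := step _ _ (cg _ cv) cv.
  have := value_lip_x x (phi T f t' t x (gamma v) v) t'0 t'T.
  rewrite distrC in hs; have := ler_wpM2l Lx0 hs.
  have : 0 <= Ch * (Cf * (t' - t)) by rewrite mulr_ge0// ltW.
  move: Lx => L; lra.
rewrite lerBlDl; have [c Uc] := U_neq0.
apply: (dpp_upper tt' t'T (strategies_cst t Uc)) => v cv /=.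
have cc : controls U t T (cst c) by exact: controls_cst.
have hs := step _ _ cc cv; split.
  have := value_lip_x (phi T f t' t x (cst c) v) x t'0 t'T.
  have := ler_wpM2l Lx0 hs.
  have : 0 <= Ch * (Cf * (t' - t)) by rewrite mulr_ge0// ltW.
  move: Lx => L; lra.
move=> r /andP[tr rt'].
have hr : `|phi T f r t x (cst c) v - x| <= Cf * (t' - t).
  apply: (@le_trans _ _ (Cf * (r - t))); first by apply: phi_lip => //; rewrite tr (le_trans rt').
  by rewrite ler_wpM2l ?lerB// ltW.
have := h_lipschitz (phi T f r t x (cst c) v) x.
have := ler_wpM2l (ltW Ch_gt0) hr; have := value_ge_obstacle x t'T.
have : 0 <= Lx * (Cf * (t' - t)) by rewrite mulr_ge0.
have := ler_norm (h (phi T f r t x (cst c) v) - h x).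
move: Lx => L; lra.
Qed.

Lemma value_continuous :
  {within [set z : 'rV[R]_n * R | z.2 \in `[0, T]], continuous V}.
Proof.
apply/subspace_continuousP => -[x t] /= tT; apply/cvgrPdist_lt => e e0.
have Lx0 : 0 <= Lx by rewrite !mulr_ge0 ?expR_ge0 ?addr_ge0 ?(ltW Cl_gt0) ?(ltW Ch_gt0).
pose K := Lx + (Lx + Ch) * Cf + 1.
have Ch0 := ltW Ch_gt0; have Cf0 := ltW Cf_gt0.
have LC0 : 0 <= (Lx + Ch) * Cf by rewrite mulr_ge0// addr_ge0.
have K0 : 0 < K by rewrite /K; move: Lx Lx0 LC0 => L; lra.
have eK : 0 < e / K by rewrite divr_gt0.
apply/nbhs_ballP; exists (e / K) => // -[x' t'] [/= xx tt] t'T.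
have {}xx : `|x - x'| < e / K by move: xx; rewrite mx_norm_ball.
have {}tt : `|t - t'| < e / K by [].
move: tT t'T; rewrite !in_itv/= => /andP[t0 tT] /andP[t'0 t'T].
have h1 : `|V (x, t) - V (x', t)| <= Lx * `|x - x'|.
  rewrite ler_norml; have := value_lip_x x x' t0 tT; have := value_lip_x x' x t0 tT.
  by rewrite [`|x' - x|]distrC; move: Lx => L; lra.
have h2 : `|V (x', t) - V (x', t')| <= (Lx + Ch) * Cf * `|t - t'|.
  have [tt'|t't] := leP t t'.
    have -> : `|t - t'| = t' - t by rewrite distrC ger0_norm ?subr_ge0.
    exact: value_lip_t.
  rewrite distrC [`|t - t'|]gtr0_norm ?subr_gt0//; apply: value_lip_t => //; exact: ltW.
rewrite (le_lt_trans (ler_distD (V (x', t)) _ _))//.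
rewrite (le_lt_trans (lerD h1 h2))//.
apply: (@le_lt_trans _ _ ((Lx + (Lx + Ch) * Cf) * (e / K))).
  by rewrite [leRHS]mulrDl lerD// ler_wpM2l// ltW.
have -> : Lx + (Lx + Ch) * Cf = K - 1 by rewrite /K addrK.
have -> : (K - 1) * (e / K) = e - e / K by field; rewrite gt_eqF.
lra.
Qed.

(** * The Hamiltonian and pointwise replies *)

Local Notation H := (hamiltonian U VV f).
Local Notation F x q u v := (\sum_(i < n) q 0 i * f x u v 0 i).

Lemma ham_term_bound x (q : 'rV[R]_n) u v : U u -> VV v ->
  `|F x q u v| <= \sum_(i < n) `|q 0 i| * Cf.
Proof.
move=> Uu Vv; apply: (le_trans (ler_norm_sum _ _ _)); apply: ler_sum => i _.
rewrite normrM ler_wpM2l//; apply: le_trans (f_bounded x Uu Vv).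
exact: ((rV_norm_leP _ (normr_ge0 _)).2 (lexx _) i).
Qed.

Lemma ham_has_inf x (q : 'rV[R]_n) v : VV v -> has_inf [set F x q u v | u in U].
Proof.
move=> Vv; split; first by have [u Uu] := U_neq0; exists (F x q u v), u.
exists (- \sum_(i < n) `|q 0 i| * Cf) => _ [u Uu <-].
by have := ham_term_bound x q Uu Vv; rewrite ler_norml => /andP[].
Qed.

Lemma ham_has_sup x (q : 'rV[R]_n) : has_sup [set inf [set F x q u v | u in U] | v in VV].
Proof.
split; first by have [v Vv] := VV_neq0; eexists; exists v.
exists (\sum_(i < n) `|q 0 i| * Cf) => _ [v Vv <-].
have [u Uu] := U_neq0; apply: (@le_trans _ _ (F x q u v)).
  by apply: ge_inf; [case: (ham_has_inf x q Vv)|exists u].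
by have := ham_term_bound x q Uu Vv; rewrite ler_norml => /andP[].
Qed.

Lemma ham_lt x q c : H x q < c -> forall v, VV v -> exists2 u, U u & F x q u v < c.
Proof.
move=> Hc v Vv; have hi : inf [set F x q u v | u in U] < c.
  by apply: le_lt_trans Hc; apply: sup_upper_bound; [exact: ham_has_sup|exists v].
have e0 : 0 < c - inf [set F x q u v | u in U] by rewrite subr_gt0.
have [_ [u Uu <-]] := inf_adherent e0 (ham_has_inf x q Vv).
by rewrite addrC subrK => lt; exists u.
Qed.

Lemma ham_gt x q c : c < H x q -> exists2 v, VV v & forall u, U u -> c < F x q u v.
Proof.
move=> cH; have e0 : 0 < H x q - c by rewrite subr_gt0.
have [_ [v Vv <-]] := sup_adherent e0 (ham_has_sup x q).
rewrite -/(H x q) opprB addrC subrK => lt; exists v => // u Uu.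
apply: (lt_le_trans lt); apply: ge_inf; first by case: (ham_has_inf x q Vv).
by exists u.
Qed.

Lemma ham_le x (q : 'rV[R]_n) x' (q' : 'rV[R]_n) d :
  (forall u v, U u -> VV v -> F x q u v <= F x' q' u v + d) ->
  H x q <= H x' q' + d.
Proof.
move=> hF; rewrite leNgt; apply/negP => lt.
pose c := (H x' q' + d + H x q) / 2.
have c1 : c < H x q by rewrite /c; lra.
have c2 : H x' q' < c - d by rewrite /c; lra.
have [v Vv hv] := ham_gt c1; have [u Uu hu] := ham_lt c2 Vv.
by have := hv u Uu; have := hF u v Uu Vv; lra.
Qed.

(** Since [c] acts on values of the opponent's control and not on time, [c \o w] is automatically
    non-anticipative; the countable range makes it measurable for every measurable [w]. *)
Lemma measurable_selection (P : 'rV[R]_m -> 'rV[R]_p -> Prop) :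
  (forall v, VV v -> exists2 u, U u &
     exists2 A, nbhs v A & forall v', A v' -> VV v' -> P u v') ->
  exists c, (forall v, VV v -> U (c v) /\ P (c v) v) /\
    (forall a b w, controls VV a b w -> controls U a b (c \o w)).
Proof.
move=> hP; have [u0 Uu0] := U_neq0.
pose J (j : nat) : 'rV[rat]_p * rat := odflt (0, 0) (unpickle j).
pose good j := exists2 u, U u & forall v, rat_ball (J j) v -> VV v -> P u v.
have /choice[uu huu] j : exists u, U u /\
    (good j -> forall v, rat_ball (J j) v -> VV v -> P u v).
  have [[u Uu h1]|ng] := pselect (good j); first by exists u.
  by exists u0.
pose Q (v : 'rV[R]_p) j := `[< good j /\ rat_ball (J j) v >].
have hQ v : VV v -> exists j, Q v j.
  move=> Vv; have [u Uu [A nA hA]] := hP v Vv.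
  have [j [jv jA]] := rat_ballP nA; exists (pickle j).
  apply/asboolP; rewrite /good /J pickleK/=; split => //.
  by exists u => // v' /jA; exact: hA.
(* The first rational ball around [v] on which one control works for all points. *)
pose c (v : 'rV[R]_p) := if pselect (exists j, Q v j) is left e then uu (ex_minn e) else u0.
exists c; split.
  move=> v Vv; rewrite /c; case: pselect => [e|]; last by move=> /(_ (hQ v Vv)).
  case: ex_minnP => j /asboolP[gj jv] _; have [h1 h2] := huu j; split => //.
  exact: h2.
move=> a b w [mw wV]; split; last first.
  move=> s sab; rewrite /c/=; case: pselect => // e.
  by have [] := huu (ex_minn e).
have mI : lmeasurable `[a, b]%classic by apply: borel_lmeasurable.
apply/lebesgue_measurable_funP => // B.
pose A i := if `[< good i >] then `[a, b]%classic `&` w @^-1` rat_ball (J i) else set0.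
have mA i : lmeasurable (A i).
  rewrite /A; case: ifP => _; last exact: measurable0.
  exact: (lebesgue_measurable_funP w mI).2 mw (J i).
(* [c] uses the least admissible index, so the set where index [j] is used is [A j] minus all
   earlier [A i]. *)
have -> : `[a, b]%classic `&` (c \o w) @^-1` rat_ball B =
    \bigcup_(j in (fun j : nat => rat_ball B (uu j)))
      (A j `\` \bigcup_(i in (fun i => (i < j)%N)) A i).
  apply/seteqP; split => [s [/= sab]|s [j /= jB [jA hj]]].
    rewrite /c; case: pselect => [e|]; last by move=> /(_ (hQ _ (wV _ sab))).
    case: ex_minnP => j /asboolP[gj jv] jmin hB; exists j => //; split.
      by rewrite /A asboolT.
    move=> [i /= ij]; rewrite /A; case: ifPn => // /asboolP gi [_ /= iw].
    have : Q (w s) i by apply/asboolP.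
    by move=> /jmin; rewrite leqNgt ij.
  move: jA; rewrite /A; case: ifPn => // /asboolP gj [/= sab js]; split => //=.
  rewrite /c; case: pselect => [e|]; last by move=> /(_ (hQ _ (wV _ sab))).
  case: ex_minnP => k /asboolP[gk kv] kmin.
  have : (k <= j)%N by apply: kmin; apply/asboolP.
  rewrite leq_eqVlt => /orP[/eqP -> //|kj].
  by exfalso; apply: hj; exists k => //; rewrite /A asboolT.
apply: lmeasurable_bigcup => j _; apply: measurableD; first exact: mA.
by apply: lmeasurable_bigcup => i _; exact: mA.
Qed.

(** * The value is a viscosity solution *)

(** The time [d] works for all controls at once, because every trajectory has speed at most [Cf].
    This uniformity is essential: [d] is fixed before the opponent plays. *)
Lemma test_along_trajectory (W : 'rV[R]_n * R -> R) x0 t0 e rho :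
  t0 \in `]0, T[ -> smooth_on [set z | z.2 \in `]0, T[] W -> 0 < e -> 0 < rho ->
  exists d, [/\ 0 < d, d <= rho, t0 + d <= T &
    forall u v, controls U t0 T u -> controls VV t0 T v ->
    let y s := phi T f s t0 x0 u v in
    [/\ forall s, t0 <= s <= t0 + d -> ball (x0, t0) rho (y s, s),
        ac_on t0 (t0 + d) (fun s => W (y s, s)) &
        {ae lebesgue_measure, forall s, s \in `[t0, t0 + d] ->
          exists2 c, is_derive s (1 : R) (fun s => W (y s, s)) c &
           `|c - (partial_t W (x0, t0) + F x0 (partial_x W (x0, t0)) (u s) (v s))| <= e}]].
Proof.
move=> t0T sW e0 rho0.
set D := [set z | _] in sW.
have oD : open D.
  rewrite (_ : D = snd @^-1` `]0, T[%classic)//.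
  by apply: open_comp; [move=> z _; exact: cvg_snd|exact: itv_open].
have Dz0 : D (x0, t0) by [].
set gt0 := partial_t W (x0, t0); set gx0 := partial_x W (x0, t0).
pose B := \sum_(i < n) `|gx0 0 i|.
have B0 : 0 <= B by apply: sumr_ge0.
have nC0 : 0 < 1 + n%:R * Cf by rewrite ltr_pwDl// mulr_ge0// ltW.
(* The error splits as [eta * (1 + n Cf)] for the variation of the partials of [W], and [e / 2] for
   that of [f] in the state. *)
pose eta := e / 2 / (1 + n%:R * Cf).
have eta0 : 0 < eta by rewrite !divr_gt0.
have [r r0 hr] := smooth_near oD sW Dz0 eta0.
have [t00 t0T'] : 0 < t0 /\ t0 < T by move: t0T; rewrite in_itv/= => /andP[].
have BC0 : 0 < B * Cf * Cf + 1 by rewrite ltr_wpDl// !mulr_ge0// ltW.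
have C10 : 0 < Cf + 1 by rewrite addr_gt0.
(* [d1] keeps the trajectory before [T] and the variation of [f] below [e / 2]; [d2] keeps the
   trajectory in the balls of radius [r] and [rho]. *)
pose d1 := Num.min (T - t0) (e / 2 / (B * Cf * Cf + 1)).
pose d2 := Num.min (r / 2 / (Cf + 1)) (rho / 2 / (Cf + 1)).
pose d := Num.min d1 d2.
have d0 : 0 < d by rewrite !lt_min subr_gt0 t0T' !divr_gt0.
have dT : d <= T - t0 by rewrite /d /d1 !ge_min lexx.
have de : B * Cf * Cf * d <= e / 2.
  have : d <= e / 2 / (B * Cf * Cf + 1) by rewrite /d /d1 !ge_min lexx orbT.
  by rewrite ler_pdivlMr// mulrDr mulr1 mulrC; have := ltW d0; lra.
have dCf : 0 < d * Cf by rewrite mulr_gt0.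
have dr : Cf * d < r /\ d < r.
  have : d <= r / 2 / (Cf + 1) by rewrite /d /d2 !ge_min lexx !orbT.
  by rewrite ler_pdivlMr// mulrDr mulr1 [Cf * d]mulrC => h1; split; lra.
have drho : Cf * d < rho /\ d < rho.
  have : d <= rho / 2 / (Cf + 1) by rewrite /d /d2 !ge_min lexx !orbT.
  by rewrite ler_pdivlMr// mulrDr mulr1 [Cf * d]mulrC => h1; split; lra.
exists d; split => //; [by apply: ltW; case: drho|by rewrite -lerBrDl|].
move=> u v cu cv y.
have tT : t0 <= T by exact: ltW.
have yx s : t0 <= s <= t0 + d -> `|y s - x0| <= Cf * d.
  move=> /andP[ts sd]; apply: (@le_trans _ _ (Cf * (s - t0))).
    by apply: phi_lip => //; rewrite ts; lra.
  by rewrite ler_wpM2l ?(ltW Cf_gt0)//; lra.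
have yball q s : Cf * d < q -> d < q -> t0 <= s <= t0 + d -> ball (x0, t0) q (y s, s).
  move=> h1 h2 sd; split => /=.
    by rewrite mx_norm_ball /ball_/= distrC (le_lt_trans (yx s sd)).
  by rewrite /ball/= distrC ger0_norm ?subr_ge0; case/andP: sd => //; lra.
have yD s : t0 <= s <= t0 + d -> ball (x0, t0) r (y s, s) by case: dr => *; exact: yball.
have ly := solves_ode_lip f_bounded cu cv (phi_solves x0 tT cu cv).
split.
- by move=> s sd; case: drho => *; exact: yball.
- pose G := B + `|gt0| + eta.
  have G0 : 0 <= G by rewrite !addr_ge0// ltW.
  have hG z : ball (x0, t0) r z -> [/\ D z, forall i, `|partial_x W z 0 i| <= G &
     `|partial_t W z| <= G].
    move=> /hr[Dz hx ht]; split => // [i|].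
      have : `|gx0 0 i| <= B by rewrite /B (bigD1 i)//= lerDl sumr_ge0.
      have := hx i; have := ler_normD (partial_x W z 0 i - gx0 0 i) (gx0 0 i).
      by rewrite subrK -/gx0 /G => h1 h2 h3; have := normr_ge0 gt0; lra.
    have := ler_normD (partial_t W z - gt0) gt0.
    by rewrite subrK /G => h1; rewrite -/gt0 in ht; lra.
  apply: (@lipschitz_ac_on _ _ _ _ ((n%:R + 1) * G * (Cf + 1))) => s t ts st td.
  have sd : t0 <= s <= t0 + d by rewrite ts (le_trans st).
  have tdd : t0 <= t <= t0 + d by rewrite td (le_trans ts).
  apply: (le_trans (smooth_lipschitz sW G0 hG (yD s sd) (yD t tdd))).
  rewrite -[leRHS]mulrA ler_wpM2l ?mulr_ge0//.
  rewrite prod_normE/= ge_max; apply/andP; split.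
    have tT2 : t <= T by lra.
    apply: (le_trans (ly s t ts st tT2)).
    by rewrite ler_wpM2r ?subr_ge0// lerDl.
  by rewrite ger0_norm ?subr_ge0// ler_peMl ?subr_ge0// lerDr ltW.
- have [_ _ dy] := phi_solves x0 tT cu cv.
  apply: ae_mono dy => s hs sd.
  have sd' : t0 <= s <= t0 + d by move: sd; rewrite in_itv.
  have sT : s \in `[t0, T] by move: sd'; rewrite in_itv/= => /andP[-> /= h1]; lra.
  have Uu : U (u s) by case: cu => _; apply.
  have Vv : VV (v s) by case: cv => _; apply.
  have [Dz hx ht] := hr _ (yD s sd').
  eexists; first exact: (is_derive_test (hs sT) (smooth_differentiable sW Dz)).
  rewrite -/(y s) opprD addrACA -sumrB.
  apply: (le_trans (ler_normD _ _)).
  have -> : e = eta + (n%:R * (eta * Cf) + e / 2).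
    have -> : eta + (n%:R * (eta * Cf) + e / 2) = eta * (1 + n%:R * Cf) + e / 2 by ring.
    by rewrite divfK ?gt_eqF// -splitr.
  apply: lerD => //; apply: (le_trans (ler_norm_sum _ _ _)).
  apply: (@le_trans _ _ (\sum_(i < n) (eta * Cf + `|gx0 0 i| * (Cf * (Cf * d))))).
    apply: ler_sum => i _.
    have fi : `|f (y s) (u s) (v s) 0 i| <= Cf.
      apply: le_trans (f_bounded (y s) Uu Vv).
      exact: ((rV_norm_leP _ (normr_ge0 _)).2 (lexx _) i).
    have fd : `|f (y s) (u s) (v s) 0 i - f x0 (u s) (v s) 0 i| <= Cf * (Cf * d).
      apply: (@le_trans _ _ `|f (y s) (u s) (v s) - f x0 (u s) (v s)|).
        have := (rV_norm_leP (f (y s) (u s) (v s) - f x0 (u s) (v s)) (normr_ge0 _)).2 (lexx _) i.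
        by rewrite !mxE.
      apply: (le_trans (f_lipschitz _ _ Uu Vv)); rewrite ler_wpM2l ?(ltW Cf_gt0)//.
      exact: yx.
    have -> : f (y s) (u s) (v s) 0 i * partial_x W (y s, s) 0 i -
        gx0 0 i * f x0 (u s) (v s) 0 i =
        (partial_x W (y s, s) 0 i - gx0 0 i) * f (y s) (u s) (v s) 0 i +
        gx0 0 i * (f (y s) (u s) (v s) 0 i - f x0 (u s) (v s) 0 i) by ring.
    apply: (le_trans (ler_normD _ _)); rewrite !normrM; apply: lerD.
      by apply: ler_pM => //; exact: hx.
    by rewrite ler_wpM2l.
  rewrite big_split/= sumr_const card_ord -(mulr_natl (eta * _)) lerD2l -mulr_suml -/B.
  by apply: le_trans de; rewrite !mulrA.
Qed.

Lemma value_viscosity_sub (W : 'rV[R]_n * R -> R) z0 :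
  z0.2 \in `]0, T[ -> smooth_on [set z | z.2 \in `]0, T[] W ->
  (\forall z \near z0, V z - W z <= V z0 - W z0) -> 0 <= vi_lhs U VV f h V W z0.
Proof.
case: z0 => x0 t0 /= t0T sW /nbhs_ballP[rho /= rho0 hrho].
rewrite leNgt; apply/negP; rewrite /vi_lhs gt_max/= => /andP[hV HW].
set gt0 := partial_t W _ in HW; set gx0 := partial_x W _ in HW.
rewrite subr_lt0 in hV.
(* The defect is [2 * th]: [th] is spent on choosing replies and [th / 2] on following the
   trajectory, so [W] still decreases at rate [th / 2]. *)
pose th := - (gt0 + H x0 gx0) / 2.
have th0 : 0 < th by rewrite /th; lra.
have Hlt : H x0 gx0 < - gt0 - th by rewrite /th; lra.
have [c [hc cc]] : exists c, (forall v, VV v -> U (c v) /\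
      F x0 gx0 (c v) v < - gt0 - th) /\
    (forall a b w, controls VV a b w -> controls U a b (c \o w)).
  apply: (@measurable_selection (fun u v => F x0 gx0 u v < - gt0 - th)) => v Vv.
  have [u Uu hu] := ham_lt Hlt Vv; exists u => //.
  pose k := - gt0 - th - F x0 gx0 u v.
  have k0 : 0 < k by rewrite subr_gt0.
  pose B := \sum_(i < n) `|gx0 0 i|.
  have B0 : 0 <= B by apply: sumr_ge0.
  have kB : 0 < k / (B + 1) by rewrite divr_gt0// ltr_wpDl.
  have [d d0 hd] := rhs_continuous_controls f_continuous x0 Uu Vv kB.
  exists (ball v d); first exact: nbhsx_ballx.
  move=> v' vv' Vv'; have := hd u v' Uu Vv' (ballxx _ d0) vv'.
  move=> /ltW hk.
  have : F x0 gx0 u v' - F x0 gx0 u v <= B * (k / (B + 1)).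
    rewrite -sumrB mulr_suml; apply: ler_sum => i _; rewrite -mulrBr.
    apply: (le_trans (ler_norm _)); rewrite normrM ler_wpM2l//.
    apply: le_trans hk.
    have := (rV_norm_leP (f x0 u v' - f x0 u v) (normr_ge0 _)).2 (lexx _) i.
    by rewrite !mxE.
  have : B * (k / (B + 1)) < k.
    rewrite mulrCA gtr_pMr// ltr_pdivrMr ?mul1r ?ltrDl//; lra.
  rewrite /k; lra.
pose gamma (v : R -> 'rV[R]_p) := c \o v.
have sg : strategies U VV t0 T gamma.
  split => [v cv|s v v' _ _ _ evv']; first exact: cc.
  by apply: ae_mono evv' => r hr rs; rewrite /gamma/= hr.
(* The second entry bounds [d] so that [h] rises along the trajectory by at most half of the gap
   [V - h]. *)
pose rho' := Num.min rho ((V (x0, t0) - h x0) / 2 / (Ch * Cf)).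
have ChCf : 0 < Ch * Cf by rewrite mulr_gt0.
have rho'0 : 0 < rho' by rewrite lt_min rho0 !divr_gt0// subr_gt0.
have th20 : 0 < th / 2 by rewrite divr_gt0.
have [d [d0 drho dT hd]] := test_along_trajectory x0 t0T sW th20 rho'0.
have [t00 t0T'] : 0 < t0 /\ t0 < T by move: t0T; rewrite in_itv/= => /andP[].
(* The first entry bounds the value at time [t0 + d], the second bounds [h] until then; both lie
   strictly below the value at the start. *)
pose M := Num.max (V (x0, t0) - th / 2 * d) ((V (x0, t0) + h x0) / 2).
have MV : M < V (x0, t0).
  by rewrite gt_max; apply/andP; split; [rewrite gtrBl mulr_gt0|lra].
have t0d : t0 <= t0 + d by rewrite lerDl ltW.
suff : V (x0, t0) <= M by rewrite leNgt MV.
apply: (dpp_upper t0d dT sg) => v cv.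
have cg : controls U t0 T (gamma v) by exact: cc.
have [yb yac yd] := hd _ _ cg cv.
split.
  rewrite le_max; apply/orP; left.
  have ybd : ball (x0, t0) rho (phi T f (t0 + d) t0 x0 (gamma v) v, t0 + d).
    apply: le_ball (yb (t0 + d) _); first by rewrite ge_min lexx.
    by rewrite t0d lexx.
  have := hrho _ ybd => /=.
  suff : W (phi T f (t0 + d) t0 x0 (gamma v) v, t0 + d) - W (x0, t0) <= - (th / 2 * d) by lra.
  have lin : ac_on t0 (t0 + d) (fun s : R => - (th / 2) * s).
    apply: (@lipschitz_ac_on _ _ _ _ (th / 2)) => s t _ st _.
    by rewrite -mulrBr normrM normrN !ger0_norm ?subr_ge0// ltW.
  have := ac_nonincreasing t0d (ac_onB yac lin).
  rewrite phi0// ?(ltW t0T')// => Hn; have {}Hn := Hn _.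
  suff h1 : {ae lebesgue_measure, forall s, s \in `[t0, t0 + d] ->
     exists2 q, q <= 0 & is_derive s (1 : R)
       (fun s => W (phi T f s t0 x0 (gamma v) v, s) - - (th / 2) * s) q}.
    by have := Hn h1; lra.
  apply: ae_mono yd => s hs sd; have [q dq hq] := hs sd.
  exists (q - - (th / 2)); last first.
    apply: is_deriveB; apply/is_derive1P => k k0; exists 1 => // t _.
    rewrite (_ : _ - _ = 0) ?normr0 ?mulr_ge0 ?(ltW k0)//.
    by rewrite -[_ *: _]/((t - s) * _); ring.
  have Vv : VV (v s) by case: cv => _; apply; move: sd; rewrite !in_itv/= => /andP[-> h1]; lra.
  have [_ hF] := hc _ Vv.
  move: hq; rewrite ler_norml -/gt0 -/gx0 => /andP[_]; rewrite /gamma/=; move: hF.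
  by rewrite -/(F x0 gx0 (c (v s)) (v s)); lra.
move=> r /andP[tr rd]; rewrite le_max; apply/orP; right.
have := h_lipschitz (phi T f r t0 x0 (gamma v) v) x0.
have : `|phi T f r t0 x0 (gamma v) v - x0| <= Cf * (r - t0).
  by apply: phi_lip => //; [exact: ltW|rewrite tr (le_trans rd)].
move=> /(ler_wpM2l (ltW Ch_gt0)) h1 /(le_trans (ler_norm _)) h2.
have : d <= (V (x0, t0) - h x0) / 2 / (Ch * Cf).
  by apply: (le_trans drho); rewrite ge_min lexx orbT.
rewrite ler_pdivlMr// => h3.
have : Ch * (Cf * (r - t0)) <= d * (Ch * Cf).
  by rewrite mulrA mulrC ler_wpM2r ?(ltW ChCf)//; lra.
lra.
Qed.

(** A constant control suffices for the opponent: some [v0] nearly attains the outer supremum at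
    [x0] against every reply, and for a short time it stays good along the trajectory. *)
Lemma value_viscosity_super (W : 'rV[R]_n * R -> R) z0 :
  z0.2 \in `]0, T[ -> smooth_on [set z | z.2 \in `]0, T[] W ->
  (\forall z \near z0, V z0 - W z0 <= V z - W z) -> vi_lhs U VV f h V W z0 <= 0.
Proof.
case: z0 => x0 t0 /= t0T sW /nbhs_ballP[rho /= rho0 hrho].
have [t00 t0T'] : 0 < t0 /\ t0 < T by move: t0T; rewrite in_itv/= => /andP[].
rewrite /vi_lhs ge_max/=; apply/andP; split.
  by rewrite subr_le0; apply: value_ge_obstacle; exact: ltW.
rewrite leNgt; apply/negP => HW.
set gt0 := partial_t W _ in HW; set gx0 := partial_x W _ in HW.
pose th := (gt0 + H x0 gx0) / 2.
have th0 : 0 < th by rewrite /th; lra.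
have Hgt : - gt0 + th < H x0 gx0 by rewrite /th; lra.
have [v0 Vv0 hv0] := ham_gt Hgt.
have th20 : 0 < th / 2 by rewrite divr_gt0.
have [d [d0 drho dT hd]] := test_along_trajectory x0 t0T sW th20 rho0.
have t0d : t0 <= t0 + d by rewrite lerDl ltW.
suff : V (x0, t0) + th / 2 * d <= V (x0, t0) by rewrite gerDl leNgt mulr_gt0.
apply: (dpp_lower t0d dT) => gamma [cg _].
have cv : controls VV t0 T (cst v0) by exact: controls_cst.
exists (cst v0) => //.
have [yb yac yd] := hd _ _ (cg _ cv) cv.
set y := phi T f (t0 + d) _ _ _ _.
have ybd : ball (x0, t0) rho (y, t0 + d) by apply: yb; rewrite t0d lexx.
have := hrho _ ybd => /=.
suff : th / 2 * d <= W (y, t0 + d) - W (x0, t0) by lra.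
have lin : ac_on t0 (t0 + d) (fun s : R => th / 2 * s).
  apply: (@lipschitz_ac_on _ _ _ _ (th / 2)) => s t _ st _.
  by rewrite -mulrBr normrM !ger0_norm ?subr_ge0// ltW.
have := ac_nonincreasing t0d (ac_onB lin yac).
rewrite phi0//; [|exact: ltW|exact: cg] => Hn; have {}Hn := Hn _.
suff h1 : {ae lebesgue_measure, forall s, s \in `[t0, t0 + d] ->
   exists2 q, q <= 0 & is_derive s (1 : R)
     (fun s => th / 2 * s - W (phi T f s t0 x0 (gamma (cst v0)) (cst v0), s)) q}.
  by have := Hn h1; rewrite -/y; lra.
apply: ae_mono yd => s hs sd; have [q dq hq] := hs sd.
exists (th / 2 - q); last first.
  apply: is_deriveB; apply/is_derive1P => k k0; exists 1 => // t _.
  rewrite (_ : _ - _ = 0) ?normr0 ?mulr_ge0 ?(ltW k0)//.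
  by rewrite -[_ *: _]/((t - s) * _); ring.
have Uu : U (gamma (cst v0) s).
  by have [_] := cg _ cv; apply; move: sd; rewrite !in_itv/= => /andP[-> h1]; lra.
have hF := hv0 _ Uu.
move: hq; rewrite ler_norml -/gt0 -/gx0 => /andP[+ _]; move: hF.
by set X := \sum_(i < n) _; rewrite /= -/X; lra.
Qed.

Lemma value_viscosity_solution : viscosity_solution T U VV f l h V.
Proof.
split; [exact: value_continuous|exact: value_terminal|].
move=> z0 W z0T sW; split; [exact: value_viscosity_sub|exact: value_viscosity_super].
Qed.

(** * Comparison *)

(** Only the jet [(a, b)] and a quadratic touching inequality remain, so the comparison argument
    never differentiates a test function. *)
Lemma viscosity_sub_jet (Vs : 'rV[R]_n * R -> R) z0 b a K :
  viscosity_solution T U VV f l h Vs -> z0.2 \in `]0, T[ ->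
  (\forall z \near z0, Vs z <= Vs z0 + quadratic z0 b a K z) ->
  0 <= Num.max (h z0.1 - Vs z0) (a + H z0.1 b).
Proof.
move=> [_ _ vs] z0T hq.
have sq := poly_smooth [set z | z.2 \in `]0, T[] (poly_quadratic z0 b a K).
have [+ _] := vs z0 _ z0T sq; rewrite /vi_lhs; have [-> ->] := partials_quadratic z0 b a K.
apply; apply: filterS hq => z; rewrite quadratic0 subr0; lra.
Qed.

Lemma viscosity_super_jet (Vs : 'rV[R]_n * R -> R) z0 b a K :
  viscosity_solution T U VV f l h Vs -> z0.2 \in `]0, T[ ->
  (\forall z \near z0, Vs z0 + quadratic z0 b a K z <= Vs z) ->
  Num.max (h z0.1 - Vs z0) (a + H z0.1 b) <= 0.
Proof.
move=> [_ _ vs] z0T hq.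
have sq := poly_smooth [set z | z.2 \in `]0, T[] (poly_quadratic z0 b a K).
have [_ +] := vs z0 _ z0T sq; rewrite /vi_lhs; have [-> ->] := partials_quadratic z0 b a K.
apply; apply: filterS hq => z; rewrite quadratic0 subr0; lra.
Qed.

(** The squared positive part is not twice differentiable, but it lies below its first-order
    expansion plus a square. This lets a quadratic test function dominate the penalty. *)
Lemma pos_part_sqr_le (b0 k : R) :
  Num.max (b0 + k) 0 ^+ 2 <= Num.max b0 0 ^+ 2 + 2 * Num.max b0 0 * k + k ^+ 2.
Proof. by case: (leP b0 0) => h1; case: (leP (b0 + k) 0) => h2; nra. Qed.

(* A difference of solutions that is positive at [(xb, tb)] stays positive inside
   the forward cone [cone >= 0, t1 <= t] of speed [c]: with [c >= n Cf], the
   penalty of [comparison_interior] is a strict supersolution of the linearized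
   inequality, and it is large on the lateral boundary, where [cone = 0]. *)
Definition cone (xb : 'rV[R]_n) (t1 c : R) (z : 'rV[R]_n * R) : R :=
  c ^+ 2 * (z.2 - t1) ^+ 2 - \sum_(i < n) (z.1 0 i - xb 0 i) ^+ 2.

Lemma poly_cone xb t1 c : polynomial_fun (cone xb t1 c).
Proof.
have -> : cone xb t1 c = (fun z : 'rV[R]_n * R => c ^+ 2 * (z.2 - t1) ^+ 2) \+
  (fun z : 'rV[R]_n * R => - \sum_(i < n) (z.1 0 i - xb 0 i) ^+ 2) by [].
apply: poly_add.
  by apply: poly_scale; apply: poly_sqr; apply: poly_sub_cst; exact: poly_time.
have -> : (fun z : 'rV[R]_n * R => - \sum_(i < n) (z.1 0 i - xb 0 i) ^+ 2) =
  (fun z => -1 * \sum_(i < n) (z.1 0 i - xb 0 i) ^+ 2).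
  by apply/funext => z; rewrite mulN1r.
apply: poly_scale; apply: poly_sum => i; apply: poly_sqr; apply: poly_sub_cst.
exact: poly_coord.
Qed.

Lemma cone_coord xb t1 c (z : 'rV[R]_n * R) i : 0 <= c -> t1 <= z.2 -> 0 <= cone xb t1 c z ->
  `|z.1 0 i - xb 0 i| <= c * (z.2 - t1).
Proof.
move=> c0 tz; rewrite /cone subr_ge0 -exprMn => hz.
have ct : 0 <= c * (z.2 - t1) by rewrite mulr_ge0 ?subr_ge0.
rewrite -(@ler_pXn2r _ 2%N)// ?nnegrE// real_normK ?num_real//.
apply: le_trans hz; rewrite (bigD1 i)//= lerDl sumr_ge0// => j _; exact: sqr_ge0.
Qed.

Lemma cone_compact xb t1 c : 0 <= c ->
  compact [set z : 'rV[R]_n * R | t1 <= z.2 <= T /\ 0 <= cone xb t1 c z].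
Proof.
move=> c0; pose r := c * (T - t1).
have cB : compact [set x : 'rV[R]_n | `|x - xb| <= r].
  apply: bounded_closed_compact.
    exists (`|xb| + r); split; first exact: num_real.
    move=> M hM x /= hx; apply: le_trans (ltW hM).
    by rewrite -lerBlDl (le_trans (lerB_dist _ _)).
  have -> : [set x : 'rV[R]_n | `|x - xb| <= r] = closed_ball_ (fun x => `|x|) xb r.
    by apply/seteqP; split => x; rewrite /closed_ball_/= distrC.
  exact: closed_closed_ball_.
have cI : compact `[t1, T]%classic by exact: segment_compact.
apply: (@subclosed_compact _ _ ([set x : 'rV[R]_n | `|x - xb| <= r] `*` `[t1, T]%classic)).
- have -> : [set z : 'rV[R]_n * R | t1 <= z.2 <= T /\ 0 <= cone xb t1 c z] =
    (snd @^-1` `[t1, T]%classic) `&` (cone xb t1 c @^-1` [set s | 0 <= s]).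
    by apply/seteqP; split => z /=; rewrite in_itv.
  apply: closedI.
    by apply: closed_comp => [z _|]; [exact: cvg_snd|exact: itv_closed].
  apply: closed_comp => [z _|]; last exact: closed_ge.
  by apply: poly_continuous; exact: poly_cone.
- exact: compact_setX.
- move=> z [/andP[tz zT] hz]; split => /=; last by rewrite in_itv/= tz.
  have r0 : 0 <= r by rewrite mulr_ge0// subr_ge0 (le_trans tz).
  apply/rV_norm_leP => // i; rewrite !mxE.
  by apply: (le_trans (cone_coord i c0 tz hz)); rewrite ler_wpM2l// lerB.
Qed.

(** Squared so as to bound the quadratic remainder of [pos_part_sqr_le] by [dist2]. In the constant,
    [2 * c ^+ 2 * T] comes from time and [2 * c * T] from each of the [n] coordinates. *)
Lemma cone_lipschitz xb t1 c (y z : 'rV[R]_n * R) : 0 <= c -> 0 <= t1 ->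
  t1 <= y.2 <= T /\ 0 <= cone xb t1 c y -> t1 <= z.2 <= T /\ 0 <= cone xb t1 c z ->
  (cone xb t1 c y - cone xb t1 c z) ^+ 2 <=
    (2 * c ^+ 2 * T + 2 * n%:R * (c * T)) ^+ 2 * dist2 y z.
Proof.
move=> c0 t10 [/andP[t1y yT] zy] [/andP[t1z zT] zz].
have T0 : 0 <= T by rewrite (le_trans t10)// (le_trans t1y).
set L := _ + 2 * n%:R * _.
have L0 : 0 <= L by rewrite /L addr_ge0 ?mulr_ge0 ?sqr_ge0.
have h1 : `|cone xb t1 c y - cone xb t1 c z| <= L * `|y - z|.
  have -> : cone xb t1 c y - cone xb t1 c z =
     c ^+ 2 * ((y.2 - z.2) * (y.2 + z.2 - 2 * t1)) -
     \sum_(i < n) (y.1 0 i - z.1 0 i) * ((y.1 0 i - xb 0 i) + (z.1 0 i - xb 0 i)).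
    have -> : \sum_(i < n) (y.1 0 i - z.1 0 i) * ((y.1 0 i - xb 0 i) + (z.1 0 i - xb 0 i)) =
      \sum_(i < n) (y.1 0 i - xb 0 i) ^+ 2 - \sum_(i < n) (z.1 0 i - xb 0 i) ^+ 2.
      by rewrite -sumrB; apply: eq_bigr => i _; ring.
    by rewrite /cone; ring.
  have ny2 : `|y.2 - z.2| <= `|y - z| by rewrite prod_normE le_max lexx orbT.
  have ny1 i : `|y.1 0 i - z.1 0 i| <= `|y - z|.
    apply: (@le_trans _ _ `|y.1 - z.1|); last by rewrite prod_normE le_max lexx.
    by have := (rV_norm_leP (y.1 - z.1) (normr_ge0 _)).2 (lexx _) i; rewrite !mxE.
  apply: (le_trans (ler_normB _ _)); rewrite /L [leRHS]mulrDl; apply: lerD.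
    rewrite normrM (ger0_norm (sqr_ge0 c)) normrM.
    have hT : `|y.2 + z.2 - 2 * t1| <= 2 * T by rewrite ler_norml; lra.
    have := ler_pM (normr_ge0 _) (normr_ge0 _) ny2 hT.
    by move=> /(ler_wpM2l (sqr_ge0 c)); lra.
  apply: (le_trans (ler_norm_sum _ _ _)).
  apply: (@le_trans _ _ (\sum_(i < n) `|y - z| * (2 * (c * T)))).
    apply: ler_sum => i _; rewrite normrM; apply: ler_pM => //.
    apply: (le_trans (ler_normD _ _)).
    have hy := cone_coord i c0 t1y zy; have hz := cone_coord i c0 t1z zz.
    have hy' : c * (y.2 - t1) <= c * T by rewrite ler_wpM2l//; lra.
    have hz' : c * (z.2 - t1) <= c * T by rewrite ler_wpM2l//; lra.
    lra.
  rewrite sumr_const card_ord -(mulr_natl (`|y - z| * _)) le_eqVlt.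
  by apply/orP; left; apply/eqP; ring.
rewrite -real_normK ?num_real//.
have : `|cone xb t1 c y - cone xb t1 c z| ^+ 2 <= (L * `|y - z|) ^+ 2.
  by rewrite lerXn2r ?nnegrE ?mulr_ge0.
move=> /le_trans; apply; rewrite exprMn ler_wpM2l ?sqr_ge0//; exact: norm_dist2.
Qed.

(** Exact expansion of a quadratic with the favourable term in [c ^+ 2] dropped. The one-sided bound
    suffices because it is multiplied by the nonnegative slope [g]. *)
Lemma cone_decrease_le xb t1 c (y z : 'rV[R]_n * R) :
  cone xb t1 c z - cone xb t1 c y <=
    - (2 * c ^+ 2 * (z.2 - t1)) * (y.2 - z.2)
    + \sum_(i < n) 2 * (z.1 0 i - xb 0 i) * (y.1 0 i - z.1 0 i) + dist2 y z.
Proof.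
rewrite /cone /dist2.
have -> : \sum_(i < n) (y.1 0 i - xb 0 i) ^+ 2 =
  \sum_(i < n) (z.1 0 i - xb 0 i) ^+ 2 +
  \sum_(i < n) 2 * (z.1 0 i - xb 0 i) * (y.1 0 i - z.1 0 i)
  + \sum_(i < n) (y.1 0 i - z.1 0 i) ^+ 2.
  by rewrite -!big_split/=; apply: eq_bigr => i _; ring.
have : 0 <= c ^+ 2 * (y.2 - z.2) ^+ 2 by rewrite mulr_ge0 ?sqr_ge0.
have := sqr_ge0 (y.2 - z.2); lra.
Qed.

Lemma comparison_interior (V1 V2 : 'rV[R]_n * R -> R) xb tb :
  viscosity_solution T U VV f l h V1 -> viscosity_solution T U VV f l h V2 ->
  tb \in `]0, T[ -> V1 (xb, tb) <= V2 (xb, tb).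
Proof.
move=> vs1 vs2 tbT; rewrite leNgt; apply/negP => lt12.
have [tb0 tbT'] : 0 < tb /\ tb < T by move: tbT; rewrite in_itv/= => /andP[].
pose th := V1 (xb, tb) - V2 (xb, tb).
have th0 : 0 < th by rewrite subr_gt0.
(* A vertex strictly between times 0 and [tb] keeps the cone away from time 0 and puts [zb] strictly
   inside it. *)
pose t1 := tb / 2; have t10 : 0 < t1 by rewrite divr_gt0.
have t1b : t1 < tb by rewrite /t1; lra.
(* The added 1 keeps the cone nondegenerate when [n = 0]. *)
pose c := n%:R * Cf + 1.
have nCf0 : 0 <= n%:R * Cf by rewrite mulr_ge0// ltW.
have c0 : 0 < c by rewrite ltr_wpDl.
pose zeta := cone xb t1 c.
pose Q := [set z : 'rV[R]_n * R | t1 <= z.2 <= T /\ 0 <= zeta z].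
have cQ : compact Q by apply: cone_compact; exact: ltW.
pose zb := (xb, tb).
have zetab : zeta zb = c ^+ 2 * (tb - t1) ^+ 2.
  by rewrite /zeta /cone/= big1 ?subr0// => i _; rewrite subrr expr0n.
have zetab0 : 0 < zeta zb by rewrite zetab mulr_gt0// exprn_gt0// subr_gt0.
have Qb : Q zb by split; [rewrite (ltW t1b) ltW|exact: ltW].
have Qstrip : Q `<=` [set z | z.2 \in `[0, T]].
  by move=> z [/andP[h1 h2] _] /=; rewrite in_itv/= h2 (le_trans (ltW t10)).
have [cV1 term1 _] := vs1; have [cV2 term2 _] := vs2.
have cV1Q := continuous_subspaceW Qstrip cV1.
have cV2Q := continuous_subspaceW Qstrip cV2.
have [zm Qm hm] := compact_EVT_max (ex_intro _ zb Qb) cQ cV1Q.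
have [zl Ql hl] := compact_EVT_min (ex_intro _ zb Qb) cQ cV2Q.
pose M := V1 zm - V2 zl.
have hM z : Q z -> V1 z - V2 z <= M by move=> Qz; rewrite /M lerB ?hm ?hl ?inE.
(* This weight makes the penalty exceed [M] where [zeta = 0]. *)
pose kap := (`|M| + 1) / zeta zb ^+ 2.
have kap0 : 0 < kap by rewrite divr_gt0 ?exprn_gt0// ltr_wpDl.
have T1 : 0 < T + 1 by lra.
(* The term [sig * (T - t)] provides strictness, at a cost of at most [th / 2] at [zb], where the
   other penalty vanishes. *)
pose sig := th / 2 / (T + 1).
have sig0 : 0 < sig by rewrite !divr_gt0.
pose pp z := Num.max (zeta zb - zeta z) 0.
have pp0 z : 0 <= pp z by rewrite le_max lexx orbT.
pose psi z := kap * pp z ^+ 2 + sig * (T - z.2).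
have psib : psi zb <= th / 2.
  rewrite /psi /pp subrr maxxx expr0n mulr0 add0r /sig -mulrA ler_piMr//; first lra.
  by rewrite mulrC ler_pdivrMr//=; lra.
have psi0 z : Q z -> 0 <= psi z.
  move=> [/andP[_ zT] _]; rewrite addr_ge0// mulr_ge0 ?sqr_ge0 ?subr_ge0// ltW//.
pose A z := V1 z - psi z.
have czeta : continuous zeta by apply: poly_continuous; exact: poly_cone.
have cpsi : continuous psi.
  move=> z; apply: cvgD.
    apply: cvgM; first exact: cvg_cst.
    have -> : (fun z => pp z ^+ 2) = (fun z => pp z * pp z) by apply/funext => y; rewrite expr2.
    have cpp : pp x @[x --> z] --> pp z.
      apply: (@continuous_max _ _ (fun z => zeta zb - zeta z) (fun=> 0)).
        by apply: cvgB; [exact: cvg_cst|exact: czeta].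
      exact: cvg_cst.
    exact: cvgM.
  apply: cvgM; first exact: cvg_cst.
  by apply: cvgB; [exact: cvg_cst|exact: cvg_snd].
have cA : {within Q, continuous A}.
  have cpsiQ : {within Q, continuous psi} by exact: continuous_subspaceT.
  by move=> z; apply: cvgB; [exact: cV1Q|exact: cpsiQ].
(* The final time is excluded by the common terminal data, the lateral boundary by the penalty, and
   the time [t1] because the cone has no positive point there. *)
have interior z : Q z -> 0 < A z - V2 z -> [/\ z.2 \in `]0, T[, t1 < z.2 & 0 < zeta z].
  move=> /[dup] Qz [/andP[t1z zT] zz] hA.
  have zT' : z.2 < T.
    rewrite lt_neqAle zT andbT; apply/eqP => e; move: hA; rewrite /A.
    have -> : V1 z = V2 z by case: z {Qz t1z zT zz} e => x t /= ->; rewrite term1 term2.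
    by have := psi0 z Qz; lra.
  have zz' : 0 < zeta z.
    rewrite lt_neqAle zz andbT; apply/eqP => e; move: hA; rewrite /A /psi /pp -e subr0.
    rewrite (max_idPl (ltW zetab0)) /kap divfK ?gt_eqF ?exprn_gt0//.
    have := hM z Qz; have := ler_norm M.
    have : 0 <= sig * (T - z.2) by rewrite mulr_ge0 ?subr_ge0// ltW.
    lra.
  have t1z' : t1 < z.2.
    rewrite lt_neqAle t1z andbT; apply/eqP => e; move: zz'; rewrite /zeta /cone -e subrr.
    rewrite expr0n mulr0 sub0r oppr_gt0 ltNge sumr_ge0// => i _; exact: sqr_ge0.
  by split => //; rewrite in_itv/= zT' (lt_trans t10).
have near_Q z : Q z -> 0 < A z - V2 z -> \forall y \near z, Q y.
  move=> Qz hA; have [zT t1z zz] := interior z Qz hA.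
  have csnd : {for z, continuous (@snd 'rV[R]_n R)} by exact: cvg_snd.
  have h1 : \forall y \near z, t1 < y.2 by exact: (csnd [set s | t1 < s] (lt_nbhsr t1z)).
  have h2 : \forall y \near z, y.2 < T.
    have zT' : z.2 < T by move: zT; rewrite in_itv/= => /andP[].
    exact: (csnd [set s | s < T] (lt_nbhsl zT')).
  have h3 : \forall y \near z, 0 < zeta y by exact: (czeta z [set s | 0 < s] (lt_nbhsr zz)).
  by apply: filterS3 h1 h2 h3 => y y1 y2 y3; split; [rewrite !ltW|exact: ltW].
(* The three bounds serve, in order, to keep both doubled points where [A] exceeds [V2], to treat
   the obstacle, and to keep the Hamiltonian error below [sig]. *)
pose e := Num.min (th / 8) (Num.min (th / 8 / Ch) (sig / 2 / (2 * (n%:R * Cf) + 1))).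
have nC1 : 0 < 2 * (n%:R * Cf) + 1 by lra.
have e0 : 0 < e by rewrite !lt_min !divr_gt0.
have e1 : e <= th / 8 by rewrite /e ge_min lexx.
have e2 : Ch * e <= th / 8.
  by rewrite mulrC -ler_pdivlMr// /e !ge_min lexx !orbT.
have e3 : 2 * (n%:R * Cf) * e < sig.
  have : e <= sig / 2 / (2 * (n%:R * Cf) + 1) by rewrite /e !ge_min lexx !orbT.
  by rewrite ler_pdivlMr//; lra.
have [N [z [z' [N0 [Qz Qz'] hb [hmax hmin] [hAA hBB hN hzz]]]]] :=
  doubling cQ cA cV2Q Qb e0.
have hb' : th / 2 <= A z - V2 z'.
  by apply: le_trans hb; rewrite /A -/th; move: psib; rewrite /th /zb; lra.
have Az : 0 < A z - V2 z by move: hBB; rewrite ler_norml => /andP[]; lra.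
have Az' : 0 < A z' - V2 z' by move: hAA; rewrite ler_norml => /andP[]; lra.
have [zT t1z zz] := interior z Qz Az.
have [z'T t1z' zz'] := interior z' Qz' Az'.
(* [(a', b')] is the gradient of the doubling term; [(a, b)] adds to it the gradient of [psi] at
   [z], where [g] is the derivative of the squared positive part times [kap]. *)
pose b' := \row_(i < n) (2 * N * (z.1 0 i - z'.1 0 i)).
pose a' := 2 * N * (z.2 - z'.2).
pose g := 2 * kap * pp z.
have g0 : 0 <= g by rewrite mulr_ge0// mulr_ge0// ltW.
pose b := \row_(i < n) (g * (2 * (z.1 0 i - xb 0 i)) + 2 * N * (z.1 0 i - z'.1 0 i)).
pose a := - (g * (2 * c ^+ 2 * (z.2 - t1))) - sig + 2 * N * (z.2 - z'.2).
have super : Num.max (h z'.1 - V2 z') (a' + H z'.1 b') <= 0.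
  apply: (@viscosity_super_jet V2 z' b' a' (- N) vs2 z'T).
  apply: filterS (near_Q z' Qz' Az') => y Qy; have := hmin y Qy.
  suff -> : quadratic z' b' a' (- N) y = N * dist2 z z' - N * dist2 z y by lra.
  rewrite /quadratic /dist2 /b' /a' !mulNr !mulrDr !mulr_sumr.
  under eq_bigr do rewrite mxE.
  have -> : \sum_(i < n) N * (z.1 0 i - z'.1 0 i) ^+ 2 =
     \sum_(i < n) 2 * N * (z.1 0 i - z'.1 0 i) * (y.1 0 i - z'.1 0 i) -
     \sum_(i < n) N * (y.1 0 i - z'.1 0 i) ^+ 2 +
     \sum_(i < n) N * (z.1 0 i - y.1 0 i) ^+ 2.
    by rewrite -sumrB -big_split/=; apply: eq_bigr => i _; ring.
  ring.
pose L := 2 * c ^+ 2 * T + 2 * n%:R * (c * T).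
have zeta_lip y : Q y -> (zeta y - zeta z) ^+ 2 <= L ^+ 2 * dist2 y z.
  by move=> Qy; apply: cone_lipschitz => //; exact: ltW.
have sub : 0 <= Num.max (h z.1 - V1 z) (a + H z.1 b).
  (* The curvature collects [N] from doubling, [g] from the expansion of the cone, and
     [kap * L ^+ 2] from the squared positive part. *)
  apply: (@viscosity_sub_jet V1 z b a (N + g + kap * L ^+ 2) vs1 zT).
  apply: filterS (near_Q z Qz Az) => y Qy; have := hmax y Qy; rewrite /A.
  have psile : psi y - psi z <= kap * (2 * pp z * (zeta z - zeta y) +
      (zeta z - zeta y) ^+ 2) - sig * (y.2 - z.2).
    have := pos_part_sqr_le (zeta zb - zeta z) (zeta z - zeta y).
    rewrite addrA subrK -/(pp y) -/(pp z) => /(ler_wpM2l (ltW kap0)).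
    by rewrite /psi; lra.
  have := ler_wpM2l (ltW kap0) (zeta_lip y Qy).
  have -> : (zeta y - zeta z) ^+ 2 = (zeta z - zeta y) ^+ 2 by ring.
  have gz : g * (zeta z - zeta y) <= g * (- (2 * c ^+ 2 * (z.2 - t1)) * (y.2 - z.2)
      + \sum_(i < n) 2 * (z.1 0 i - xb 0 i) * (y.1 0 i - z.1 0 i) + dist2 y z).
    by rewrite ler_wpM2l//; exact: cone_decrease_le.
  have -> : quadratic z b a (N + g + kap * L ^+ 2) y =
     g * (- (2 * c ^+ 2 * (z.2 - t1)) * (y.2 - z.2)
      + \sum_(i < n) 2 * (z.1 0 i - xb 0 i) * (y.1 0 i - z.1 0 i) + dist2 y z)
     - sig * (y.2 - z.2) + kap * (L ^+ 2 * dist2 y z)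
     + (N * dist2 y z' - N * dist2 z z').
    have -> : N * dist2 y z' - N * dist2 z z' = N * dist2 y z +
       2 * N * (z.2 - z'.2) * (y.2 - z.2) +
       \sum_(i < n) 2 * N * (z.1 0 i - z'.1 0 i) * (y.1 0 i - z.1 0 i).
      rewrite /dist2.
      have -> : \sum_(i < n) (y.1 0 i - z'.1 0 i) ^+ 2 =
        \sum_(i < n) (y.1 0 i - z.1 0 i) ^+ 2 + \sum_(i < n) (z.1 0 i - z'.1 0 i) ^+ 2 +
        \sum_(i < n) 2 * (z.1 0 i - z'.1 0 i) * (y.1 0 i - z.1 0 i).
        by rewrite -!big_split/=; apply: eq_bigr => i _; ring.
      have -> : \sum_(i < n) 2 * N * (z.1 0 i - z'.1 0 i) * (y.1 0 i - z.1 0 i) =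
        N * \sum_(i < n) 2 * (z.1 0 i - z'.1 0 i) * (y.1 0 i - z.1 0 i).
        by rewrite mulr_sumr; apply: eq_bigr => i _; ring.
      ring.
    rewrite /quadratic.
    have -> : \sum_(i < n) b 0 i * (y.1 0 i - z.1 0 i) =
      g * \sum_(i < n) 2 * (z.1 0 i - xb 0 i) * (y.1 0 i - z.1 0 i) +
      \sum_(i < n) 2 * N * (z.1 0 i - z'.1 0 i) * (y.1 0 i - z.1 0 i).
      by rewrite mulr_sumr -big_split/=; apply: eq_bigr => i _; rewrite mxE; ring.
    rewrite /a; ring.
  move=> h1 h2; move: gz psile; rewrite /g; lra.
move: super; rewrite ge_max => /andP[hV2 HV2].
(* If the obstacle is active for [V1], then [h z.1] exceeds [h z'.1] by at least [th / 2], which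
   nearby points forbid. *)
move: sub; rewrite le_max => /orP[hV1|HV1].
  have := h_lipschitz z.1 z'.1 => /(le_trans (ler_norm _)) hh.
  have hz1 : `|z.1 - z'.1| <= e.
    by apply: le_trans hzz; rewrite prod_normE le_max lexx.
  have := ler_wpM2l (ltW Ch_gt0) hz1; have := psi0 z Qz.
  by move: hb'; rewrite /A; lra.
(* In the cone the space gradient of the penalty costs at most what its time derivative gains, since
   [n Cf <= c]. What is left is [- sig] plus a doubling error smaller than [sig]. *)
have : H z.1 b <= H z'.1 b' + (g * (2 * c ^+ 2 * (z.2 - t1)) + 2 * (n%:R * Cf) * e).
  apply: ham_le => u v Uu Vv; rewrite -lerBlDl -sumrB.
  have fb i : `|f z.1 u v 0 i| <= Cf.
    apply: le_trans (f_bounded z.1 Uu Vv).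
    exact: ((rV_norm_leP _ (normr_ge0 _)).2 (lexx _) i).
  have nz1 : `|z.1 - z'.1| <= `|z - z'| by rewrite prod_normE le_max lexx.
  have fl i : `|f z.1 u v 0 i - f z'.1 u v 0 i| <= Cf * `|z - z'|.
    apply: (@le_trans _ _ `|f z.1 u v - f z'.1 u v|).
      have := (rV_norm_leP (f z.1 u v - f z'.1 u v) (normr_ge0 _)).2 (lexx _) i.
      by rewrite !mxE.
    by apply: (le_trans (f_lipschitz _ _ Uu Vv)); rewrite ler_wpM2l// ltW.
  have zi i : `|z.1 0 i - z'.1 0 i| <= `|z - z'|.
    apply: le_trans nz1.
    by have := (rV_norm_leP (z.1 - z'.1) (normr_ge0 _)).2 (lexx _) i; rewrite !mxE.
  have Nzz : N * `|z - z'| ^+ 2 <= e.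
    by apply: le_trans hN; rewrite ler_wpM2l ?(ltW N0)//; exact: norm_dist2.
  pose r := c * (z.2 - t1).
  have r0 : 0 <= r by rewrite mulr_ge0 ?(ltW c0)// subr_ge0 ltW.
  apply: (@le_trans _ _ (\sum_(i < n) (g * (2 * (r * Cf)) + 2 * (Cf * e)))).
    apply: ler_sum => i _; rewrite !mxE.
    have -> : (g * (2 * (z.1 0 i - xb 0 i)) + 2 * N * (z.1 0 i - z'.1 0 i)) * f z.1 u v 0 i -
      2 * N * (z.1 0 i - z'.1 0 i) * f z'.1 u v 0 i =
      g * (2 * ((z.1 0 i - xb 0 i) * f z.1 u v 0 i)) +
      2 * (N * ((z.1 0 i - z'.1 0 i) * (f z.1 u v 0 i - f z'.1 u v 0 i))) by ring.
    apply: lerD.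
      rewrite ler_wpM2l// ler_wpM2l//; apply: (le_trans (ler_norm _)).
      rewrite normrM ler_pM//; exact: cone_coord i (ltW c0) (ltW t1z) (ltW zz).
    rewrite ler_wpM2l//.
    apply: (@le_trans _ _ (N * (`|z - z'| * (Cf * `|z - z'|)))).
      rewrite ler_wpM2l ?(ltW N0)//; apply: (le_trans (ler_norm _)).
      by rewrite normrM ler_pM.
    have := ler_wpM2l (ltW Cf_gt0) Nzz; rewrite expr2; lra.
  rewrite sumr_const card_ord -(mulr_natl (_ + _)) mulrDr.
  have -> : n%:R * (2 * (Cf * e)) = 2 * (n%:R * Cf) * e by ring.
  rewrite lerD2r.
  have -> : n%:R * (g * (2 * (r * Cf))) = g * (2 * (n%:R * Cf * r)) by ring.
  have -> : 2 * c ^+ 2 * (z.2 - t1) = 2 * (c * r) by rewrite /r; ring.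
  rewrite ler_wpM2l// ler_wpM2l// ler_wpM2r// /c; lra.
by move: HV1 HV2; rewrite /a /a'; lra.
Qed.

(** The viscosity inequalities hold only at interior times; continuity from slightly later times
    reaches [t = 0], and the terminal condition settles [t = T]. *)
Lemma comparison (V1 V2 : 'rV[R]_n * R -> R) x t :
  viscosity_solution T U VV f l h V1 -> viscosity_solution T U VV f l h V2 ->
  t \in `[0, T] -> V1 (x, t) <= V2 (x, t).
Proof.
move=> vs1 vs2; rewrite in_itv/= => /andP[t0 tT].
have [cV1 term1 _] := vs1; have [cV2 term2 _] := vs2.
have [->|tT'] := eqVneq t T; first by rewrite term1 term2.
have ltT : t < T by rewrite lt_neqAle tT'.
apply/ler_addgt0Pr => e e0; have e20 : 0 < e / 2 by rewrite divr_gt0.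
have tI : t \in `[0, T] by rewrite in_itv/= t0.
move/subspace_continuousP/(_ (x, t) tI)/cvgrPdist_lt/(_ _ e20)/nbhs_ballP : cV1.
move=> [d1 /= d10 hd1].
move/subspace_continuousP/(_ (x, t) tI)/cvgrPdist_lt/(_ _ e20)/nbhs_ballP : cV2.
move=> [d2 /= d20 hd2].
pose d := Num.min (T - t) (Num.min d1 d2).
have d0 : 0 < d by rewrite !lt_min subr_gt0 ltT d10.
have dT : d <= T - t by rewrite /d ge_min lexx.
have dd1 : d <= d1 by rewrite /d !ge_min lexx !orbT.
have dd2 : d <= d2 by rewrite /d !ge_min lexx !orbT.
pose s := t + d / 2.
have sT : s \in `]0, T[ by rewrite in_itv/= /s; lra.
have sI : s \in `[0, T] by rewrite in_itv/= /s; lra.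
have bs r : d <= r -> ball (x, t) r (x, s).
  move=> dr; split => /=; first by apply: ballxx; apply: lt_le_trans dr.
  by rewrite /ball/= /s opprD addrA subrr sub0r normrN gtr0_norm; lra.
have := hd1 (x, s) (bs _ dd1) sI; have := hd2 (x, s) (bs _ dd2) sI.
have := comparison_interior x vs1 vs2 sT.
by rewrite /from_subspace !ltr_norml => ? /andP[? ?] /andP[? ?]; lra.
Qed.

End game.

Theorem theorem1 (R : realType) (n m p : nat) (T : R)
    (U : set 'rV[R]_m) (VV : set 'rV[R]_p)
    (f : 'rV[R]_n -> 'rV[R]_m -> 'rV[R]_p -> 'rV[R]_n)
    (l h : 'rV[R]_n -> R) (Cf Cl Ch : R)
    (T_ge0 : 0 <= T)
    (U_neq0 : U !=set0) (U_compact : compact U)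
    (VV_neq0 : VV !=set0) (VV_compact : compact VV)
    (Cf_gt0 : 0 < Cf) (Cl_gt0 : 0 < Cl) (Ch_gt0 : 0 < Ch)
    (f_continuous : forall x : 'rV[R]_n,
      {within U `*` VV, continuous (fun w : 'rV[R]_m * 'rV[R]_p => f x w.1 w.2)})
    (f_bounded : forall x u v, U u -> VV v -> `|f x u v| <= Cf)
    (f_lipschitz : forall x x' u v, U u -> VV v ->
      `|f x u v - f x' u v| <= Cf * `|x - x'|)
    (l_bounded : forall x, `|l x| <= Cl)
    (l_lipschitz : forall x x', `|l x - l x'| <= Cl * `|x - x'|)
    (h_bounded : forall x, `|h x| <= Ch)
    (h_lipschitz : forall x x', `|h x - h x'| <= Ch * `|x - x'|) :
  viscosity_solution T U VV f l h (value T U VV f l h) /\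
  (forall V : 'rV[R]_n * R -> R,
     viscosity_solution T U VV f l h V ->
     forall (x : 'rV[R]_n) (t : R), t \in `[0, T] ->
       V (x, t) = value T U VV f l h (x, t)).
Proof.
have vs : viscosity_solution T U VV f l h (value T U VV f l h).
  exact: (value_viscosity_solution U_neq0 VV_neq0 Cf_gt0 Cl_gt0 Ch_gt0 f_continuous
    f_bounded f_lipschitz l_bounded l_lipschitz h_bounded h_lipschitz).
split => // V vV x t tT; apply/eqP; rewrite eq_le.
have cmp := comparison U_neq0 VV_neq0 Cf_gt0 Ch_gt0 f_bounded f_lipschitz h_lipschitz.
by apply/andP; split; [exact: cmp vV vs tT|exact: cmp vs vV tT].
Qed.
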